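(* Let $T>0$, let $n,m,k\ge 1$ be integers, and let the data satisfy the following three sets of assumptions. (a) $A,C\in L^\infty(0,T;\mathbb{R}^{n\times n})$, $B,D\in L^\infty(0,T;\mathbb{R}^{n\times k})$, $\widehat A\in L^\infty(0,T;\mathbb{R}^{m\times n})$, $\widehat B\in L^\infty(0,T;\mathbb{R}^{m\times k})$, $\widehat C,\widehat D\in L^\infty(0,T;\mathbb{R}^{m\times m})$, $H\in\mathbb{R}^{m\times n}$, $Q\in C([0,T]^2;\mathbb{S}^n)$, $R\in C([0,T]^2;\mathbb{S}^k)$, $M,N\in C([0,T]^2;\mathbb{S}^m)$, $G_1\in C([0,T];\mathbb{S}^n)$, $G_2\in C([0,T];\mathbb{S}^m)$. (b) There is a constant $\delta>0$ such that for all $0\le t\le s\le T$: $R(t,s)\ge\delta I$, $G_2(t)\ge\delta I$, $Q(t,s)\ge0$, $M(t,s)\ge0$, $N(t,s)\ge0$, $G_1(t)\ge0$. (c) There are positive definite matrices $\widehat Q,\widehat R,\widehat M,\widehat N,\widehat G_1,\widehat G_2$ such that for all $0\le t\le\tau\le s\le T$: $Q(t,s)\le Q(\tau,s)\le\widehat Q$, $R(t,s)\le R(\tau,s)\le\widehat R$, $M(t,s)\le M(\tau,s)\le\widehat M$, $N(t,s)\le N(\tau,s)\le\widehat N$, $G_1(t)\le G_1(\tau)\le\widehat G_1$, $G_2(t)\le G_2(\tau)\le\widehat G_2$. Then the equilibrium Riccati equation (ERE, defined in the context) admits a unique solution $(P_1,P_2)\in C(\Delta^*[0,T];\mathbb{S}^n_+)\times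 C([0,T];\mathbb{R}^{m\times n})$. Furthermore, $$\sup_{t\in[0,T]}\big|P_1(t,t)+P_2(t)^\top G_2(t)P_2(t)\big|\le \mathcal{C}^*_{\mathbb V},$$ where, with $\widehat{\mathcal G}=\max\{|\widehat G_1|,|\widehat G_2|\}$, $$\mathcal{C}^*_{\mathbb V}=\Big[\widehat{\mathcal G}+\widehat{\mathcal G}|H|^2+\int_0^T\big(|\widehat Q|+\widehat{\mathcal G}^2|\widehat A(s)|^2\big)ds\Big]\exp\Big\{\int_0^T\Big[2|A(s)|+|C(s)|^2+\frac n\delta\big(1+|\widehat M|+|\widehat N||C(s)|^2+2\widehat{\mathcal G}|\widehat C(s)|+2\widehat{\mathcal G}|C(s)||\widehat D(s)|\big)\Big]ds\Big\}.$$
   Context: Notation: $\mathbb{S}^n$ is the space of symmetric real $n\times n$ matrices, $\mathbb{S}^n_+$ the subset of positive semi-definite ones; matrix inequalities are in the positive semi-definite order; $|\cdot|$ is the spectral norm. $\Delta^*[0,T]=\{(t,s)\in[0,T]^2: t\le s\}$. For a function $\Theta$ with values in $\mathbb{R}^{k\times n}$ put $$A_\Theta=A+B\Theta,\qquad C_\Theta=C+D\Theta,\qquad \widehat A_\Theta=\widehat A+\widehat B\Theta .$$ Equilibrium Riccati equation (ERE): the unknown is the pair $(P_1(\cdot,\cdot),P_2(\cdot))$, and the equation is $$\begin{cases} \frac{d}{ds}P_1(t,s)+P_1(t,s)A_\Theta(s)+A_\Theta(s)^\top P_1(t,s)+C_\Theta(s)^\top P_1(t,s)C_\Theta(s)+Q(t,s)+\Theta(s)^\top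 R(t,s)\Theta(s)\\ \quad+P_2(s)^\top M(t,s)P_2(s)+C_\Theta(s)^\top P_2(s)^\top N(t,s)P_2(s)C_\Theta(s)=0,\qquad 0\le t\le s\le T,\\ \frac{d}{ds}P_2(s)+P_2(s)A_\Theta(s)+\widehat A_\Theta(s)+\widehat C(s)P_2(s)+\widehat D(s)P_2(s)C_\Theta(s)=0,\qquad 0\le s\le T,\\ P_1(t,T)=G_1(t),\quad P_2(T)=H,\qquad 0\le t\le T, \end{cases}$$ where $\Theta$ is the function of $(P_1,P_2)$ given by $$\begin{aligned}\Theta(s)=&-\big[R(s,s)+D(s)^\top\big(P_1(s,s)+P_2(s)^\top N(s,s)P_2(s)\big)D(s)\big]^{-1}\big[B(s)^\top P_1(s,s)\\&+D(s)^\top\big(P_1(s,s)+P_2(s)^\top N(s,s)P_2(s)\big)C(s)+\big(\widehat B(s)^\top+B(s)^\top P_2(s)^\top+D(s)^\top P_2(s)^\top\widehat D(s)^\top\big)G_2(s)P_2(s)\big].\end{aligned}$$ Since the coefficients are only bounded and measurable in $s$, the differential equations are understood for almost every $s$ (equivalently, in integrated form in $s$). *)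

(* Defs.v *)
From HB Require Import structures.
From mathcomp Require Import all_boot all_order all_algebra.
From mathcomp Require Import all_classical all_reals all_analysis.

Set Implicit Arguments.
Unset Strict Implicit.
Unset Printing Implicit Defensive.

Import Order.TTheory GRing.Theory Num.Theory.
Import numFieldNormedType.Exports.

Local Open Scope classical_set_scope.
Local Open Scope ring_scope.

Definition symmx (R : realType) (n : nat) (A : 'M[R]_n) : Prop := A^T = A.

Definition psd (R : realType) (n : nat) (A : 'M[R]_n) : Prop :=
  symmx A /\ forall x : 'cV[R]_n, 0 <= (x^T *m A *m x) 0 0.

Definition posdef (R : realType) (n : nat) (A : 'M[R]_n) : Prop :=
  symmx A /\ forall x : 'cV[R]_n, x != 0 -> 0 < (x^T *m A *m x) 0 0.

Definition lemx (R : realType) (n : nat) (A B : 'M[R]_n) : Prop := psd (B - A).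

Definition enorm (R : realType) (n : nat) (x : 'cV[R]_n) : R :=
  Num.sqrt (\sum_i x i 0 ^+ 2).

(* The library's norm on matrices is the largest absolute value of an entry;
   the spectral norm is the operator norm induced by the Euclidean norms. *)
Definition specnorm (R : realType) (p q : nat) (A : 'M[R]_(p, q)) : R :=
  sup [set enorm (A *m x) | x in [set x : 'cV[R]_q | enorm x <= 1]].

Definition square (R : realType) (T : R) : set (R * R) :=
  [set p | 0 <= p.1 <= T /\ 0 <= p.2 <= T].

Definition triangle (R : realType) (T : R) : set (R * R) :=
  [set p | 0 <= p.1 /\ p.1 <= p.2 /\ p.2 <= T].

(* L^oo(0,T; R^{p x q}); only the values on [0,T] matter. *)
Definition Linfty (R : realType) (T : R) (p q : nat) (F : R -> 'M[R]_(p, q)) :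
    Prop :=
  (forall i j, measurable_fun `[0, T] (fun s => F s i j)) /\
  exists K : R, {ae (@lebesgue_measure R), forall s, s \in `[0, T] ->
    forall i j, `|F s i j| <= K}.

Definition continuous_sym1 (R : realType) (T : R) (p : nat) (F : R -> 'M[R]_p) :
    Prop :=
  {within `[0, T], continuous F} /\ forall t, 0 <= t <= T -> symmx (F t).

Definition continuous_sym2 (R : realType) (T : R) (p : nat)
    (F : R -> R -> 'M[R]_p) : Prop :=
  {within square T, continuous (fun z : R * R => F z.1 z.2)} /\
  forall t s, square T (t, s) -> symmx (F t s).

(* The suffix h stands for the hat: cAh is \widehat A, and so on. *)
Record ere_data (R : realType) (n m k : nat) := EreData {
  cA : R -> 'M[R]_n;
  cB : R -> 'M[R]_(n, k);
  cC : R -> 'M[R]_n;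
  cD : R -> 'M[R]_(n, k);
  cAh : R -> 'M[R]_(m, n);
  cBh : R -> 'M[R]_(m, k);
  cCh : R -> 'M[R]_m;
  cDh : R -> 'M[R]_m;
  cH : 'M[R]_(m, n);
  cQ : R -> R -> 'M[R]_n;
  cR : R -> R -> 'M[R]_k;
  cM : R -> R -> 'M[R]_m;
  cN : R -> R -> 'M[R]_m;
  cG1 : R -> 'M[R]_n;
  cG2 : R -> 'M[R]_m
}.

(* invmx is total, but the matrix inverted here is a unit as soon as
   R(s,s) >= delta I with delta > 0, N(s,s) >= 0 and P1(s,s) >= 0. *)
Definition Theta (R : realType) (n m k : nat) (E : ere_data R n m k)
    (P1 : R -> R -> 'M[R]_n) (P2 : R -> 'M[R]_(m, n)) (s : R) : 'M[R]_(k, n) :=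
  let P := P1 s s + (P2 s)^T *m cN E s s *m P2 s in
  - (invmx (cR E s s + (cD E s)^T *m P *m cD E s) *m
     ((cB E s)^T *m P1 s s + (cD E s)^T *m P *m cC E s
      + ((cBh E s)^T + (cB E s)^T *m (P2 s)^T
         + (cD E s)^T *m (P2 s)^T *m (cDh E s)^T) *m cG2 E s *m P2 s)).

(* The ERE reads  d/ds P1(t,s) + ere_rhs1 t s = 0,  d/ds P2(s) + ere_rhs2 s = 0. *)
Definition ere_rhs1 (R : realType) (n m k : nat) (E : ere_data R n m k)
    (P1 : R -> R -> 'M[R]_n) (P2 : R -> 'M[R]_(m, n)) (t s : R) : 'M[R]_n :=
  let Th := Theta E P1 P2 s in
  let ATh := cA E s + cB E s *m Th in
  let CTh := cC E s + cD E s *m Th in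
  P1 t s *m ATh + ATh^T *m P1 t s + CTh^T *m P1 t s *m CTh
  + cQ E t s + Th^T *m cR E t s *m Th
  + (P2 s)^T *m cM E t s *m P2 s
  + CTh^T *m (P2 s)^T *m cN E t s *m P2 s *m CTh.

Definition ere_rhs2 (R : realType) (n m k : nat) (E : ere_data R n m k)
    (P1 : R -> R -> 'M[R]_n) (P2 : R -> 'M[R]_(m, n)) (s : R) : 'M[R]_(m, n) :=
  let Th := Theta E P1 P2 s in
  let ATh := cA E s + cB E s *m Th in
  let CTh := cC E s + cD E s *m Th in
  let AhTh := cAh E s + cBh E s *m Th in
  P2 s *m ATh + AhTh + cCh E s *m P2 s + cDh E s *m P2 s *m CTh.

Definition mx_integrable (R : realType) (p q : nat) (a b : R)
    (F : R -> 'M[R]_(p, q)) : Prop :=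
  forall i j,
    (@lebesgue_measure R).-integrable `[a, b] (fun r => (F r i j)%:E).

Definition mx_integral (R : realType) (p q : nat) (a b : R)
    (F : R -> 'M[R]_(p, q)) : 'M[R]_(p, q) :=
  \matrix_(i, j) \int[@lebesgue_measure R]_(r in `[a, b]) F r i j.

(* (P1, P2) in C(Delta^*[0,T]; S^n_+) x C([0,T]; R^{m x n}) solves the ERE.
   The coefficients are only measurable in s, so the equations are in integrated
   form; the terminal conditions are the cases s = T. *)
Definition ere_solution (R : realType) (T : R) (n m k : nat)
    (E : ere_data R n m k)
    (P1 : R -> R -> 'M[R]_n) (P2 : R -> 'M[R]_(m, n)) : Prop :=
  [/\ {within triangle T, continuous (fun z : R * R => P1 z.1 z.2)},
      forall t s, triangle T (t, s) -> psd (P1 t s),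
      {within `[0, T], continuous P2},
      forall t s, triangle T (t, s) ->
        mx_integrable s T (ere_rhs1 E P1 P2 t) /\
        P1 t s = cG1 E t + mx_integral s T (ere_rhs1 E P1 P2 t) &
      forall s, 0 <= s <= T ->
        mx_integrable s T (ere_rhs2 E P1 P2) /\
        P2 s = cH E + mx_integral s T (ere_rhs2 E P1 P2)].

Definition CstarV (R : realType) (T : R) (n m k : nat) (E : ere_data R n m k)
    (delta : R) (Qh : 'M[R]_n) (Mh Nh : 'M[R]_m)
    (G1h : 'M[R]_n) (G2h : 'M[R]_m) : R :=
  let G := Num.max (specnorm G1h) (specnorm G2h) in
  (G + G * specnorm (cH E) ^+ 2
   + \int[@lebesgue_measure R]_(s in `[0, T])
       (specnorm Qh + G ^+ 2 * specnorm (cAh E s) ^+ 2))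
  * expR (\int[@lebesgue_measure R]_(s in `[0, T])
      (2 * specnorm (cA E s) + specnorm (cC E s) ^+ 2
       + n%:R / delta *
         (1 + specnorm Mh + specnorm Nh * specnorm (cC E s) ^+ 2
          + 2 * G * specnorm (cCh E s)
          + 2 * G * specnorm (cC E s) * specnorm (cDh E s)))).

(* Main.v *)
(** Fix the feedback Theta. Then P1(t, .) solves a linear Lyapunov equation whose
    data are positive semi-definite and increase with t; hence P1 >= 0, and
    P1(t, s) <= P1(tau, s) for t <= tau <= s. The diagonal
    V(s) = P1(s,s) + P2(s)^T G2(s) P2(s) therefore satisfies
    V(t) <= V(s) + int_t^s F(r, Theta(r)) dr, where F is quadratic in the control
    and Theta minimizes it. Comparing with the zero control and using Gronwall
    gives the bound on V (with 1/delta, hence with n/delta), and so a bound on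
    P1 <= V and on |P2|^2 <= V/delta that no solution can exceed.

    Clamping the entries of (P1, P2) and regularizing the inverse in Theta makes
    the equation globally Lipschitz: it has a unique solution on [0,T]^2, found by
    Picard iteration in an exponentially weighted norm. Going backwards from T, the
    a priori bound shows that the clamping is never active. Every solution of the
    ERE obeys the same bound, hence solves the clamped equation too, which gives
    uniqueness.

    The coefficients are only measurable, so differential inequalities are replaced
    by increments over short intervals: if Phi(s) <= Phi(s') + o(s' - s) uniformly
    for s <= s', then Phi(a) <= Phi(b) for all a <= b. *)

Require Import Defs.
From HB Require Import structures.
From mathcomp Require Import all_boot all_order all_algebra.
From mathcomp Require Import all_classical all_reals all_analysis.
From mathcomp Require Import perm measurable_realfun ring lra.

Set Implicit Arguments.
Unset Strict Implicit.
Unset Printing Implicit Defensive.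

Import Order.TTheory GRing.Theory Num.Theory.
Import numFieldNormedType.Exports.

Local Open Scope classical_set_scope.
Local Open Scope ring_scope.

(** * Bounded measurable functions and their integrals *)

(** The system is nonlocal: the row P1(t, .) is driven through Theta by the diagonal P1(r, r). The
    data depend on t only continuously and monotonically, so V need not be absolutely continuous and
    is never differentiated. Monotonicity supplies the sign instead: moving the first argument up
    from s to r, or from s to s', only increases the quadratic forms. Bilinear terms have no sign,
    but uniform continuity makes their error o(1), hence o(s' - s) after integration.

    The order of the a priori argument matters. Positivity and monotonicity of P1 hold for every
    bounded feedback; only then is the matrix inverted in Theta known to be coercive, so that the
    regularized inverse is the true one, the feedback is optimal, and the bound on V follows. All
    this is available only on an interval [a, T] where the clamping is already known to be inactive.
    There the bound lies below the clamping level by a margin of 1, and the clamped solution is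
    Lipschitz in s with a constant L independent of a, so each step backwards may have any length
    below 1/L. *)

Section Nice.
Context (R : realType) (D : set R) (Z : Type) (close : R -> Z -> Z -> Prop)
  (adm : (R -> Z) -> Prop).

(* Z is a space of parameters, close d z z' says that z and z' are at distance at
   most d, and adm singles out the curves in Z along which phi is measurable. *)
Definition nice (phi : R -> Z -> R) : Prop :=
  (forall g, adm g -> measurable_fun D (fun r => phi r (g r))) /\
  exists b : R, 0 <= b /\ forall r, D r ->
    (forall z, `|phi r z| <= b) /\
    (forall d z z', 0 <= d -> close d z z' -> `|phi r z - phi r z'| <= b * d).

Definition nicemx p q (F : R -> Z -> 'M[R]_(p, q)) : Prop :=
  forall i j, nice (fun r z => F r z i j).

Lemma eq_nice (phi psi : R -> Z -> R) :
  (forall r z, psi r z = phi r z) -> nice phi -> nice psi.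
Proof.
by move=> e; have -> : psi = phi by apply/funext => r; apply/funext => z.
Qed.

Lemma nice_fun (f : R -> R) (b : R) : measurable_fun D f ->
  (forall r, D r -> `|f r| <= b) -> nice (fun r _ => f r).
Proof.
move=> mf fb; split=> //; exists (Num.max b 0); split=> [|r Dr].
  by rewrite le_max lexx orbT.
split=> [_|d z z' d0 _]; first by rewrite le_max fb.
by rewrite subrr normr0 mulr_ge0// le_max lexx orbT.
Qed.

Lemma nice_cst (c : R) : nice (fun _ _ => c).
Proof. by apply: (@nice_fun (cst c) `|c|). Qed.

Lemma niceD phi psi : nice phi -> nice psi -> nice (fun r z => phi r z + psi r z).
Proof.
move=> [mf [b [b0 fb]]] [mg [c [c0 gc]]]; split=> [g ag|].
  by apply: measurable_funD; [exact: mf | exact: mg].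
exists (b + c); split=> [|r Dr]; first exact: addr_ge0.
have [fb1 fb2] := fb r Dr; have [gc1 gc2] := gc r Dr.
split=> [z|d z z' d0 zz']; first by rewrite (le_trans (ler_normD _ _))// lerD.
rewrite opprD addrACA (le_trans (ler_normD _ _))// mulrDl.
by rewrite lerD// (fb2, gc2).
Qed.

Lemma niceM phi psi : nice phi -> nice psi -> nice (fun r z => phi r z * psi r z).
Proof.
move=> [mf [b [b0 fb]]] [mg [c [c0 gc]]]; split=> [g ag|].
  by apply: measurable_funM; [exact: mf | exact: mg].
exists (b * c + b * c); split=> [|r Dr]; first by rewrite addr_ge0// mulr_ge0.
have [fb1 fb2] := fb r Dr; have [gc1 gc2] := gc r Dr.
split=> [z|d z z' d0 zz'].
  by rewrite normrM -[leLHS]addr0 lerD ?mulr_ge0// ler_pM.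
have -> : phi r z * psi r z - phi r z' * psi r z' =
  phi r z * (psi r z - psi r z') + (phi r z - phi r z') * psi r z' by ring.
rewrite (le_trans (ler_normD _ _))// !normrM mulrDl lerD//.
  by rewrite -mulrA ler_pM// gc2.
by rewrite mulrAC ler_pM// fb2.
Qed.

Lemma niceN phi : nice phi -> nice (fun r z => - phi r z).
Proof.
move=> np; have := niceM (nice_cst (-1)) np.
by under [X in nice X -> _]eq_fun do under eq_fun do rewrite mulN1r.
Qed.

Lemma niceB phi psi : nice phi -> nice psi -> nice (fun r z => phi r z - psi r z).
Proof. by move=> np nq; apply: niceD => //; exact: niceN. Qed.

Lemma nice_sum (I : Type) (s : seq I) (P : pred I) (phi : I -> R -> Z -> R) :
  (forall i, nice (phi i)) -> nice (fun r z => \sum_(i <- s | P i) phi i r z).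
Proof.
move=> np; elim: s => [|i s IH].
  under eq_fun do under eq_fun do rewrite big_nil.
  exact: nice_cst.
under eq_fun do under eq_fun do rewrite big_cons.
by case: (P i) => //; apply: niceD.
Qed.

Lemma nice_prod (I : Type) (s : seq I) (P : pred I) (phi : I -> R -> Z -> R) :
  (forall i, nice (phi i)) -> nice (fun r z => \prod_(i <- s | P i) phi i r z).
Proof.
move=> np; elim: s => [|i s IH].
  under eq_fun do under eq_fun do rewrite big_nil.
  exact: nice_cst.
under eq_fun do under eq_fun do rewrite big_cons.
by case: (P i) => //; apply: niceM.
Qed.

Lemma nice_max phi (c : R) : nice phi -> nice (fun r z => Num.max (phi r z) c).
Proof.
move=> [mf [b [b0 fb]]]; split=> [g ag|].
  by apply: (@measurable_maxr _ _ _ _ (fun r => phi r (g r)) (cst c));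
    [exact: mf | exact: measurable_cst].
exists (b + `|c|); split=> [|r Dr]; first exact: addr_ge0.
have [fb1 fb2] := fb r Dr; split=> [z|d z z' d0 zz'].
  by case: (leP (phi r z) c) => _; rewrite ?(le_trans (fb1 z))// ?lerDl ?lerDr.
have /le_trans -> // : `|Num.max (phi r z) c - Num.max (phi r z') c| <=
    `|phi r z - phi r z'|.
  case: (leP (phi r z) c) => h; case: (leP (phi r z') c) => h'.
  - by rewrite subrr normr0.
  - by rewrite ler0_norm ?ler0_norm; lra.
  - by rewrite ger0_norm ?ger0_norm; lra.
  - by [].
by rewrite (le_trans (fb2 _ _ _ d0 zz'))// ler_wpM2r// lerDl.
Qed.

Lemma nice_inv phi (e : R) : 0 < e -> (forall r z, D r -> e <= phi r z) ->
  nice phi -> nice (fun r z => (phi r z)^-1).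
Proof.
move=> e0 ep [mf [b [b0 fb]]]; split=> [g ag|].
  apply: (@eq_measurable_fun _ _ _ _ D (fun r => phi r (g r) `^ (-1))).
    move=> r /set_mem Dr; rewrite powR_inv1// (le_trans (ltW e0))//; exact: ep.
  by apply: (measurableT_comp (measurable_powR (-1))); exact: mf.
exists (e^-1 + b / e ^+ 2); split=> [|r Dr].
  by rewrite addr_ge0 ?invr_ge0 ?divr_ge0 ?exprn_ge0 ?(ltW e0).
have [fb1 fb2] := fb r Dr.
have p0 z : 0 < phi r z by exact: lt_le_trans (ep _ _ Dr).
have pe z : (phi r z)^-1 <= e^-1 by rewrite lef_pV2 ?posrE// ep.
split=> [z|d z z' d0 zz'].
  rewrite ger0_norm ?invr_ge0 ?(ltW (p0 _))// (le_trans (pe z))// lerDl.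
  by rewrite divr_ge0 ?exprn_ge0 ?(ltW e0).
have -> : (phi r z)^-1 - (phi r z')^-1 =
    (phi r z' - phi r z) * ((phi r z)^-1 * (phi r z')^-1).
  by field; rewrite !gt_eqF.
rewrite normrM distrC (@ger0_norm _ (_^-1 * _)); last first.
  by rewrite mulr_ge0// invr_ge0 ltW.
apply: (@le_trans _ _ (b * d * (e^-1 * e^-1))).
  rewrite ler_pM ?mulr_ge0 ?invr_ge0 ?(ltW (p0 _)) ?fb2//.
  by rewrite ler_pM ?invr_ge0 ?(ltW (p0 _)).
have -> : b * d * (e^-1 * e^-1) = b / e ^+ 2 * d.
  by rewrite expr2 invfM -!mulrA [d * _]mulrC !mulrA.
by rewrite ler_wpM2r// lerDr invr_ge0 ltW.
Qed.

Lemma nicemx_entry p q (F : R -> Z -> 'M[R]_(p, q)) i j :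
  nicemx F -> nice (fun r z => F r z i j).
Proof. exact. Qed.

Lemma nicemx_cst p q (M : 'M[R]_(p, q)) : nicemx (fun _ _ => M).
Proof. by move=> i j; exact: nice_cst. Qed.

Lemma nicemxD p q (F G : R -> Z -> 'M[R]_(p, q)) :
  nicemx F -> nicemx G -> nicemx (fun r z => F r z + G r z).
Proof.
move=> nF nG i j; under eq_fun do under eq_fun do rewrite mxE.
exact: niceD.
Qed.

Lemma nicemxN p q (F : R -> Z -> 'M[R]_(p, q)) :
  nicemx F -> nicemx (fun r z => - F r z).
Proof.
move=> nF i j; under eq_fun do under eq_fun do rewrite mxE.
exact: niceN.
Qed.

Lemma nicemxB p q (F G : R -> Z -> 'M[R]_(p, q)) :
  nicemx F -> nicemx G -> nicemx (fun r z => F r z - G r z).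
Proof. by move=> nF nG; apply: nicemxD => //; exact: nicemxN. Qed.

Lemma nicemxZ p q (f : R -> Z -> R) (F : R -> Z -> 'M[R]_(p, q)) :
  nice f -> nicemx F -> nicemx (fun r z => f r z *: F r z).
Proof.
move=> nf nF i j; under eq_fun do under eq_fun do rewrite mxE.
exact: niceM.
Qed.

Lemma nicemxM p q s (F : R -> Z -> 'M[R]_(p, q)) (G : R -> Z -> 'M[R]_(q, s)) :
  nicemx F -> nicemx G -> nicemx (fun r z => F r z *m G r z).
Proof.
move=> nF nG i j; under eq_fun do under eq_fun do rewrite mxE.
by apply: nice_sum => l; exact: niceM.
Qed.

Lemma nicemx_tr p q (F : R -> Z -> 'M[R]_(p, q)) :
  nicemx F -> nicemx (fun r z => (F r z)^T).
Proof.
move=> nF i j; under eq_fun do under eq_fun do rewrite mxE.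
exact: nF.
Qed.

Lemma nice_det p (F : R -> Z -> 'M[R]_p) :
  nicemx F -> nice (fun r z => \det (F r z)).
Proof.
move=> nF; apply: nice_sum => s; apply: niceM; first exact: nice_cst.
by apply: nice_prod => i; exact: nF.
Qed.

Lemma nicemx_adj p (F : R -> Z -> 'M[R]_p) :
  nicemx F -> nicemx (fun r z => \adj (F r z)).
Proof.
move=> nF i j; under eq_fun do under eq_fun do rewrite mxE.
apply: niceM; first exact: nice_cst.
apply: nice_det => a c.
under eq_fun do under eq_fun do rewrite !mxE.
exact: nF.
Qed.

End Nice.

Section BoundedMeasurable.
Context (R : realType).
Implicit Types (f g : R -> R) (a b c s : R).

(** With a one-point parameter space the closure lemmas for [nice] apply verbatim to bounded
    measurable functions of time. *)
Definition bdm (D : set R) f :=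
  @nice R D unit (fun _ _ _ => True) (fun _ => True) (fun r _ => f r).

Definition bdmmx (D : set R) p q (F : R -> 'M[R]_(p, q)) :=
  @nicemx R D unit (fun _ _ _ => True) (fun _ => True) p q (fun r _ => F r).

Lemma bdmP D f (K : R) :
  measurable_fun D f -> (forall r, D r -> `|f r| <= K) -> bdm D f.
Proof. exact: nice_fun. Qed.

Lemma bdm_measurable D f : bdm D f -> measurable_fun D f.
Proof. by move=> [mf _]; exact: (mf (fun=> tt)). Qed.

Lemma bdm_bound D f : bdm D f -> exists2 b, 0 <= b & forall r, D r -> `|f r| <= b.
Proof. by move=> [_ [b [b0 fb]]]; exists b => // r /fb[/(_ tt)]. Qed.

Lemma bdmmx_bound D p q (F : R -> 'M[R]_(p, q)) : bdmmx D F ->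
  exists2 b, 0 <= b & forall r i j, D r -> `|F r i j| <= b.
Proof.
move=> bF; have /choice[B HB] : forall ij : 'I_p * 'I_q,
    exists b, 0 <= b /\ forall r, D r -> `|F r ij.1 ij.2| <= b.
  by move=> [i j]; have [b b0 Fb] := bdm_bound (bF i j); exists b.
exists (\sum_ij B ij); first by apply: sumr_ge0 => ij _; case: (HB ij).
move=> r i j Dr; rewrite (bigD1 (i, j))//= -[leLHS]addr0 lerD//.
  by have [_ /(_ _ Dr)] := HB (i, j).
by apply: sumr_ge0 => ij _; case: (HB ij).
Qed.

Lemma eq_bdm D f g : (forall r, D r -> f r = g r) -> bdm D f -> bdm D g.
Proof.
move=> fg bf; have [b _ fb] := bdm_bound bf; apply: (@bdmP _ _ b).
  apply: eq_measurable_fun (bdm_measurable bf) => r /set_mem; exact: fg.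
by move=> r Dr; rewrite -fg// fb.
Qed.

Lemma bdmS (D D' : set R) f : measurable D -> D' `<=` D -> bdm D f -> bdm D' f.
Proof.
move=> mD DD bf; have [b _ fb] := bdm_bound bf; apply: (@bdmP _ _ b).
  exact: measurable_funS (bdm_measurable bf).
by move=> r /DD /fb.
Qed.

Lemma bdm_itvS a b a' b' f : a <= a' -> b' <= b -> bdm `[a, b] f -> bdm `[a', b'] f.
Proof.
move=> aa bb; apply: bdmS => //; apply: subset_itv.
  by rewrite bnd_simp.
by rewrite bnd_simp.
Qed.

Lemma bdmmx_itvS a b a' b' p q (F : R -> 'M[R]_(p, q)) :
  a <= a' -> b' <= b -> bdmmx `[a, b] F -> bdmmx `[a', b'] F.
Proof. by move=> aa bb bF i j; exact: bdm_itvS (bF i j). Qed.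

Lemma bdm_nice D Z (close : R -> Z -> Z -> Prop) adm f :
  bdm D f -> nice D close adm (fun r _ => f r).
Proof.
move=> bf; have [b _ fb] := bdm_bound bf.
by apply: (@nice_fun _ _ _ _ _ _ b) => //; exact: bdm_measurable.
Qed.

Lemma nice_bdm D Z (close : R -> Z -> Z -> Prop) (adm : (R -> Z) -> Prop) phi (g : R -> Z) :
  nice D close adm phi -> adm g -> bdm D (fun r => phi r (g r)).
Proof.
move=> [mp [b [_ pb]]] ag; apply: (@bdmP _ _ b); first exact: mp.
by move=> r /pb[].
Qed.

Local Notation mu := (@lebesgue_measure R).
Local Notation Int a b f := (\int[mu]_(r in `[a, b]) f r).

Lemma bdm_integrable a b f : bdm `[a, b] f -> mu.-integrable `[a, b] (EFin \o f).
Proof.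
move=> bf; have [K K0 fK] := bdm_bound bf.
apply: (@measurable_bounded_integrable _ _ _ mu f `[a, b]) => //.
- by rewrite /= lebesgue_measure_itv/=; case: ifP => _; rewrite -?EFinB ltry.
- exact: bdm_measurable.
- exists K; split; first exact: num_real.
  by move=> M KM r /= rab; rewrite (le_trans (fK r _))// ltW.
Qed.

Lemma intD a b f g : bdm `[a, b] f -> bdm `[a, b] g ->
  Int a b (fun r => f r + g r) = Int a b f + Int a b g.
Proof. by move=> bf bg; rewrite RintegralD//; exact: bdm_integrable. Qed.

Lemma intB a b f g : bdm `[a, b] f -> bdm `[a, b] g ->
  Int a b (fun r => f r - g r) = Int a b f - Int a b g.
Proof. by move=> bf bg; rewrite RintegralB//; exact: bdm_integrable. Qed.

Lemma intZ a b k f : bdm `[a, b] f -> Int a b (fun r => k * f r) = k * Int a b f.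
Proof. by move=> bf; rewrite RintegralZl//; exact: bdm_integrable. Qed.

Lemma int_le a b f g : bdm `[a, b] f -> bdm `[a, b] g ->
  (forall r, a <= r -> r <= b -> f r <= g r) -> Int a b f <= Int a b g.
Proof.
move=> bf bg fg; apply: le_Rintegral => //; try exact: bdm_integrable.
by move=> r /=; rewrite in_itv/= => /andP[? ?]; exact: fg.
Qed.

Lemma int_cst a b (k : R) : a <= b -> Int a b (fun=> k) = k * (b - a).
Proof.
move=> ab; rewrite Rintegral_cst//= lebesgue_measure_itv/= lte_fin.
case: ifPn => // /negbTE ba.
by rewrite (_ : a = b) ?subrr//; apply/eqP; rewrite eq_le ab leNgt ba.
Qed.

Lemma int_bound a b f k : a <= b -> bdm `[a, b] f ->
  (forall r, a <= r -> r <= b -> f r <= k) -> Int a b f <= k * (b - a).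
Proof.
by move=> ab bf fk; rewrite -int_cst//; apply: int_le => //; exact: nice_cst.
Qed.

Lemma int_boundl a b f k : a <= b -> bdm `[a, b] f ->
  (forall r, a <= r -> r <= b -> k <= f r) -> k * (b - a) <= Int a b f.
Proof.
by move=> ab bf fk; rewrite -int_cst//; apply: int_le => //; exact: nice_cst.
Qed.

Lemma int_norm a b f k : a <= b -> bdm `[a, b] f ->
  (forall r, a <= r -> r <= b -> `|f r| <= k) -> `|Int a b f| <= k * (b - a).
Proof.
move=> ab bf fk; rewrite ler_norml -mulNr; apply/andP; split.
  by apply: int_boundl => // r ar rb; have := fk r ar rb; rewrite ler_norml => /andP[].
by apply: int_bound => // r ar rb; have := fk r ar rb; rewrite ler_norml => /andP[].
Qed.

Lemma int_ge0 a b f : (forall r, a <= r -> r <= b -> 0 <= f r) -> 0 <= Int a b f.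
Proof.
by move=> f0; apply: Rintegral_ge0 => r /=; rewrite in_itv/= => /andP[? ?]; exact: f0.
Qed.

Lemma eq_int a b f g : (forall r, a <= r -> r <= b -> f r = g r) ->
  Int a b f = Int a b g.
Proof.
move=> fg; apply: eq_Rintegral => r /set_mem/=; rewrite in_itv/= => /andP[? ?].
exact: fg.
Qed.

Lemma int_pt a f : Int a a f = 0.
Proof. by rewrite set_itv1 Rintegral_set1. Qed.

Lemma int_chasles a b c f : a <= b -> b <= c -> bdm `[a, c] f ->
  Int a c f = Int a b f + Int b c f.
Proof.
move=> ab bc bf.
have := @Rintegral_itvB R f (BLeft a) (BRight c) b (bdm_integrable bf).
rewrite !bnd_simp => /(_ ab bc) E.
(* The right piece comes as the half-open interval from b to c; its missing endpoint is a null
   set. *)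
rewrite -(@Rintegral_itv_obnd_cbnd _ b); first by rewrite -E addrC subrK.
apply: (@integrableS _ _ _ mu `[a, c] `]b, c]) => //.
  by apply: subset_itvr; rewrite bnd_simp.
exact: bdm_integrable.
Qed.

Lemma int_sum a b (I : finType) (f : I -> R -> R) :
  (forall i, bdm `[a, b] (f i)) ->
  Int a b (fun r => \sum_i f i r) = \sum_i Int a b (f i).
Proof.
move=> bf; elim: (index_enum I) => [|i s IH].
  rewrite big_nil (eq_int (g := fun=> 0)); last by move=> r _ _; rewrite big_nil.
  by rewrite Rintegral_cst// mul0r.
rewrite big_cons -IH -intD//; last exact: nice_sum.
by apply: eq_int => r _ _; rewrite big_cons.
Qed.

End BoundedMeasurable.

(** * Integral inequalities *)

Section BackwardInduction.
Context (R : realType).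
Implicit Types (a b s e h : R).

(** A uniform grid of mesh below e reaches a in finitely many steps. It replaces the usual argument
    on the largest interval where P holds, and so asks for no closedness of P. *)
Lemma backward_induction (P : R -> Prop) a b e : 0 < e -> a <= b -> P b ->
  (forall s s', a <= s -> s <= s' -> s' <= b -> s' - s < e -> P s' -> P s) -> P a.
Proof.
move=> e0 ab Pb step.
have ba0 : 0 <= (b - a) / e by rewrite divr_ge0 ?subr_ge0 ?(ltW e0).
have := archi_boundP ba0; set N := Num.bound _ => bN.
have N0 : 0 < N%:R :> R by exact: le_lt_trans bN.
pose h := (b - a) / N%:R.
have h0 : 0 <= h by rewrite divr_ge0 ?subr_ge0// ltW.
have he : h < e by rewrite ltr_pdivrMr// mulrC -ltr_pdivrMr.
have hN : N%:R * h = b - a by rewrite mulrC divfK// gt_eqF.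
have PN j : (j <= N)%N -> P (b - j%:R * h).
  elim: j => [_|j IH jN]; first by rewrite mul0r subr0.
  have jh : j.+1%:R * h <= b - a by rewrite -hN ler_wpM2r// ler_nat.
  have jh0 : 0 <= j%:R * h by rewrite mulr_ge0.
  move: jh; rewrite -natr1 mulrDl mul1r => jh.
  apply: (step _ (b - j%:R * h)) (IH (ltnW jN)); lra.
by have := PN N (leqnn N); rewrite hN opprB addrC subrK.
Qed.

(** Local errors at rate e sum to e (b - a) along the grid, and e is arbitrary; Phi may be
    discontinuous and nowhere differentiable. *)
Lemma telescope (Phi : R -> R) a b : a <= b ->
  (forall e, 0 < e -> exists2 eta, 0 < eta & forall s s',
    a <= s -> s <= s' -> s' <= b -> s' - s < eta ->
    Phi s <= Phi s' + e * (s' - s)) ->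
  Phi a <= Phi b.
Proof.
move=> ab H; rewrite -[leRHS]addr0; apply/ler_addgt0Pr => e e0.
(* The added 1 avoids a division by zero when a = b. *)
have e'0 : 0 < e / (b - a + 1).
  by rewrite divr_gt0// -[ltLHS]addr0 ler_ltD ?subr_ge0.
have [eta eta0 He] := H _ e'0.
have : Phi a <= Phi b + e / (b - a + 1) * (b - a).
  apply: (@backward_induction (fun s => Phi s <= Phi b + e / (b - a + 1) * (b - s)) a b eta) => //.
    by rewrite subrr mulr0 addr0.
  move=> s s' as_ ss sb see IH.
  by have := He s s' as_ ss sb see; lra.
move=> /le_trans -> //; rewrite addr0 lerD2l.
rewrite mulrAC ler_pdivrMr; first by rewrite ler_pM2l// lerDl.
by rewrite -[ltLHS]addr0 ler_ltD ?subr_ge0.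
Qed.

Lemma telescope_sqr (Phi : R -> R) a b (C : R) : 0 <= C -> a <= b ->
  (forall s s', a <= s -> s <= s' -> s' <= b -> Phi s <= Phi s' + C * (s' - s) ^+ 2) ->
  Phi a <= Phi b.
Proof.
move=> C0 ab H; apply: telescope => // e e0.
have C1 : 0 < C + 1 by rewrite ltr_wpDl.
exists (e / (C + 1)); first by rewrite divr_gt0.
move=> s s' as_ ss sb see; apply: (le_trans (H s s' as_ ss sb)).
rewrite lerD2l expr2 mulrA ler_wpM2r ?subr_ge0//.
have : (C + 1) * (s' - s) <= e by rewrite mulrC -ler_pdivlMr// ltW.
by apply: le_trans; rewrite ler_wpM2r ?subr_ge0// lerDl.
Qed.

End BackwardInduction.

Section Gronwall.
Context (R : realType).
Local Notation mu := (@lebesgue_measure R).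
Local Notation Int a b f := (\int[mu]_(r in `[a, b]) f r).
Implicit Types (a b s : R).

(** From exp x >= 1 + x, together with (1 + x)(1 - x + x^2) = 1 + x^3 >= 1. *)
Lemma expRN_le (x : R) : 0 <= x -> expR (- x) <= 1 - x + x ^+ 2.
Proof.
move=> x0; rewrite expRN.
have x1 : 0 < 1 + x by rewrite ltr_pwDl.
apply: (@le_trans _ _ (1 + x)^-1).
  by rewrite lef_pV2 ?posrE ?expR_gt0// expR_ge1Dx.
rewrite -[leLHS]mul1r ler_pdivrMr//.
have : 0 <= x ^+ 3 by rewrite exprn_ge0.
by rewrite !exprS expr0; nra.
Qed.

(** Backward Gronwall inequality for merely bounded measurable rates. With z(s) the right-hand side
    of the hypothesis, the usual integrating factor gives [Phi], which satisfies Phi(s) <= Phi(s') +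
    O((s' - s)^2), and Phi(b) = c. *)
Lemma gronwall a b (y al be : R -> R) (c : R) : a <= b -> 0 <= c ->
  bdm `[a, b] y -> bdm `[a, b] al -> bdm `[a, b] be ->
  (forall r, a <= r -> r <= b -> 0 <= y r) ->
  (forall r, a <= r -> r <= b -> 0 <= al r) ->
  (forall r, a <= r -> r <= b -> 0 <= be r) ->
  (forall s, a <= s -> s <= b -> y s <= c + Int s b (fun r => al r * y r + be r)) ->
  y a <= (c + Int a b be) * expR (Int a b al).
Proof.
move=> ab c0 by_ bal bbe y0 al0 be0 H.
have bay : bdm `[a, b] (fun r => al r * y r + be r) by apply: niceD => //; exact: niceM.
pose z s := c + Int s b (fun r => al r * y r + be r).
pose Phi s := z s * expR (- Int s b al) - Int s b be.
have sub s f : a <= s -> bdm `[a, b] f -> bdm `[s, b] f by move=> ?; exact: bdm_itvS.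
have sub' s s' f : a <= s -> s' <= b -> bdm `[a, b] f -> bdm `[s, s'] f.
  by move=> ? ?; exact: bdm_itvS.
have iy0 s s' : a <= s -> s' <= b -> 0 <= Int s s' (fun r => al r * y r + be r).
  move=> as_ sb; apply: int_ge0 => r sr rs.
  have ar := le_trans as_ sr; have rb := le_trans rs sb.
  by rewrite addr_ge0 ?mulr_ge0 ?al0 ?y0 ?be0.
have ial0 s s' : a <= s -> s' <= b -> 0 <= Int s s' al.
  by move=> as_ sb; apply: int_ge0 => r sr rs; apply: al0; lra.
have ibe0 s s' : a <= s -> s' <= b -> 0 <= Int s s' be.
  by move=> as_ sb; apply: int_ge0 => r sr rs; apply: be0; lra.
have [Ka Ka0 alK] := bdm_bound bal.
have za s : a <= s -> s <= b -> z s <= z a.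
  move=> as_ sb; rewrite /z (@int_chasles _ a s b)//.
  by rewrite lerD2l lerDr iy0.
have z0 s : a <= s -> s <= b -> 0 <= z s by move=> ? ?; rewrite addr_ge0// iy0.
have HPhi : Phi a <= Phi b.
  apply: (@telescope_sqr _ _ _ _ (z a * Ka ^+ 2)) => //.
    by rewrite mulr_ge0 ?exprn_ge0// z0.
  move=> s s' as_ ss sb.
  have sb' := le_trans ss sb; have as' := le_trans as_ ss.
  rewrite /Phi (@int_chasles _ s s' b al)//; last exact: sub.
  rewrite (@int_chasles _ s s' b be)//; last exact: sub.
  set x := Int s s' al; set A := Int s' b al; set B := Int s s' be.
  have x0 : 0 <= x by exact: ial0.
  have A0 : 0 <= A by exact: ial0.
  have B0 : 0 <= B by exact: ibe0.
  (* On [s, s'] one has y <= z <= z(s), as z decreases in time: z may be frozen at the left end. *)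
  have zs : z s <= z s' + z s * x + B.
    have E : z s = z s' + Int s s' (fun r => al r * y r + be r).
      by rewrite /z (@int_chasles _ s s' b)//; [ring | exact: sub].
    rewrite [leLHS]E -[leRHS]addrA lerD2l {1}/x /B.
    rewrite -intZ; last exact: sub'.
    rewrite -intD; [|by apply: niceM; [exact: nice_cst|exact: sub']|exact: sub'].
    apply: int_le; [exact: sub'|by apply: niceD; [apply: niceM; [exact: nice_cst|exact: sub']|exact: sub']|].
    move=> r sr rs; rewrite lerD2r mulrC.
    have ar := le_trans as_ sr; have rb := le_trans rs sb.
    rewrite ler_wpM2r ?al0//; apply: le_trans (H r ar rb) _.
    rewrite -/(z r) /z (@int_chasles _ s r b)//; last exact: sub.
    by rewrite lerD2l lerDr iy0.
  have eA0 : 0 < expR (- A) by exact: expR_gt0.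
  have eA1 : expR (- A) <= 1 by rewrite expR_le1; lra.
  have xK : x <= Ka * (s' - s).
    apply: int_bound => //; first exact: sub'.
    move=> r sr rs; rewrite (le_trans (ler_norm _))// alK//= in_itv/=; lra.
  (* The second-order remainder of exp(-x), with x <= Ka (s' - s), is the error that [telescope_sqr]
     tolerates. *)
  have zx : z s * expR (- x) <= z s' + B + z a * Ka ^+ 2 * (s' - s) ^+ 2.
    have zs0 := z0 s as_ sb'.
    apply: (@le_trans _ _ (z s * (1 - x + x ^+ 2))).
      by rewrite ler_wpM2l// expRN_le.
    have xx : z s * x ^+ 2 <= z a * Ka ^+ 2 * (s' - s) ^+ 2.
      rewrite -mulrA -exprMn ler_pM ?sqr_ge0 ?za//.
      by rewrite lerXn2r ?nnegrE// mulr_ge0// subr_ge0.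
    by rewrite mulrDr lerD// mulrBr mulr1 lerBlDr addrAC.
  rewrite opprD expRD mulrA.
  have zaK0 : 0 <= z a * Ka ^+ 2 * (s' - s) ^+ 2.
    by rewrite mulr_ge0 ?sqr_ge0// mulr_ge0 ?sqr_ge0// z0.
  have E3 : z s * expR (- x) * expR (- A) <=
      z s' * expR (- A) + (B + z a * Ka ^+ 2 * (s' - s) ^+ 2).
    apply: (@le_trans _ _ ((z s' + B + z a * Ka ^+ 2 * (s' - s) ^+ 2) * expR (- A))).
      by rewrite ler_wpM2r// ltW.
    by rewrite -addrA [leLHS]mulrDl lerD2l ler_piMr// addr_ge0.
  rewrite lerBlDr (le_trans E3)// le_eqVlt; apply/orP; left; apply/eqP.
  by ring.
have := HPhi; rewrite /Phi {2}/z !int_pt !oppr0 expR0 !addr0 mulr1 lerBlDr => Ha.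
apply: (le_trans (H a (lexx a) ab)); rewrite -/(z a).
rewrite -ler_pdivrMr ?expR_gt0// -expRN//.
Qed.

(** The exact value is (exp(lam (b - s)) - 1) / lam. The upper bound suffices for the contraction
    estimate, and telescoping yields it without an antiderivative. *)
Lemma int_expR_le (lam s b : R) : 0 < lam -> s <= b ->
  Int s b (fun r => expR (lam * (b - r))) <= expR (lam * (b - s)) / lam.
Proof.
move=> lam0 sb.
have bexp u v : v <= b -> bdm `[u, v] (fun r => expR (lam * (b - r))).
  move=> vb; apply: (@bdmP _ _ _ (expR (lam * (b - u)))).
    apply: (measurableT_comp (@measurable_expR R)).
    apply: measurable_funM; first exact: measurable_cst.
    by apply: measurable_funB; first exact: measurable_cst.
  move=> r /=; rewrite in_itv/= => /andP[ur rv]; rewrite ger0_norm ?expR_ge0//.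
  by rewrite ler_expR ler_pM2l// lerD2l lerN2.
rewrite -subr_le0.
pose Phi u := Int u b (fun r => expR (lam * (b - r))) - expR (lam * (b - u)) / lam.
have Phib : Phi b <= 0.
  by rewrite /Phi int_pt sub0r oppr_le0 divr_ge0 ?expR_ge0// ltW.
apply: le_trans Phib; rewrite -/(Phi s).
apply: (@telescope_sqr _ _ _ _ (expR (lam * (b - s)) * lam)) => //.
  by rewrite mulr_ge0 ?expR_ge0// ltW.
move=> u v su uv vb.
rewrite /Phi (@int_chasles _ u v b)//; last exact: bexp.
have xE : expR (lam * (b - v)) = expR (lam * (b - u)) * expR (- (lam * (v - u))).
  by rewrite -expRD; congr expR; ring.
have h1 : expR (lam * (b - v)) <= expR (lam * (b - u)) * (1 - lam * (v - u) + (lam * (v - u)) ^+ 2).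
  rewrite xE ler_wpM2l ?expR_ge0// expRN_le// mulr_ge0 ?subr_ge0//; lra.
have h2 : Int u v (fun r => expR (lam * (b - r))) <= expR (lam * (b - u)) * (v - u).
  apply: int_bound => //; first exact: bexp.
  by move=> r ur rv; rewrite ler_expR ler_pM2l// lerD2l lerN2.
have h3 : expR (lam * (b - u)) * lam * (v - u) ^+ 2 <= expR (lam * (b - s)) * lam * (v - u) ^+ 2.
  by rewrite ler_wpM2r ?sqr_ge0// ler_wpM2r ?(ltW lam0)// ler_expR ler_pM2l// lerD2l lerN2.
have h4 : expR (lam * (b - v)) / lam <= expR (lam * (b - u)) / lam - expR (lam * (b - u)) * (v - u)
     + expR (lam * (b - u)) * lam * (v - u) ^+ 2.
  rewrite ler_pdivrMr// (le_trans h1)// le_eqVlt; apply/orP; left; apply/eqP.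
  by field; rewrite gt_eqF.
by lra.
Qed.

End Gronwall.

(** * Quadratic forms and the spectral norm *)

Section Euclidean.
Context (R : realType).

Definition dot p (x y : 'cV[R]_p) : R := (x^T *m y) 0 0.

Section Dot.
Context (p : nat).
Implicit Types (x y z : 'cV[R]_p) (a : R).

Lemma dotE x y : dot x y = \sum_i x i 0 * y i 0.
Proof. by rewrite /dot mxE; apply: eq_bigr => i _; rewrite mxE. Qed.

Lemma dotC x y : dot x y = dot y x.
Proof. by rewrite !dotE; apply: eq_bigr => i _; rewrite mulrC. Qed.

Lemma dotDr x y z : dot x (y + z) = dot x y + dot x z.
Proof. by rewrite /dot mulmxDr mxE. Qed.

Lemma dotDl x y z : dot (y + z) x = dot y x + dot z x.
Proof. by rewrite dotC dotDr !(dotC x). Qed.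

Lemma dotZr a x y : dot x (a *: y) = a * dot x y.
Proof. by rewrite /dot -scalemxAr mxE. Qed.

Lemma dotZl a x y : dot (a *: x) y = a * dot x y.
Proof. by rewrite dotC dotZr dotC. Qed.

Lemma dotNr x y : dot x (- y) = - dot x y.
Proof. by rewrite -scaleN1r dotZr mulN1r. Qed.

Lemma dotNl x y : dot (- x) y = - dot x y.
Proof. by rewrite dotC dotNr dotC. Qed.

Lemma dotBr x y z : dot x (y - z) = dot x y - dot x z.
Proof. by rewrite dotDr dotNr. Qed.

Lemma dotBl x y z : dot (y - z) x = dot y x - dot z x.
Proof. by rewrite dotDl dotNl. Qed.

Lemma dot0r x : dot x 0 = 0.
Proof. by rewrite -(scale0r 0) dotZr mul0r. Qed.

Lemma dot_ge0 x : 0 <= dot x x.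
Proof. by rewrite dotE; apply: sumr_ge0 => i _; rewrite -expr2 sqr_ge0. Qed.

Lemma enorm_ge0 x : 0 <= enorm x.
Proof. exact: sqrtr_ge0. Qed.

Lemma enorm_sqr x : enorm x ^+ 2 = dot x x.
Proof.
rewrite /enorm sqr_sqrtr ?dotE; last by apply: sumr_ge0 => i _; rewrite sqr_ge0.
by apply: eq_bigr => i _; rewrite expr2.
Qed.

Lemma enorm_le x a : 0 <= a -> (enorm x <= a) = (dot x x <= a ^+ 2).
Proof. by move=> a0; rewrite -enorm_sqr ler_pXn2r ?nnegrE// enorm_ge0. Qed.

Lemma dot_eq0 x : dot x x = 0 -> x = 0.
Proof.
rewrite dotE => /eqP; rewrite psumr_eq0; last by move=> i _; rewrite -expr2 sqr_ge0.
move=> /allP H; apply/matrixP => i j; rewrite ord1 mxE.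
by have := H i (mem_index_enum _); rewrite -expr2 sqrf_eq0 => /eqP.
Qed.

Lemma enorm_eq0 x : enorm x = 0 -> x = 0.
Proof. by move=> x0; apply: dot_eq0; rewrite -enorm_sqr x0 expr0n. Qed.

Lemma enorm0 : enorm (0 : 'cV[R]_p) = 0.
Proof. by apply/eqP; rewrite -sqrf_eq0 enorm_sqr dot0r. Qed.

Lemma enormZ a x : enorm (a *: x) = `|a| * enorm x.
Proof.
apply/eqP; rewrite -(@eqrXn2 _ 2) ?enorm_ge0 ?mulr_ge0 ?enorm_ge0//.
by rewrite exprMn !enorm_sqr dotZl dotZr mulrA real_normK ?num_real// expr2.
Qed.

Lemma enormN x : enorm (- x) = enorm x.
Proof. by rewrite -scaleN1r enormZ normrN1 mul1r. Qed.

Lemma cauchy_schwarz x y : `|dot x y| <= enorm x * enorm y.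
Proof.
rewrite -(@ler_pXn2r _ 2) ?nnegrE ?mulr_ge0 ?enorm_ge0//.
rewrite exprMn !enorm_sqr real_normK ?num_real//.
have [/dot_eq0 -> | x0] := eqVneq (dot x x) 0.
  by rewrite !(dotC 0) !dot0r expr0n mul0r.
have x1 : 0 < dot x x by rewrite lt_neqAle eq_sym x0 dot_ge0.
have := dot_ge0 (dot x x *: y - dot x y *: x).
rewrite !(dotBl, dotBr, dotZl, dotZr) (dotC y x) => H.
have : 0 <= dot x x * (dot x x * dot y y - dot x y ^+ 2) by lra.
by rewrite pmulr_rge0// subr_ge0.
Qed.

Lemma dot_le x y : dot x y <= enorm x * enorm y.
Proof. by rewrite (le_trans (ler_norm _))// cauchy_schwarz. Qed.

Lemma enormD x y : enorm (x + y) <= enorm x + enorm y.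
Proof.
rewrite enorm_le ?addr_ge0 ?enorm_ge0// !(dotDl, dotDr) sqrrD !enorm_sqr (dotC y).
by have := dot_le x y; lra.
Qed.

Lemma enorm_entry x i : `|x i 0| <= enorm x.
Proof.
rewrite -(@ler_pXn2r _ 2) ?nnegrE ?enorm_ge0// enorm_sqr real_normK ?num_real//.
rewrite dotE (bigD1 i)//= expr2 lerDl; apply: sumr_ge0 => j _.
by rewrite -expr2 sqr_ge0.
Qed.

Lemma enorm_le_sum x : enorm x <= \sum_i `|x i 0|.
Proof.
have s0 : 0 <= \sum_i `|x i 0| by apply: sumr_ge0.
rewrite enorm_le// dotE expr2 mulr_suml; apply: ler_sum => i _.
rewrite (le_trans (ler_norm _))// normrM ler_wpM2l// (bigD1 i)//= lerDl.
by apply: sumr_ge0.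
Qed.

Lemma enorm_delta i : enorm (delta_mx i 0 : 'cV[R]_p) = 1.
Proof.
apply/eqP; rewrite -(@eqrXn2 _ 2) ?enorm_ge0// enorm_sqr expr1n dotE (bigD1 i)//=.
rewrite big1 ?addr0; first by rewrite mxE !eqxx mulr1.
by move=> j /negbTE ji; rewrite mxE ji mul0r.
Qed.

End Dot.

Lemma dot_mulmx p q (A : 'M[R]_(p, q)) x y : dot (A *m x) y = dot x (A^T *m y).
Proof. by rewrite /dot trmx_mul mulmxA. Qed.

(** An upper bound for the spectral norm that is controlled entry by entry, used wherever only
    smallness or finiteness matters. *)
Definition absmx p q (A : 'M[R]_(p, q)) : R := \sum_i \sum_j `|A i j|.

Lemma absmx_ge0 p q (A : 'M[R]_(p, q)) : 0 <= absmx A.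
Proof. by apply: sumr_ge0 => i _; exact: sumr_ge0. Qed.

Lemma absmx_le p q (A : 'M[R]_(p, q)) (b : R) : (forall i j, `|A i j| <= b) ->
  absmx A <= p%:R * q%:R * b.
Proof.
move=> Ab; apply: (@le_trans _ _ (\sum_(i < p) \sum_(j < q) b)).
  by apply: ler_sum => i _; apply: ler_sum.
by rewrite !sumr_const !card_ord -mulrnA mulnC -[leLHS]mulr_natl natrM.
Qed.

Lemma enorm_mulmx_abs p q (A : 'M[R]_(p, q)) x : enorm (A *m x) <= absmx A * enorm x.
Proof.
apply: (le_trans (enorm_le_sum _)); rewrite /absmx mulr_suml; apply: ler_sum => i _.
rewrite mxE (le_trans (ler_norm_sum _ _ _))// mulr_suml; apply: ler_sum => j _.
by rewrite normrM ler_wpM2l// enorm_entry.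
Qed.

Section Specnorm.
Context (p q : nat).
Implicit Types (A B : 'M[R]_(p, q)).

Lemma specnorm_has_sup A :
  has_sup [set enorm (A *m x) | x in [set x : 'cV[R]_q | enorm x <= 1]].
Proof.
split; first by exists (enorm (A *m 0)); exists 0 => //=; rewrite enorm0.
exists (absmx A) => _ [x /= x1 <-]; rewrite (le_trans (enorm_mulmx_abs _ _))//.
by rewrite ler_piMr// absmx_ge0.
Qed.

Lemma specnorm_ub A x : enorm x <= 1 -> enorm (A *m x) <= specnorm A.
Proof.
move=> x1; apply: sup_upper_bound; first exact: specnorm_has_sup.
by exists x.
Qed.

Lemma specnorm_le A (c : R) :
  (forall x, enorm x <= 1 -> enorm (A *m x) <= c) -> specnorm A <= c.
Proof.
move=> Ac; apply: ge_sup; first by case: (specnorm_has_sup A).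
by move=> _ [x /= x1 <-]; exact: Ac.
Qed.

Lemma specnorm_ge0 A : 0 <= specnorm A.
Proof. by rewrite (le_trans (enorm_ge0 (A *m 0)))// specnorm_ub// enorm0. Qed.

Lemma enorm_mulmx A x : enorm (A *m x) <= specnorm A * enorm x.
Proof.
have [x0|x0] := eqVneq (enorm x) 0.
  by rewrite (enorm_eq0 x0) mulmx0 !enorm0 mulr0.
have x1 : 0 < enorm x by rewrite lt_neqAle eq_sym x0 enorm_ge0.
have := @specnorm_ub A ((enorm x)^-1 *: x).
rewrite -scalemxAr !enormZ ger0_norm ?invr_ge0 ?enorm_ge0// mulVf// => /(_ (lexx _)).
by rewrite mulrC ler_pdivrMr.
Qed.

Lemma specnorm_abs A : specnorm A <= absmx A.
Proof.
apply: specnorm_le => x x1; rewrite (le_trans (enorm_mulmx_abs _ _))//.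
by rewrite ler_piMr// absmx_ge0.
Qed.

Lemma specnormB A B : specnorm A <= specnorm B + absmx (A - B).
Proof.
apply: specnorm_le => x x1; rewrite -[A in A *m x](subrK B) addrC mulmxDl.
rewrite (le_trans (enormD _ _))// lerD ?specnorm_ub//.
by rewrite (le_trans (enorm_mulmx_abs _ _))// ler_piMr// absmx_ge0.
Qed.

Lemma specnorm_entry A i j : `|A i j| <= specnorm A.
Proof.
have := @specnorm_ub A (delta_mx j 0); rewrite enorm_delta => /(_ (lexx _)).
apply: le_trans; apply: le_trans (enorm_entry _ i).
by rewrite -colE mxE.
Qed.

End Specnorm.

Lemma psdP p (A : 'M[R]_p) : psd A <-> A^T = A /\ forall x, 0 <= dot x (A *m x).
Proof. by split=> -[sA pA]; split=> // x; have := pA x; rewrite /dot mulmxA. Qed.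

Section Psd.
Context (p : nat).
Implicit Types (A B : 'M[R]_p) (x y : 'cV[R]_p).

Lemma psd_dot A x : psd A -> 0 <= dot x (A *m x).
Proof. by move/psdP => [_]. Qed.

Lemma psd_sym A : psd A -> A^T = A. Proof. by case. Qed.

Lemma lemx_dot A B x : lemx A B -> dot x (A *m x) <= dot x (B *m x).
Proof. by move/(psd_dot x); rewrite mulmxBl dotBr subr_ge0. Qed.

Lemma lemx0 A : lemx 0 A -> psd A.
Proof. by rewrite /lemx subr0. Qed.

Lemma psdD A B : psd A -> psd B -> psd (A + B).
Proof.
move=> /psdP[sA pA] /psdP[sB pB]; apply/psdP; split; first by rewrite linearD/= sA sB.
by move=> x; rewrite mulmxDl dotDr addr_ge0.
Qed.

Lemma psd_conj q (C : 'M[R]_(p, q)) A : psd A -> psd (C^T *m A *m C).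
Proof.
move=> /psdP[sA pA]; apply/psdP; split; first by rewrite !trmx_mul trmxK sA mulmxA.
by move=> x; rewrite -!mulmxA dotC dot_mulmx trmxK dotC pA.
Qed.

Lemma sym_dot A x y : A^T = A -> dot x (A *m y) = dot y (A *m x).
Proof. by move=> sA; rewrite dotC dot_mulmx sA. Qed.

(** The form at t x + y is a nonnegative quadratic in t, so its discriminant is nonpositive. *)
Lemma psd_cauchy_schwarz A x y : psd A ->
  dot x (A *m y) ^+ 2 <= dot x (A *m x) * dot y (A *m y).
Proof.
move=> /psdP[sA pA].
set a := dot x (A *m x); set b := dot y (A *m y); set c := dot x (A *m y).
have H t : 0 <= a * t ^+ 2 + 2 * c * t + b.
  have := pA (t *: x + y).
  rewrite mulmxDr -scalemxAr !(dotDl, dotDr, dotZl, dotZr).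
  by rewrite (sym_dot y x sA) -/a -/b -/c; lra.
have a0 : 0 <= a by exact: pA.
have b0 : 0 <= b by exact: pA.
have [a0'|a0'] := eqVneq a 0.
  rewrite a0' mul0r; have [->|c0] := eqVneq c 0; first by rewrite expr0n.
  (* In the degenerate case the quadratic is affine in t; for c nonzero this t gives it the value
     -1. *)
  have := H (- (b + 1) / (2 * c)); rewrite a0' mul0r add0r.
  have -> : 2 * c * (- (b + 1) / (2 * c)) + b = -1 by field.
  by lra.
have {}a0 : 0 < a by rewrite lt_neqAle eq_sym a0' a0.
have := H (- c / a).
have -> : a * (- c / a) ^+ 2 + 2 * c * (- c / a) + b = (a * b - c ^+ 2) / a by field.
by rewrite pmulr_lge0 ?invr_gt0// subr_ge0.
Qed.

(** Passes from the form to the operator norm without diagonalizing: Cauchy-Schwarz for A with y = A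
    x gives |y|^4 <= <y, A y> <x, A x> <= c^2 |y|^2 |x|^2. *)
Lemma psd_enorm A (c : R) : psd A -> 0 <= c ->
  (forall x, dot x (A *m x) <= c * dot x x) -> forall x, enorm (A *m x) <= c * enorm x.
Proof.
move=> pA c0 Ac x; set y := A *m x.
have h0 : dot y (A *m x) ^+ 2 <= c * dot y y * (c * dot x x).
  apply: le_trans (psd_cauchy_schwarz y x pA) _.
  by rewrite ler_pM// ?psd_dot// Ac.
rewrite -/y in h0.
have [y0|y0] := eqVneq (dot y y) 0.
  by rewrite (dot_eq0 y0) enorm0 mulr_ge0// enorm_ge0.
have y1 : 0 < dot y y by rewrite lt_neqAle eq_sym y0 dot_ge0.
rewrite enorm_le ?mulr_ge0 ?enorm_ge0// exprMn enorm_sqr.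
rewrite -(ler_pM2l y1) -expr2 (le_trans h0)// le_eqVlt; apply/orP; left; apply/eqP.
by ring.
Qed.

Lemma psd_specnorm A (c : R) : psd A -> 0 <= c ->
  (forall x, dot x (A *m x) <= c * dot x x) -> specnorm A <= c.
Proof.
move=> pA c0 Ac; apply: specnorm_le => x x1.
by rewrite (le_trans (psd_enorm pA c0 Ac x))// ler_piMr.
Qed.

Lemma dot_specnorm A x : dot x (A *m x) <= specnorm A * dot x x.
Proof.
rewrite (le_trans (dot_le _ _))// -enorm_sqr expr2 mulrA mulrC ler_wpM2r ?enorm_ge0//.
exact: enorm_mulmx.
Qed.

End Psd.

(** * Inverses and determinants of coercive matrices *)

Section InverseBound.
Context (p : nat) (d : R) (X : 'M[R]_p) (d0 : 0 < d).
Hypothesis Xd : forall x, d * dot x x <= dot x (X *m x).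

Lemma coercive_unitmx : X \in unitmx.
Proof.
rewrite unitmxE unitfE; apply/negP => /det0P[v v0 vX].
move/eqP: v0; apply; have := Xd v^T.
have -> : dot v^T (X *m v^T) = 0 by rewrite /dot trmxK mulmxA vX mul0mx mxE.
rewrite pmulr_rle0// => h; apply: trmx_inj; rewrite trmx0.
by apply: dot_eq0; apply/eqP; rewrite eq_le h dot_ge0.
Qed.

Lemma invmx_coercive_bound x : enorm (invmx X *m x) <= enorm x / d.
Proof.
set y := invmx X *m x.
have xE : x = X *m y by rewrite mulmxA mulmxV ?coercive_unitmx// mul1mx.
rewrite ler_pdivlMr// mulrC.
have [->|y0] := eqVneq (enorm y) 0; first by rewrite mulr0 enorm_ge0.
have y1 : 0 < enorm y by rewrite lt_neqAle eq_sym y0 enorm_ge0.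
rewrite -(ler_pM2l y1); apply: le_trans (dot_le _ _).
rewrite xE; apply: le_trans (Xd y); rewrite -enorm_sqr.
by rewrite le_eqVlt; apply/orP; left; apply/eqP; ring.
Qed.

(** The entries of the inverse of a d-coercive matrix are at most 1/d, so by the Leibniz formula its
    determinant is at most p! / d^p in absolute value. Inverting and squaring gives a lower bound
    for det^2 that depends on p and d alone: a threshold for [reginv] valid at all times. *)
Definition detlb (p : nat) (d : R) : R := ((p`!)%:R / d ^+ p)^-1 ^+ 2.

Lemma detlb_gt0 : 0 < detlb p d.
Proof.
by rewrite exprn_gt0// invr_gt0 divr_gt0 ?exprn_gt0// ltr0n fact_gt0.
Qed.

Lemma det_coercive : detlb p d <= \det X ^+ 2.
Proof.
have Xi i j : `|invmx X i j| <= d^-1.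
  have := invmx_coercive_bound (delta_mx j 0).
  rewrite enorm_delta mul1r; apply: le_trans; apply: le_trans (enorm_entry _ i).
  by rewrite -colE mxE.
have Di : `|\det (invmx X)| <= (p`!)%:R / d ^+ p.
  rewrite (le_trans (ler_norm_sum _ _ _))//.
  apply: (@le_trans _ _ (\sum_(s : {perm 'I_p}) (d ^+ p)^-1)).
    apply: ler_sum => s _; rewrite normrM normrX normrN1 expr1n mul1r normr_prod.
    rewrite -exprVn -[in leRHS](card_ord p) -prodr_const.
    by apply: ler_prod => i _; rewrite normr_ge0 Xi.
  by rewrite sumr_const card_Sn -[leLHS]mulr_natl.
have uX := coercive_unitmx.
have dX : \det X * \det (invmx X) = 1 by rewrite -det_mulmx mulmxV// det1.
have dX0 : \det X != 0 by apply/eqP => h; move: dX; rewrite h mul0r => /eqP; rewrite eq_sym oner_eq0.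
rewrite /detlb -[leRHS]real_normK ?num_real// lerXn2r ?nnegrE ?normr_ge0//.
  by rewrite invr_ge0 divr_ge0 ?exprn_ge0 ?(ltW d0).
rewrite -[leRHS]invrK lef_pV2 ?posrE ?divr_gt0 ?ltr0n ?fact_gt0 ?exprn_gt0//.
  rewrite -normfV (_ : (\det X)^-1 = \det (invmx X))//.
  by apply: (mulfI dX0); rewrite mulfV// dX.
by rewrite invr_gt0 normr_gt0.
Qed.

End InverseBound.

(* Agrees with invmx where det^2 >= e, but is Lipschitz on bounded sets. *)
Definition reginv p (e : R) (X : 'M[R]_p) : 'M[R]_p :=
  (\det X / Num.max (\det X ^+ 2) e) *: \adj X.

Lemma reginvE p (d : R) (X : 'M[R]_p) : 0 < d ->
  (forall x, d * dot x x <= dot x (X *m x)) -> reginv (detlb p d) X = invmx X.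
Proof.
move=> d0 Xd; have uX := coercive_unitmx d0 Xd.
rewrite /reginv /invmx uX max_l ?det_coercive//; congr (_ *: _).
by move: uX; rewrite unitmxE unitfE => h; field.
Qed.

End Euclidean.

(** * Picard iteration *)

Section UniformContinuity.
Context (R : realType).

Lemma continuous_within_eps (A : set R) (f : R -> R) :
  (forall x e, A x -> 0 < e -> exists2 d, 0 < d &
    forall y, A y -> `|x - y| < d -> `|f x - f y| < e) ->
  {within A, continuous f}.
Proof.
move=> H; apply/subspace_continuousP => x Ax; apply/cvgrPdist_lt => e e0.
have [d d0 Hd] := H x e Ax e0.
rewrite near_withinE /=; near=> y.
by move=> Ay; apply: Hd => //; near: y; exact: (nbhsx_ballx x d d0).
Unshelve. all: by end_near. Qed.

Lemma half_pow_small (C e : R) : 0 <= C -> 0 < e -> exists n : nat, C * 2^-1 ^+ n < e.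
Proof.
move=> C0 e0; exists (Num.bound (C / e)).
set N := Num.bound _.
have CN : C / e < N%:R by apply: archi_boundP; rewrite divr_ge0// ltW.
have N2 : N%:R < 2 ^+ N :> R by rewrite -natrX ltr_nat ltn_expl.
rewrite exprVn ltr_pdivrMr ?exprn_gt0// mulrC -ltr_pdivrMr//.
exact: lt_trans N2.
Qed.

(** The intervals with center x n and radius 2 C 2^-n are nested, because the radius shrinks at each
    step by exactly the permitted increment C 2^-n. The supremum of the left ends lies in all of
    them. *)
Lemma geometric_limit (x : nat -> R) (C : R) : 0 <= C ->
  (forall n, `|x n.+1 - x n| <= C * 2^-1 ^+ n) ->
  exists y, forall n, `|y - x n| <= 2 * C * 2^-1 ^+ n.
Proof.
move=> C0 Hx.
pose c n := 2 * C * (2^-1 : R) ^+ n.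
have cS n : c n.+1 = c n - C * 2^-1 ^+ n by rewrite /c exprS; field.
have c0 n : 0 <= c n by rewrite !mulr_ge0// exprn_ge0// invr_ge0.
have lo n k : x n - c n <= x (n + k)%N - c (n + k)%N.
  elim: k => [|k IH]; first by rewrite addn0.
  apply: (le_trans IH); rewrite addnS cS.
  by have := Hx (n + k)%N; rewrite ler_norml => /andP[? _]; lra.
have hi n k : x (n + k)%N + c (n + k)%N <= x n + c n.
  elim: k => [|k IH]; first by rewrite addn0.
  apply: le_trans IH; rewrite addnS cS.
  by have := Hx (n + k)%N; rewrite ler_norml => /andP[_ ?]; lra.
have lohi n m : x n - c n <= x m + c m.
  apply: (le_trans (lo n m)); apply: le_trans (hi m n); rewrite addnC.
  by have := c0 (m + n)%N; lra.
pose S := [set x n - c n | n in [set: nat]].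
have S0 : S !=set0 by exists (x 0%N - c 0%N); exists 0%N.
have supS : has_sup S by split=> //; exists (x 0%N + c 0%N) => _ [n _ <-].
exists (sup S) => n; rewrite -/(c n) ler_norml; apply/andP; split.
  have : x n - c n <= sup S by apply: sup_upper_bound => //; exists n.
  by lra.
have : sup S <= x n + c n by apply: ge_sup => // _ [m _ <-].
by lra.
Qed.

End UniformContinuity.

Section Picard.
Context (R : realType) (T : R) (T0 : 0 <= T) (I : finType) (cl : R -> R -> R -> Prop).
Local Notation Z := (R * (I -> R) * (I -> R))%type.
Local Notation mu := (@lebesgue_measure R).
Local Notation Int a b f := (\int[mu]_(r in `[a, b]) f r).

(** A parameter consists of the row time t, the row values U(t, r) and the diagonal values U(r, r).
    Times are compared by [cl], that is, by how far apart the data at these times are: the data are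
    only continuous in t, so the right-hand side is not Lipschitz in t itself. *)
Definition pic_close (d : R) (z z' : Z) : Prop :=
  [/\ cl d z.1.1 z'.1.1, forall i, `|z.1.2 i - z'.1.2 i| <= d
    & forall i, `|z.2 i - z'.2 i| <= d].

Definition pic_adm (g : R -> Z) : Prop :=
  [/\ exists t, forall r, (g r).1.1 = t,
      forall i, measurable_fun `[0, T] (fun r => (g r).1.2 i)
    & forall i, measurable_fun `[0, T] (fun r => (g r).2 i)].

Context (F : I -> R -> Z -> R) (g : I -> R -> R).
Hypothesis clr : forall d t, 0 <= d -> cl d t t.
Hypothesis clE : forall e, 0 < e ->
  exists2 eta, 0 < eta & forall t t', `|t - t'| < eta -> cl e t t'.
Hypothesis nF : forall i, nice `[0, T] pic_close pic_adm (F i).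
Context (L : R) (L0 : 0 <= L).
Hypothesis gL : forall i t, `|g i t| <= L.
Hypothesis gL' : forall i d t t', 0 <= d -> cl d t t' -> `|g i t - g i t'| <= L * d.
Hypothesis FL : forall i r z, 0 <= r -> r <= T -> `|F i r z| <= L.
Hypothesis FL' : forall i r d z z', 0 <= r -> r <= T -> 0 <= d -> pic_close d z z' ->
  `|F i r z - F i r z'| <= L * d.

Implicit Types (U : I -> R -> R -> R) (s t : R).

Definition pic_arg U t r : Z := (t, fun j => U j t r, fun j => U j r r).

Definition pic U i t s : R := g i t + Int s T (fun r => F i r (pic_arg U t r)).

Definition pic_meas U t : Prop :=
  (forall i, measurable_fun `[0, T] (fun r => U i t r)) /\
  (forall i, measurable_fun `[0, T] (fun r => U i r r)).

Lemma pic_bdm U i t a b : pic_meas U t -> 0 <= a -> b <= T ->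
  bdm `[a, b] (fun r => F i r (pic_arg U t r)).
Proof.
move=> [m1 m2] a0 bT; apply: (@bdm_itvS _ 0 T) => //.
by apply: (nice_bdm (nF i)); split=> //=; exists t.
Qed.

(** A rate of at least 2 L makes the integral operator halve the weighted distance; the 1 keeps it
    positive when L = 0. *)
Definition pic_lam : R := 2 * L + 1.

Lemma pic_lam_gt0 : 0 < pic_lam.
Proof. by rewrite ltr_wpDl// mulr_ge0. Qed.

(** Integrating the weight costs a factor 1/[pic_lam], which beats L. The comparison of U and U' is
    asked only on row t and on the diagonal, for times in [s, T]; hence the estimate works on the
    square, for existence, as well as on the triangle, for uniqueness. *)
Lemma pic_contraction U U' (B : R) i t s : 0 <= B -> 0 <= s -> s <= T ->
  pic_meas U t -> pic_meas U' t ->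
  (forall r j, s <= r -> r <= T ->
    `|U j t r - U' j t r| <= B * expR (pic_lam * (T - r)) /\
    `|U j r r - U' j r r| <= B * expR (pic_lam * (T - r))) ->
  `|pic U i t s - pic U' i t s| <= B / 2 * expR (pic_lam * (T - s)).
Proof.
move=> B0 s0 sT mU mU' H.
have bU := pic_bdm i mU s0 (lexx T).
have bU' := pic_bdm i mU' s0 (lexx T).
rewrite /pic opprD addrACA subrr add0r -intB//.
set h := fun r => F i r (pic_arg U t r) - F i r (pic_arg U' t r).
have bh : bdm `[s, T] h by exact: niceB.
have be : bdm `[s, T] (fun r => expR (pic_lam * (T - r))).
  apply: (@bdmP _ _ _ (expR (pic_lam * (T - s)))).
    apply: (measurableT_comp (@measurable_expR R)).
    apply: measurable_funM; first exact: measurable_cst.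
    by apply: measurable_funB; first exact: measurable_cst.
  move=> r /=; rewrite in_itv/= => /andP[sr rT]; rewrite ger0_norm ?expR_ge0//.
  by rewrite ler_expR ler_pM2l ?pic_lam_gt0// lerD2l lerN2.
have hL r : s <= r -> r <= T -> `|h r| <= L * B * expR (pic_lam * (T - r)).
  move=> sr rT; rewrite /h -mulrA FL' ?mulr_ge0 ?expR_ge0//; first exact: le_trans sr.
  split=> /=; first by apply: clr; rewrite mulr_ge0 ?expR_ge0.
    by move=> j; have [] := H r j sr rT.
  by move=> j; have [] := H r j sr rT.
have bLe : bdm `[s, T] (fun r => L * B * expR (pic_lam * (T - r))).
  by apply: niceM => //; exact: nice_cst.
have le1 : `|Int s T h| <= Int s T (fun r => L * B * expR (pic_lam * (T - r))).
  rewrite ler_norml; apply/andP; split.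
    rewrite lerNl -mulN1r -intZ//; apply: int_le => //.
      by apply: niceM => //; exact: nice_cst.
    by move=> r sr rT; have := hL r sr rT; rewrite ler_norml mulN1r lerNl => /andP[].
  apply: int_le => // r sr rT.
  by have := hL r sr rT; rewrite ler_norml => /andP[].
apply: (le_trans le1); rewrite intZ//.
have LB0 : 0 <= L * B by rewrite mulr_ge0.
apply: (le_trans (ler_wpM2l LB0 (int_expR_le pic_lam_gt0 sT))).
have e0 : 0 <= expR (pic_lam * (T - s)) by exact: expR_ge0.
rewrite mulrA ler_pdivrMr ?pic_lam_gt0//.
rewrite /pic_lam in e0 *; set E := expR _ in e0 *.
have : 0 <= B * E by rewrite mulr_ge0.
have -> : B / 2 * E * (2 * L + 1) = L * B * E + B * E / 2 by field.
by move=> h0; rewrite lerDl divr_ge0.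
Qed.

Definition pic_ucont U : Prop := forall e, 0 < e -> exists2 d, 0 < d &
  forall i t t' s s', 0 <= s -> s <= T -> 0 <= s' -> s' <= T ->
    `|t - t'| < d -> `|s - s'| < d -> `|U i t s - U i t' s'| < e.

Lemma pic_ucont_meas U t : pic_ucont U -> pic_meas U t.
Proof.
move=> cU; split=> i; apply: subspace_continuous_measurable_fun => //;
  apply: continuous_within_eps => x e /=; rewrite in_itv/= => /andP[x0 xT] e0;
  have [d d0 Hd] := cU e e0; exists d => // y; rewrite in_itv/= => /andP[y0 yT] xy.
- by apply: Hd => //; rewrite subrr normr0.
- exact: Hd.
Qed.

Lemma pic_lipschitz U i t s s' : pic_meas U t -> 0 <= s -> s <= s' -> s' <= T ->
  `|pic U i t s - pic U i t s'| <= L * (s' - s).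
Proof.
move=> mU s0 ss sT.
have sT' := le_trans ss sT; have s0' := le_trans s0 ss.
rewrite /pic (@int_chasles _ s s' T)//; last exact: pic_bdm.
rewrite opprD addrACA subrr add0r addrK.
apply: int_norm => //; first exact: pic_bdm.
by move=> r sr rs; apply: FL; [exact: le_trans sr | exact: le_trans sT].
Qed.

Lemma pic_ucont_pic U : pic_ucont U -> pic_ucont (pic U).
Proof.
move=> cU e e0.
have mU t := pic_ucont_meas t cU.
(* If the data at t and t' and the states there differ by at most d, then [g] moves by L d and the
   integral by L T d; d is chosen so that k d = e / 2. *)
pose k := L + L * T + 1.
have k0 : 0 < k by rewrite /k ltr_wpDl// addr_ge0// mulr_ge0.
pose d := e / 2 / k.
have d0 : 0 < d by rewrite !divr_gt0.
have [e1 e10 He1] := clE d0.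
have [e2 e20 He2] := cU d d0.
pose e3 := e / 2 / (L + 1).
have L1 : 0 < L + 1 by rewrite ltr_wpDl.
have e30 : 0 < e3 by rewrite !divr_gt0.
exists (Num.min e1 (Num.min e2 e3)); first by rewrite !lt_min e10 e20.
move=> i t t' s s' s0 sT s0' sT'.
rewrite !lt_min => /and3P[t1 t2 _] /and3P[_ _ s3].
have A1 : `|pic U i t s - pic U i t' s| <= e / 2.
  rewrite /pic opprD addrACA -intB; [|exact: pic_bdm|exact: pic_bdm].
  rewrite (le_trans (ler_normD _ _))//.
  have I1 : `|g i t - g i t'| <= L * d by apply: gL'; [exact: ltW|exact: He1].
  have I2 : `|Int s T (fun r => F i r (pic_arg U t r) - F i r (pic_arg U t' r))|
      <= L * d * (T - s).
    apply: int_norm => //; first by apply: niceB; exact: pic_bdm.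
    move=> r sr rT; have r0 := le_trans s0 sr; apply: FL' => //; first exact: ltW.
    split=> /=; first exact: He1.
      by move=> j; apply/ltW/He2 => //; rewrite subrr normr0.
    by move=> j; rewrite subrr normr0 ltW.
  have Ld0 : 0 <= L * d by rewrite mulr_ge0// ltW.
  have I3 : L * d * (T - s) <= L * d * T by rewrite ler_wpM2l//; lra.
  have I4 : k * d = e / 2 by rewrite /d mulrC divfK// gt_eqF.
  by have := I4; rewrite /k; lra.
have A2 : `|pic U i t' s - pic U i t' s'| < e / 2.
  apply: (@le_lt_trans _ _ (L * `|s - s'|)).
    have [ss|ss] := leP s s'.
      by rewrite [`|s - s'|]distrC (@ger0_norm _ (s' - s)) ?subr_ge0// pic_lipschitz.
    rewrite distrC (@ger0_norm _ (s - s')) ?subr_ge0 ?(ltW ss)//.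
    by rewrite pic_lipschitz// ltW.
  apply: (@le_lt_trans _ _ ((L + 1) * `|s - s'|)).
    by rewrite ler_wpM2r// lerDl.
  by rewrite mulrC -ltr_pdivlMr.
rewrite -(subrK (pic U i t' s) (pic U i t s)) -addrA (le_lt_trans (ler_normD _ _))//.
by rewrite (splitr e) ler_ltD.
Qed.

(** Iteration from 0. The increments are uniformly geometric for all real t and all s in [0, T], so
    the limit is uniformly continuous, like the iterates, and its diagonal is measurable. *)
Lemma picard_existence : exists U, pic_ucont U /\
  forall i t s, 0 <= s -> s <= T -> U i t s = pic U i t s.
Proof.
pose V n := iter n pic (fun _ _ _ => 0).
have cV n : pic_ucont (V n).
  elim: n => [|n IH]; last exact: pic_ucont_pic.
  by move=> e e0; exists 1 => // *; rewrite subrr normr0.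
have mV n t := pic_ucont_meas t (cV n).
pose M0 := L + L * T.
have M00 : 0 <= M0 by rewrite addr_ge0// mulr_ge0.
have e1 r : r <= T -> 1 <= expR (pic_lam * (T - r)).
  by move=> rT; rewrite -expR0 ler_expR mulr_ge0 ?subr_ge0// ltW// pic_lam_gt0.
have diffV n i t s : 0 <= s -> s <= T ->
    `|V n.+1 i t s - V n i t s| <= M0 * 2^-1 ^+ n * expR (pic_lam * (T - s)).
  elim: n i t s => [|n IH] i t s s0 sT.
    rewrite expr0 mulr1 /= subr0.
    apply: (@le_trans _ _ M0); last by rewrite ler_peMr// e1.
    rewrite /pic (le_trans (ler_normD _ _))// lerD//.
    apply: (@le_trans _ _ (L * (T - s))).
      apply: int_norm => //; first exact: (pic_bdm i (mV 0%N t)).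
      by move=> r sr rT; apply: FL => //; exact: le_trans sr.
    by rewrite ler_wpM2l//; lra.
  rewrite exprSr !mulrA.
  apply: (@pic_contraction (V n.+1) (V n)) => //.
    by rewrite mulr_ge0// exprn_ge0// invr_ge0.
  by move=> r j sr rT; split; apply: IH => //; exact: le_trans sr.
pose E := expR (pic_lam * T).
have eE s : 0 <= s -> expR (pic_lam * (T - s)) <= E.
  by move=> s0; rewrite ler_expR ler_wpM2l ?(ltW pic_lam_gt0)//; lra.
have C0 : 0 <= M0 * E by rewrite mulr_ge0// expR_ge0.
have diffV' n i t s : 0 <= s -> s <= T ->
    `|V n.+1 i t s - V n i t s| <= M0 * E * 2^-1 ^+ n.
  move=> s0 sT; apply: (le_trans (diffV n i t s s0 sT)); rewrite [leRHS]mulrAC.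
  by rewrite ler_wpM2l ?eE// mulr_ge0// exprn_ge0// invr_ge0.
(* The limit is taken pointwise; for s outside [0, T] it gets the default value 0. *)
have /choice[U0 HU0] : forall p : I * R * R, exists y, 0 <= p.2 -> p.2 <= T ->
    forall n, `|y - V n p.1.1 p.1.2 p.2| <= 2 * (M0 * E) * 2^-1 ^+ n.
  move=> [[i t] s] /=; have [/andP[s0 sT]|sN] := boolP ((0 <= s) && (s <= T)); last first.
    by exists 0 => s0 sT; move: sN; rewrite s0 sT.
  have [y Hy] := @geometric_limit R (fun n => V n i t s) (M0 * E) C0
    (fun n => diffV' n i t s s0 sT).
  by exists y.
pose U i t s := U0 (i, t, s).
have HU n i t s : 0 <= s -> s <= T -> `|U i t s - V n i t s| <= 2 * (M0 * E) * 2^-1 ^+ n.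
  by move=> s0 sT; exact: (HU0 (i, t, s)).
have C20 : 0 <= 2 * (M0 * E) by rewrite mulr_ge0.
have cU : pic_ucont U.
  move=> e e0; have e30 : 0 < e / 3 by rewrite divr_gt0.
  have [n Hn] := half_pow_small C20 e30.
  have [d d0 Hd] := cV n _ e30; exists d => // i t t' s s' s0 sT s0' sT' tt ss.
  have := HU n i t s s0 sT; have := HU n i t' s' s0' sT'.
  have := Hd i t t' s s' s0 sT s0' sT' tt ss.
  move: Hn; set c := _ * _ ^+ n => Hn.
  rewrite !ltr_norml !ler_norml => /andP[? ?] /andP[? ?] /andP[? ?].
  by apply/andP; split; lra.
exists U; split=> // i t s s0 sT.
have C40 : 0 <= 2 * (2 * (M0 * E)) * E by rewrite mulr_ge0 ?expR_ge0// mulr_ge0.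
(* U and [pic U] are both within O(2^-n) of the iterate V (n + 1) = pic (V n). *)
apply/eqP; rewrite -subr_eq0 -normr_le0; apply/ler_addgt0Pr => e e0; rewrite add0r.
have [n Hn] := half_pow_small C40 e0.
have B0 : 0 <= 2 * (M0 * E) * 2^-1 ^+ n by rewrite mulr_ge0// exprn_ge0// invr_ge0.
have H1 : `|pic U i t s - pic (V n) i t s| <= 2 * (M0 * E) * 2^-1 ^+ n / 2 * E.
  apply: (@le_trans _ _ (2 * (M0 * E) * 2^-1 ^+ n / 2 * expR (pic_lam * (T - s)))).
    apply: pic_contraction => //; first exact: pic_ucont_meas.
    move=> r j sr rT; have r0 := le_trans s0 sr.
    by split; (apply: (le_trans (HU n _ _ _ r0 rT)); rewrite ler_peMr// e1).
  by rewrite ler_wpM2l ?eE// divr_ge0.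
have H2 := HU n.+1 i t s s0 sT.
have E1 : 1 <= E by rewrite /E -(subr0 T) e1.
have H3 : 2 * (M0 * E) * 2^-1 ^+ n.+1 <= 2 * (M0 * E) * 2^-1 ^+ n / 2 * E.
  by rewrite exprSr [leLHS]mulrA ler_peMr// mulr_ge0// invr_ge0.
rewrite -(subrKA (V n.+1 i t s)) (le_trans (ler_normD _ _))//.
rewrite (distrC _ (pic U i t s)) ltW//; apply: le_lt_trans Hn.
have -> : 2 * (2 * (M0 * E)) * E * 2^-1 ^+ n =
  2 * (M0 * E) * 2^-1 ^+ n / 2 * E + 2 * (M0 * E) * 2^-1 ^+ n / 2 * E +
  2 * (M0 * E) * 2^-1 ^+ n * E.
  by set w := 2^-1 ^+ n; field.
apply: (le_trans (lerD (le_trans H2 H3) H1)).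
by rewrite lerDl mulr_ge0// (le_trans ler01).
Qed.

Definition pic_tri_meas U : Prop := forall t, 0 <= t -> t <= T -> pic_meas U t.

(** Starting from the trivial bound 2 B, each use of the contraction halves the weighted distance.
    From a point with t <= s it leads only to points (t, r) and (r, r) with r >= s, so it never
    leaves the triangle. *)
Lemma picard_uniqueness U U' (B : R) :
  pic_tri_meas U -> pic_tri_meas U' ->
  (forall i t s, 0 <= t -> t <= s -> s <= T -> `|U i t s| <= B /\ `|U' i t s| <= B) ->
  (forall i t s, 0 <= t -> t <= s -> s <= T -> U i t s = pic U i t s) ->
  (forall i t s, 0 <= t -> t <= s -> s <= T -> U' i t s = pic U' i t s) ->
  forall i t s, 0 <= t -> t <= s -> s <= T -> U i t s = U' i t s.
Proof.
move=> mU mU' bU EU EU' i0 t0 s0 t00 ts0 s0T.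
have B0 : 0 <= B by have [h _] := bU i0 t0 s0 t00 ts0 s0T; rewrite (le_trans _ h).
have H n i t s : 0 <= t -> t <= s -> s <= T ->
    `|U i t s - U' i t s| <= 2 * B * 2^-1 ^+ n * expR (pic_lam * (T - s)).
  elim: n i t s => [|n IH] i t s t0' ts sT.
    have [b1 b2] := bU i t s t0' ts sT.
    apply: (@le_trans _ _ (2 * B)).
      by rewrite (le_trans (ler_normB _ _))//; lra.
    rewrite mulr1 ler_peMr ?mulr_ge0// -expR0 ler_expR mulr_ge0 ?subr_ge0//.
    by rewrite ltW// pic_lam_gt0.
  have s0' := le_trans t0' ts.
  rewrite EU// EU'// exprSr !mulrA; apply: pic_contraction => //.
  - by rewrite !mulr_ge0// exprn_ge0// invr_ge0.
  - by apply: mU => //; exact: le_trans sT.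
  - by apply: mU' => //; exact: le_trans sT.
  move=> r j sr rT; split; apply: IH => //; last exact: le_trans sr.
  exact: le_trans sr.
apply/eqP; rewrite -subr_eq0 -normr_le0; apply/ler_addgt0Pr => e e0; rewrite add0r.
have C0 : 0 <= 2 * B * expR (pic_lam * (T - s0)) by rewrite !mulr_ge0// expR_ge0.
have [n Hn] := half_pow_small C0 e0.
by apply: (le_trans (H n _ _ _ t00 ts0 s0T)); rewrite mulrAC ltW.
Qed.

End Picard.

(** * Lyapunov equations *)

Section MatrixIntegral.
Context (R : realType).
Local Notation mu := (@lebesgue_measure R).
Local Notation Int a b f := (\int[mu]_(r in `[a, b]) f r).
Implicit Types (a b s : R).

Lemma bdmmx_cst D p q (M : 'M[R]_(p, q)) : bdmmx D (fun=> M).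
Proof. exact: nicemx_cst. Qed.

Lemma bdm_dot D p (X Y : R -> 'cV[R]_p) : bdmmx D X -> bdmmx D Y ->
  bdm D (fun r => dot (X r) (Y r)).
Proof.
move=> bX bY; rewrite /dot; apply: (@nicemx_entry _ _ _ _ _ 1 1 (fun r _ => (X r)^T *m Y r)).
by apply: nicemxM => //; exact: nicemx_tr.
Qed.

Lemma bdmmx_mulv D p q (F : R -> 'M[R]_(p, q)) (x : 'cV[R]_q) :
  bdmmx D F -> bdmmx D (fun r => F r *m x).
Proof. by move=> bF; apply: nicemxM => //; exact: nicemx_cst. Qed.

Lemma bdm_form D p q (F : R -> 'M[R]_(p, q)) x y :
  bdmmx D F -> bdm D (fun r => dot x (F r *m y)).
Proof. by move=> bF; apply: bdm_dot; [exact: bdmmx_cst | exact: bdmmx_mulv]. Qed.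

Lemma bdmmx_enorm D p q (F : R -> 'M[R]_(p, q)) : bdmmx D F ->
  exists2 K, 0 <= K & forall r x, D r -> enorm (F r *m x) <= K * enorm x.
Proof.
move=> bF; have [b b0 Fb] := bdmmx_bound bF.
exists (p%:R * q%:R * b); first by rewrite !mulr_ge0.
move=> r x Dr; apply: le_trans (enorm_mulmx_abs _ _) _.
rewrite ler_wpM2r ?enorm_ge0//; apply: absmx_le => i j.
exact: Fb.
Qed.

Lemma bdmmx_mx_integrable a b p q (F : R -> 'M[R]_(p, q)) :
  bdmmx `[a, b] F -> mx_integrable a b F.
Proof. by move=> bF i j; exact: (bdm_integrable (bF i j)). Qed.

Lemma dot_mx_integral a b p q (F : R -> 'M[R]_(p, q)) x y : bdmmx `[a, b] F ->
  dot x (mx_integral a b F *m y) = Int a b (fun r => dot x (F r *m y)).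
Proof.
move=> bF; rewrite dotE.
under eq_int => r _ _ do rewrite dotE.
rewrite int_sum; last first.
  move=> i; apply: niceM; first exact: nice_cst.
  exact: (bdmmx_mulv y bF).
apply: eq_bigr => i _; rewrite intZ; last exact: (bdmmx_mulv y bF).
congr (_ * _); rewrite mxE.
under [RHS]eq_int => r _ _ do rewrite mxE.
rewrite int_sum; last by move=> j; apply: niceM; [exact: bF | exact: nice_cst].
apply: eq_bigr => j _; rewrite mxE [RHS](eq_int (g := fun r => y j 0 * F r i j)).
  by rewrite intZ; [exact: mulrC | exact: bF].
by move=> r _ _; rewrite mulrC.
Qed.

Lemma mx_integral_chasles a b c p q (F : R -> 'M[R]_(p, q)) :
  a <= b -> b <= c -> bdmmx `[a, c] F ->
  mx_integral a c F = mx_integral a b F + mx_integral b c F.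
Proof.
move=> ab bc bF; apply/matrixP => i j; rewrite !mxE; apply: int_chasles => //; exact: bF.
Qed.

Lemma mx_integral_pt a p q (F : R -> 'M[R]_(p, q)) : mx_integral a a F = 0.
Proof. by apply/matrixP => i j; rewrite !mxE int_pt. Qed.

Lemma eq_mx_integral a b p q (F G : R -> 'M[R]_(p, q)) :
  (forall r, a <= r -> r <= b -> F r = G r) -> mx_integral a b F = mx_integral a b G.
Proof.
by move=> FG; apply/matrixP => i j; rewrite !mxE; apply: eq_int => r ar rb; rewrite FG.
Qed.

Lemma mx_integralB a b p q (F G : R -> 'M[R]_(p, q)) :
  bdmmx `[a, b] F -> bdmmx `[a, b] G ->
  mx_integral a b (fun r => F r - G r) = mx_integral a b F - mx_integral a b G.
Proof.
move=> bF bG; apply/matrixP => i j; rewrite !mxE -intB; [|exact: bF|exact: bG].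
by apply: eq_int => r _ _; rewrite !mxE.
Qed.

(** Pairing the integral with its own value w makes the estimate scalar: |w|^2 is the integral of
    <w, F x>. *)
Lemma enorm_mx_integral a b p q (F : R -> 'M[R]_(p, q)) (K : R) x :
  a <= b -> 0 <= K -> bdmmx `[a, b] F ->
  (forall r, a <= r -> r <= b -> enorm (F r *m x) <= K * enorm x) ->
  enorm (mx_integral a b F *m x) <= K * (b - a) * enorm x.
Proof.
move=> ab K0 bF FK; set w := _ *m x.
have [->|w0] := eqVneq (enorm w) 0.
  by rewrite mulr_ge0 ?enorm_ge0// mulr_ge0// subr_ge0.
have w1 : 0 < enorm w by rewrite lt_neqAle eq_sym w0 enorm_ge0.
rewrite -(ler_pM2l w1) -expr2 enorm_sqr {2}/w dot_mx_integral//.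
apply: (@le_trans _ _ (enorm w * (K * enorm x) * (b - a))); last first.
  by rewrite le_eqVlt; apply/orP; left; apply/eqP; ring.
apply: int_bound => //; first exact: bdm_form.
move=> r ar rb; apply: le_trans (dot_le _ _) _.
by rewrite ler_wpM2l ?enorm_ge0// FK.
Qed.

End MatrixIntegral.

Section Lyapunov.
Context (R : realType) (n : nat) (a T : R) (P A C S : R -> 'M[R]_n).
Local Notation mu := (@lebesgue_measure R).
Local Notation Int a b f := (\int[mu]_(r in `[a, b]) f r).

Let G r := P r *m A r + (A r)^T *m P r + (C r)^T *m P r *m C r + S r.

Hypotheses (bP : bdmmx `[a, T] P) (bA : bdmmx `[a, T] A) (bC : bdmmx `[a, T] C)
  (bS : bdmmx `[a, T] S).
Hypothesis sP : forall s, a <= s -> s <= T -> (P s)^T = P s.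
Hypothesis eqP_ : forall s s', a <= s -> s <= s' -> s' <= T ->
  P s = P s' + mx_integral s s' G.
Hypothesis S0 : forall r x, a <= r -> r <= T -> 0 <= dot x (S r *m x).

Lemma lyapunov_bdmmx : bdmmx `[a, T] G.
Proof.
rewrite /G; apply: nicemxD => //; apply: nicemxD; first apply: nicemxD.
- exact: nicemxM.
- by apply: nicemxM => //; exact: nicemx_tr.
- by apply: nicemxM => //; apply: nicemxM => //; exact: nicemx_tr.
Qed.

(* Over [s, s'], P s is (1 + w)^T P(s') (1 + w), w the integral of A, plus a
   quantity that is nonnegative if P(s') is, up to O((s' - s)^2). *)
Lemma lyapunov_step : exists2 c, 0 <= c & forall s s' m,
  a <= s -> s <= s' -> s' <= T -> s' - s <= 1 -> 0 <= m ->
  (forall x, - m * dot x x <= dot x (P s' *m x)) ->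
  forall x, - (m * (1 + c * (s' - s)) + c * (s' - s) ^+ 2) * dot x x
            <= dot x (P s *m x).
Proof.
have [kp kp0 HP] := bdmmx_enorm bP.
have [ka ka0 HA] := bdmmx_enorm bA.
have [kc kc0 HC] := bdmmx_enorm bC.
have [kg kg0 HG] := bdmmx_enorm lyapunov_bdmmx.
pose c1 := 2 * ka + ka ^+ 2 + kc ^+ 2.
pose c2 := kp * ka ^+ 2 + 2 * kg * ka + kg * kc ^+ 2.
have c10 : 0 <= c1 by rewrite !addr_ge0 ?mulr_ge0 ?exprn_ge0.
have c20 : 0 <= c2 by rewrite !addr_ge0 ?mulr_ge0 ?exprn_ge0// mulr_ge0.
exists (c1 + c2); first exact: addr_ge0.
move=> s s' m as_ ss sT h1 m0 Hm x.
set h := s' - s; have h0 : 0 <= h by rewrite subr_ge0.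
have inD r : s <= r -> r <= s' -> `[a, T]%classic r.
  by move=> sr rs; rewrite /= in_itv/= (le_trans as_ sr) (le_trans rs sT).
have bG u v : a <= u -> v <= T -> bdmmx `[u, v] G.
  by move=> ? ?; apply: bdmmx_itvS lyapunov_bdmmx.
have lip r y z : s <= r -> r <= s' ->
    `|dot y (P r *m z) - dot y (P s' *m z)| <= kg * h * enorm y * enorm z.
  move=> sr rs; have ar := le_trans as_ sr.
  rewrite (eqP_ ar rs sT) mulmxDl dotDr addrC addKr dot_mx_integral; last exact: bG.
  apply: (@le_trans _ _ (kg * enorm y * enorm z * (s' - r))).
    apply: int_norm => //; first by apply: bdm_form; exact: bG.
    move=> u ru us; apply: (le_trans (cauchy_schwarz _ _)).
    rewrite [kg * _]mulrC -mulrA ler_wpM2l ?enorm_ge0// HG//.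
    by apply: inD => //; exact: le_trans ru.
  have -> : kg * h * enorm y * enorm z = kg * enorm y * enorm z * h by ring.
  by rewrite ler_wpM2l ?mulr_ge0 ?enorm_ge0// lerB.
pose w := mx_integral s s' A *m x.
have bA' : bdmmx `[s, s'] A by apply: bdmmx_itvS bA.
have w_le : enorm w <= ka * h * enorm x.
  by apply: enorm_mx_integral => // r sr rs; apply: HA; exact: inD.
set N := dot x x; have N0 : 0 <= N by exact: dot_ge0.
have NE : enorm x * enorm x = N by rewrite -expr2 enorm_sqr.
(* P is Lipschitz, so freezing it at s' costs O(h) in the integrand. The C-term is then bounded
   below by the hypothesis on P(s'), and the source S only helps. *)
have Gx r : s <= r -> r <= s' ->
    2 * dot x (P s' *m (A r *m x)) - (2 * kg * ka * h + m * kc ^+ 2 + kg * kc ^+ 2 * h) * N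
    <= dot x (G r *m x).
  move=> sr rs; have Dr := inD _ sr rs.
  have ar := le_trans as_ sr; have rT := le_trans rs sT.
  rewrite /G !mulmxDl !dotDr -!mulmxA.
  have -> : dot x ((A r)^T *m (P r *m x)) = dot x (P r *m (A r *m x)).
    by rewrite -dot_mulmx (sym_dot _ _ (sP ar rT)).
  have -> : dot x ((C r)^T *m (P r *m (C r *m x))) = dot (C r *m x) (P r *m (C r *m x)).
    by rewrite -dot_mulmx.
  have := S0 x ar rT.
  have : - (kg * ka * h * N) <= dot x (P r *m (A r *m x)) - dot x (P s' *m (A r *m x)).
    have := lip r x (A r *m x) sr rs; rewrite ler_norml => /andP[+ _].
    apply: le_trans; rewrite lerN2 -mulrA -NE.
    have -> : kg * ka * h * (enorm x * enorm x) = kg * h * (enorm x * (ka * enorm x)) by ring.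
    by rewrite ler_wpM2l ?mulr_ge0// ler_wpM2l ?enorm_ge0// HA.
  have CN : dot (C r *m x) (C r *m x) <= kc ^+ 2 * N.
    by rewrite -NE -expr2 -exprMn -enorm_sqr lerXn2r ?nnegrE ?mulr_ge0 ?enorm_ge0// HC.
  have : - (kg * kc ^+ 2 * h * N) <=
      dot (C r *m x) (P r *m (C r *m x)) - dot (C r *m x) (P s' *m (C r *m x)).
    have := lip r (C r *m x) (C r *m x) sr rs; rewrite ler_norml => /andP[+ _].
    apply: le_trans; rewrite lerN2 -mulrA -expr2 enorm_sqr.
    have -> : kg * kc ^+ 2 * h * N = kg * h * (kc ^+ 2 * N) by ring.
    by rewrite ler_wpM2l ?mulr_ge0.
  have : - (m * (kc ^+ 2 * N)) <= dot (C r *m x) (P s' *m (C r *m x)).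
    by apply: le_trans (Hm _); rewrite mulNr lerN2 ler_wpM2l.
  lra.
have I1 : 2 * dot x (P s' *m w) -
    (2 * kg * ka * h + m * kc ^+ 2 + kg * kc ^+ 2 * h) * N * h
    <= dot x (mx_integral s s' G *m x).
  rewrite [in leRHS]dot_mx_integral; last exact: bG.
  set K := _ * N.
  have -> : 2 * dot x (P s' *m w) - K * h =
      Int s s' (fun r => 2 * dot x (P s' *m (A r *m x)) - K).
    have bPA : bdm `[s, s'] (fun r => dot x (P s' *m (A r *m x))).
      apply: bdm_dot; first exact: bdmmx_cst.
      by apply: nicemxM; [exact: nicemx_cst | exact: bdmmx_mulv].
    rewrite intB; [|by apply: niceM => //; exact: nice_cst|exact: nice_cst].
    rewrite intZ// int_cst//; congr (2 * _ - _).
    rewrite (sym_dot _ _ (sP (le_trans as_ ss) sT)) dotC dot_mx_integral//.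
    by apply: eq_int => r _ _; rewrite (sym_dot _ _ (sP (le_trans as_ ss) sT)) dotC.
  apply: int_le; [|by apply: bdm_form; exact: bG|by []].
  apply: niceB; last exact: nice_cst.
  apply: niceM; first exact: nice_cst.
  apply: bdm_dot; first exact: bdmmx_cst.
  by apply: nicemxM; [exact: nicemx_cst | exact: bdmmx_mulv].
have E1 : dot x (P s *m x) = dot x (P s' *m x) + dot x (mx_integral s s' G *m x).
  by rewrite (eqP_ as_ ss sT) mulmxDl dotDr.
(* The cross term 2 <x, P(s') w> has no sign and is of first order in h. It is absorbed into the
   form of P(s') at x + w, which is bounded below; what remains is of order h^2. *)
have E2 : dot (x + w) (P s' *m (x + w)) =
    dot x (P s' *m x) + 2 * dot x (P s' *m w) + dot w (P s' *m w).
  rewrite mulmxDr !dotDl !dotDr (sym_dot w x (sP (le_trans as_ ss) sT)).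
  ring.
have ww : dot w w <= ka ^+ 2 * h ^+ 2 * N.
  by rewrite -NE -expr2 -!exprMn -enorm_sqr lerXn2r ?nnegrE ?mulr_ge0 ?enorm_ge0.
have wPw : dot w (P s' *m w) <= kp * (ka ^+ 2 * h ^+ 2 * N).
  apply: (@le_trans _ _ (kp * dot w w)); last by rewrite ler_wpM2l.
  rewrite (le_trans (dot_le _ _))// -enorm_sqr expr2 [leRHS]mulrCA ler_wpM2l ?enorm_ge0//.
  by apply: HP; exact: inD.
have xw : dot x w <= ka * h * N.
  apply: le_trans (dot_le _ _) _.
  by rewrite -NE [leRHS]mulrCA ler_wpM2l ?enorm_ge0.
have hh : h ^+ 2 <= h by rewrite expr2 ler_piMr.
have xwxw : dot (x + w) (x + w) <= (1 + (2 * ka + ka ^+ 2) * h) * N.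
  rewrite !dotDl !dotDr (dotC w x) -/N.
  have : ka ^+ 2 * h ^+ 2 * N <= ka ^+ 2 * h * N.
    by rewrite ler_wpM2r// ler_wpM2l// exprn_ge0.
  by move: ww xw; lra.
have Pxw : - (m * ((1 + (2 * ka + ka ^+ 2) * h) * N)) <= dot (x + w) (P s' *m (x + w)).
  by apply: le_trans (Hm _); rewrite mulNr lerN2 ler_wpM2l.
(* The estimate holds with growth rate c1 and remainder constant c2; these two surpluses allow c1 +
   c2 in both places. *)
have mh : 0 <= m * c2 * h * N by rewrite !mulr_ge0.
have ch : 0 <= c1 * h ^+ 2 * N by rewrite !mulr_ge0// exprn_ge0.
rewrite E1.
move: Pxw wPw I1 mh ch; rewrite E2 /c1 /c2.
set d1 := dot x _; set d2 := dot x _; set d3 := dot w _; set d4 := dot x _.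
lra.
Qed.

(** [lyapunov_step] lets a deficiency m grow to m (1 + c h) + c h^2. For steps h < e it stays below
    e (exp(c (T - s)) - 1), and e tends to 0. *)
Lemma lyapunov_psd : (forall x, 0 <= dot x (P T *m x)) ->
  forall s x, a <= s -> s <= T -> 0 <= dot x (P s *m x).
Proof.
move=> PT s x as_ sT; have [c c0 step] := lyapunov_step.
set E := expR (c * (T - s)).
(* The -1 is what absorbs the remainder: (exp - 1)(1 + c h) loses c h against exp (1 + c h), and c
   h^2 <= e c h. *)
have main e : 0 < e -> e <= 1 -> - (e * (E - 1)) * dot x x <= dot x (P s *m x).
  move=> e0 e1; move: x.
  apply: (@backward_induction R (fun s => forall x,
    - (e * (expR (c * (T - s)) - 1)) * dot x x <= dot x (P s *m x)) s T e) => //.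
    by move=> x; rewrite subrr mulr0 expR0 subrr mulr0 oppr0 mul0r.
  move=> u v su uv vT uve IH x.
  have au := le_trans as_ su.
  set Ev := expR (c * (T - v)) in IH.
  have Ev1 : 1 <= Ev by rewrite /Ev -expR0 ler_expR mulr_ge0 ?subr_ge0.
  have m0 : 0 <= e * (Ev - 1) by rewrite mulr_ge0 ?(ltW e0)// subr_ge0.
  apply: le_trans (step u v _ au uv vT (ltW (lt_le_trans uve e1)) m0 IH x).
  rewrite ler_wpM2r ?dot_ge0// lerN2.
  have -> : expR (c * (T - u)) = Ev * expR (c * (v - u)).
    by rewrite /Ev -expRD; congr expR; ring.
  have h0 : 0 <= v - u by rewrite subr_ge0.
  have H1 : e * Ev * (1 + c * (v - u)) <= e * Ev * expR (c * (v - u)).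
    by rewrite ler_wpM2l ?expR_ge1Dx// mulr_ge0 ?expR_ge0// ltW.
  have H2 : c * (v - u) ^+ 2 <= c * (v - u) * e.
    by rewrite expr2 mulrA ler_wpM2l ?mulr_ge0// ltW.
  lra.
apply/ler_addgt0Pr => e e0.
have K0 : 0 <= (E - 1) * dot x x.
  by rewrite mulr_ge0 ?dot_ge0// subr_ge0 -expR0 ler_expR mulr_ge0// subr_ge0.
have K1 : 0 < (E - 1) * dot x x + 1 by rewrite ltr_wpDl.
pose e' := Num.min 1 (e / ((E - 1) * dot x x + 1)).
have e'0 : 0 < e' by rewrite lt_min ltr01 divr_gt0.
have e'1 : e' <= 1 by rewrite ge_min lexx.
have := main e' e'0 e'1.
have : e' * ((E - 1) * dot x x) <= e.
  apply: (@le_trans _ _ (e / ((E - 1) * dot x x + 1) * ((E - 1) * dot x x + 1))).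
    by rewrite ler_pM ?(ltW e'0)// ?ge_min ?lexx ?orbT// lerDl.
  by rewrite divfK// gt_eqF.
lra.
Qed.

End Lyapunov.

(** * Measurability of matrix-valued functions and of the spectral norm *)

Section MeasurableMatrix.
Context (R : realType) (D : set R) (mD : measurable D).

Definition mxmeas p q (F : R -> 'M[R]_(p, q)) : Prop :=
  forall i j, measurable_fun D (fun s => F s i j).

Lemma mxmeasD p q (F G : R -> 'M[R]_(p, q)) :
  mxmeas F -> mxmeas G -> mxmeas (fun s => F s + G s).
Proof.
move=> mF mG i j; under eq_fun do rewrite mxE.
by apply: measurable_funD; [exact: mF | exact: mG].
Qed.

Lemma mxmeasN p q (F : R -> 'M[R]_(p, q)) : mxmeas F -> mxmeas (fun s => - F s).
Proof.
move=> mF i j; under eq_fun do rewrite mxE.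
by apply: (measurable_funN (mF i j)).
Qed.

Lemma mxmeasM p q l (F : R -> 'M[R]_(p, q)) (G : R -> 'M[R]_(q, l)) :
  mxmeas F -> mxmeas G -> mxmeas (fun s => F s *m G s).
Proof.
move=> mF mG i j; under eq_fun do rewrite mxE.
apply: measurable_sum => a.
by apply: measurable_funM; [exact: mF | exact: mG].
Qed.

Lemma mxmeas_tr p q (F : R -> 'M[R]_(p, q)) : mxmeas F -> mxmeas (fun s => (F s)^T).
Proof. by move=> mF i j; under eq_fun do rewrite mxE; exact: mF. Qed.

Lemma measurable_det p (F : R -> 'M[R]_p) : mxmeas F ->
  measurable_fun D (fun s => \det (F s)).
Proof.
move=> mF; apply: measurable_sum => s.
apply: measurable_funM; first exact: measurable_cst.
by apply: measurable_prod => i _; exact: mF.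
Qed.

Lemma measurable_funV (f : R -> R) : measurable_fun D f ->
  measurable_fun D (fun s => (f s)^-1).
Proof.
(* Squaring makes the base of the real power nonnegative; at a zero of f both sides are 0, as the
   inverse of 0 is 0. *)
move=> mf; apply: (@eq_measurable_fun _ _ _ _ D (fun s => f s * (f s ^+ 2) `^ (-1))).
  move=> s _; rewrite powR_inv1 ?sqr_ge0//.
  have [->|f0] := eqVneq (f s) 0; first by rewrite mul0r invr0.
  by field.
apply: measurable_funM => //.
apply: (measurableT_comp (measurable_powR (-1))).
exact: (measurable_funX 2 mf).
Qed.

Lemma mxmeas_inv p (F : R -> 'M[R]_p) : mxmeas F -> mxmeas (fun s => invmx (F s)).
Proof.
move=> mF i j.
have madj : measurable_fun D (fun s => (\det (F s))^-1 * (\adj (F s)) i j).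
  apply: measurable_funM; first by apply: measurable_funV; exact: measurable_det.
  under eq_fun do rewrite mxE.
  apply: measurable_funM; first exact: measurable_cst.
  apply: measurable_det => a b; under eq_fun do rewrite !mxE.
  exact: mF.
(* [invmx] returns its argument when the matrix is singular, so the cofactor formula is used only
   where the determinant is nonzero. *)
apply: (@eq_measurable_fun _ _ _ _ D (fun s => if \det (F s) == 0 then F s i j
   else (\det (F s))^-1 * (\adj (F s)) i j)).
  move=> s _; rewrite /invmx unitmxE unitfE.
  by case: (\det (F s) == 0) => //=; rewrite [RHS]mxE.
apply: measurable_fun_if => //.
- by apply: measurable_fun_eqr; [exact: measurable_det | exact: measurable_cst].
- exact: (measurable_funS mD (@subIsetl _ _ _) (mF i j)).
- exact: (measurable_funS mD (@subIsetl _ _ _) madj).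
Qed.

(* Rounding the entries down to multiples of 1/(N+1) writes g o F as a limit of
   functions taking countably many values. *)
Lemma measurable_mx_lipschitz p q (F : R -> 'M[R]_(p, q)) (g : 'M[R]_(p, q) -> R) :
  (forall A B, `|g A - g B| <= absmx (A - B)) -> mxmeas F ->
  measurable_fun D (fun s => g (F s)).
Proof.
move=> gL mF.
pose fl (N : nat) s : 'M[int]_(p, q) := \matrix_(i, j) Num.floor (N.+1%:R * F s i j).
pose rnd (N : nat) (z : 'M[int]_(p, q)) : 'M[R]_(p, q) :=
  \matrix_(i, j) ((z i j)%:~R / N.+1%:R).
apply: (@measurable_fun_cvg _ _ _ _ (fun N s => g (rnd N (fl N s)))).
  move=> N _ Y mY.
  have -> : D `&` (fun s => g (rnd N (fl N s))) @^-1` Y =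
    \bigcup_(z in [set: 'M[int]_(p, q)]) ([set s | D s /\ Y (g (rnd N z))] `&`
      \bigcap_(ij in [set: 'I_p * 'I_q]) (D `&` [set s |
         (z ij.1 ij.2)%:~R <= N.+1%:R * F s ij.1 ij.2 < (z ij.1 ij.2 + 1)%:~R])).
    apply/seteqP; split=> [s [Ds /= Ys]|s [z _ [[Ds Yz] Hz]]].
      exists (fl N s) => //; split=> // -[i j] _; split=> //=.
      by rewrite mxE floor_itv.
    split=> //=; suff -> : fl N s = z by [].
    apply/matrixP => i j; rewrite mxE; apply: floor_def.
    by have [] := Hz (i, j) I.
  apply: countable_bigcupT_measurable; first exact: countableP.
  move=> z; apply: measurableI.
    have [Yz|Yz] := pselect (Y (g (rnd N z))).
      by rewrite (_ : [set s | _] = D)//; apply/seteqP; split=> [s []|s].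
    by rewrite (_ : [set s | _] = set0)//; apply/seteqP; split=> [s []|s].
  apply: fin_bigcap_measurable; first exact: finite_finset.
  move=> [i j] _ /=.
  have mNF : measurable_fun D (fun s => N.+1%:R * F s i j).
    by apply: measurable_funM; [exact: measurable_cst | exact: mF].
  have := mNF mD `[(z i j)%:~R, (z i j + 1)%:~R[%classic.
  by apply.
move=> s Ds; apply/cvgrPdist_le => e e0.
have K0 : 0 <= p%:R * q%:R / e by rewrite divr_ge0 ?mulr_ge0// ltW.
near=> N.
apply: (le_trans (gL _ _)).
apply: (@le_trans _ _ (p%:R * q%:R * N.+1%:R^-1)).
  apply: absmx_le => i j; rewrite !mxE.
  have /andP[f1 f2] := floor_itv (N.+1%:R * F s i j).
  have N0 : 0 < N.+1%:R :> R by [].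
  rewrite -(ler_pM2l N0) -{1}(gtr0_norm N0) -normrM mulrBr mulrCA !mulfV ?gt_eqF//.
  rewrite mulr1 ger0_norm ?subr_ge0// lerBlDr addrC ltW//.
  by rewrite intrD in f2.
rewrite ler_pdivrMr// [leRHS]mulrC -ler_pdivrMr//.
near: N; exists (Num.bound (p%:R * q%:R / e)) => // N /= bN.
apply/ltW/(lt_le_trans (archi_boundP K0)); rewrite ler_nat.
exact: leq_trans bN _.
Unshelve. all: by end_near.
Qed.

(** [specnorm] is a supremum over an uncountable set; being 1-Lipschitz for [absmx] makes it
    measurable nevertheless. *)
Lemma measurable_specnorm p q (F : R -> 'M[R]_(p, q)) : mxmeas F ->
  measurable_fun D (fun s => specnorm (F s)).
Proof.
move=> mF; apply: (measurable_mx_lipschitz _ mF) => A B.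
rewrite ler_norml; apply/andP; split; last by rewrite lerBlDl specnormB.
rewrite lerBrDl lerBlDr.
have -> : absmx (A - B) = absmx (B - A); last exact: specnormB.
by apply: eq_bigr => i _; apply: eq_bigr => j _; rewrite !mxE distrC.
Qed.

End MeasurableMatrix.

Section BoundedSpecnorm.
Context (R : realType) (D : set R) (mD : measurable D).

Lemma bdmmx_mxmeas p q (F : R -> 'M[R]_(p, q)) : bdmmx D F -> mxmeas D F.
Proof. by move=> bF i j; exact: bdm_measurable (bF i j). Qed.

Lemma bdm_specnorm p q (F : R -> 'M[R]_(p, q)) : bdmmx D F ->
  bdm D (fun s => specnorm (F s)).
Proof.
move=> bF; have [b b0 Fb] := bdmmx_bound bF.
apply: (@bdmP _ _ _ (p%:R * q%:R * b)).
  by apply: measurable_specnorm => //; exact: bdmmx_mxmeas.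
move=> r Dr; rewrite ger0_norm ?specnorm_ge0// (le_trans (specnorm_abs _))//.
by apply: absmx_le => i j; exact: Fb.
Qed.

End BoundedSpecnorm.

(** * The Hamiltonian *)

Section Hamiltonian.
Context (R : realType) (n m k : nat).
Context (A C : 'M[R]_n) (B D : 'M[R]_(n, k)) (Ah : 'M[R]_(m, n)) (Bh : 'M[R]_(m, k))
  (Ch Dh : 'M[R]_m) (Q : 'M[R]_n) (Rm : 'M[R]_k) (M N : 'M[R]_m)
  (P : 'M[R]_n) (P2 : 'M[R]_(m, n)) (G2 : 'M[R]_m).
Implicit Types (x : 'cV[R]_n) (w : 'cV[R]_k).

Definition drift x w : 'cV[R]_m :=
  P2 *m (A *m x + B *m w) + (Ah *m x + Bh *m w) + Ch *m (P2 *m x)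
  + Dh *m (P2 *m (C *m x + D *m w)).

(** Minus the derivative of <x, V x> when the state control is w and the first time arguments of the
    data and of P1 are frozen; [drift] is minus the derivative of P2 x. *)
Definition ham x w : R :=
  2 * dot (P *m x) (A *m x + B *m w)
  + dot (C *m x + D *m w) (P *m (C *m x + D *m w))
  + dot x (Q *m x) + dot w (Rm *m w) + dot (P2 *m x) (M *m (P2 *m x))
  + dot (P2 *m (C *m x + D *m w)) (N *m (P2 *m (C *m x + D *m w)))
  + 2 * dot (G2 *m (P2 *m x)) (drift x w).

Definition control_weight : 'M[R]_k := Rm + D^T *m (P + P2^T *m N *m P2) *m D.

Definition control_cross : 'M[R]_(k, n) :=
  B^T *m P + D^T *m (P + P2^T *m N *m P2) *m C
  + (Bh^T + B^T *m P2^T + D^T *m P2^T *m Dh^T) *m G2 *m P2.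

Hypotheses (psdP_ : psd P) (psdR : psd Rm) (psdN : psd N).

Lemma dot_control_weight w : dot w (control_weight *m w) =
  dot w (Rm *m w) + dot (D *m w) (P *m (D *m w))
  + dot (P2 *m (D *m w)) (N *m (P2 *m (D *m w))).
Proof.
rewrite /control_weight mulmxDl dotDr -addrA; congr (_ + _).
by rewrite -!mulmxA -dot_mulmx mulmxDl dotDr -!mulmxA -(dot_mulmx P2).
Qed.

(* The control enters quadratically, with weight S, and S w = - L x at the
   optimum: it changes the Hamiltonian by - <w, S w>. *)
Lemma ham_optimal x w : control_weight *m w = - (control_cross *m x) ->
  ham x w <= ham x 0.
Proof.
move=> opt.
have sP := psd_sym psdP_; have sN := psd_sym psdN.
have W0 : 0 <= dot w (control_weight *m w).
  by rewrite dot_control_weight !addr_ge0 ?psd_dot.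
have := congr1 (dot w) opt; move: W0; rewrite dot_control_weight dotNr.
rewrite /control_cross !(mulmxDl, mulmxDr) -!mulmxA !dotDr -!(dot_mulmx B).
rewrite -!(dot_mulmx D) -!(dot_mulmx Bh) -!(dot_mulmx P2) -!(dot_mulmx Dh).
rewrite /ham /drift !mulmx0 !addr0 !mulmxDr !dotDl !dotDr.
rewrite (dot0r 0).
rewrite (dotC (P *m x)) (dotC (P *m x)) ![dot (G2 *m _) _]dotC.
rewrite (sym_dot (C *m x) (D *m w) sP) (sym_dot (P2 *m (C *m x)) (P2 *m (D *m w)) sN).
set q1 := dot w _; set q2 := dot (D *m w) (P *m (D *m w)).
set q3 := dot (P2 *m (D *m w)) (N *m (P2 *m (D *m w))).
set e1 := dot (B *m w) _; set e2 := dot (D *m w) _; set e3 := dot (P2 *m (D *m w)) _.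
set e4 := dot (Bh *m w) _; set e5 := dot (P2 *m (B *m w)) _; set e6 := dot (Dh *m _) _.
lra.
Qed.

Context (delta g q mu nu kap : R).
Let V := P + P2^T *m G2 *m P2.
Hypotheses (d0 : 0 < delta) (g0 : 0 <= g) (mu0 : 0 <= mu) (nu0 : 0 <= nu)
  (kap1 : 1 <= kap).
Hypothesis G2sym : G2^T = G2.
Hypothesis G2d : forall z, delta * dot z z <= dot z (G2 *m z).
Hypothesis G2g : forall z, enorm (G2 *m z) <= g * enorm z.
Hypothesis Qq : forall x, dot x (Q *m x) <= q * dot x x.
Hypothesis Mmu : forall z, dot z (M *m z) <= mu * dot z z.
Hypothesis Nnu : forall z, dot z (N *m z) <= nu * dot z z.

(** The bracket collects the terms quadratic in P2, each estimated by |P2|^2 <= |V| / delta. [kap]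
    becomes n in the final constant. *)
Definition ham_rate : R :=
  2 * specnorm A + specnorm C ^+ 2 + kap / delta *
    (1 + mu + nu * specnorm C ^+ 2 + 2 * g * specnorm Ch
     + 2 * g * specnorm C * specnorm Dh).

Lemma dotV x : dot x (V *m x) = dot x (P *m x) + dot (P2 *m x) (G2 *m (P2 *m x)).
Proof. by rewrite /V mulmxDl dotDr -!mulmxA -dot_mulmx. Qed.

Lemma ham_bound x : ham x 0 <= (ham_rate * specnorm V + (q + g ^+ 2 * specnorm Ah ^+ 2)) * dot x x.
Proof.
set v := specnorm V; set X := dot x x.
have v0 : 0 <= v by exact: specnorm_ge0.
have X0 : 0 <= X by exact: dot_ge0.
have sA0 := specnorm_ge0 A; have sC0 := specnorm_ge0 C.
have sAh0 := specnorm_ge0 Ah; have sCh0 := specnorm_ge0 Ch; have sDh0 := specnorm_ge0 Dh.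
have G20 z : 0 <= dot z (G2 *m z).
  by apply: le_trans (G2d z); rewrite mulr_ge0 ?dot_ge0// ltW.
have PV u : dot u (P *m u) <= v * dot u u.
  by apply: le_trans (dot_specnorm V u); rewrite dotV lerDl.
(* This bounds the norm of P2, since delta |P2 u|^2 <= <P2 u, G2 P2 u> <= <u, V u>. *)
pose e := Num.sqrt (v / delta).
have vd0 : 0 <= v / delta by rewrite divr_ge0// ltW.
have ee : e ^+ 2 = v / delta by rewrite sqr_sqrtr.
have e0 : 0 <= e by exact: sqrtr_ge0.
have P2e u : enorm (P2 *m u) <= e * enorm u.
  rewrite enorm_le ?mulr_ge0 ?enorm_ge0// exprMn ee enorm_sqr mulrAC ler_pdivlMr// mulrC.
  apply: le_trans (G2d _) _; apply: le_trans (dot_specnorm V u).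
  by rewrite dotV lerDr psd_dot.
have P2d u : dot (P2 *m u) (P2 *m u) <= v / delta * dot u u.
  by rewrite -ee -!enorm_sqr -exprMn lerXn2r ?nnegrE ?mulr_ge0 ?enorm_ge0.
have Cx : dot (C *m x) (C *m x) <= specnorm C ^+ 2 * X.
  by rewrite /X -!enorm_sqr -exprMn lerXn2r ?nnegrE ?mulr_ge0 ?enorm_ge0 ?enorm_mulmx.
(* The two A-terms add up to <V x, A x>, so that they cost |V| |A| and no factor 1/delta. *)
have t1 : dot (P *m x) (A *m x) + dot (G2 *m (P2 *m x)) (P2 *m (A *m x))
    <= v * specnorm A * X.
  have -> : dot (G2 *m (P2 *m x)) (P2 *m (A *m x)) = dot (P2^T *m (G2 *m (P2 *m x))) (A *m x).
    by rewrite [RHS]dot_mulmx trmxK.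
  rewrite -dotDl !mulmxA -mulmxDl -/V (le_trans (dot_le _ _))//.
  have -> : v * specnorm A * X = (v * enorm x) * (specnorm A * enorm x).
    by rewrite /X -enorm_sqr; ring.
  by rewrite ler_pM ?enorm_ge0 ?enorm_mulmx.
have t2 : dot (C *m x) (P *m (C *m x)) <= v * (specnorm C ^+ 2 * X).
  by apply: le_trans (PV _) _; rewrite ler_wpM2l.
have t4 : dot (P2 *m x) (M *m (P2 *m x)) <= mu * (v / delta * X).
  by apply: le_trans (Mmu _) _; rewrite ler_wpM2l// P2d.
have t5 : dot (P2 *m (C *m x)) (N *m (P2 *m (C *m x))) <=
    nu * (v / delta * (specnorm C ^+ 2 * X)).
  apply: le_trans (Nnu _) _; rewrite ler_wpM2l//; apply: le_trans (P2d _) _.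
  by rewrite ler_wpM2l.
(* The only term linear in P2. Splitting 2 a b <= a^2 + b^2 produces the 1 in the bracket and the
   forcing term g^2 |Ah|^2. *)
have t6 : 2 * dot (G2 *m (P2 *m x)) (Ah *m x) <=
    v / delta * X + g ^+ 2 * specnorm Ah ^+ 2 * X.
  have h1 : dot (G2 *m (P2 *m x)) (Ah *m x) <=
      enorm (P2 *m x) * (g * specnorm Ah * enorm x).
    apply: le_trans (dot_le _ _) _.
    have -> : enorm (P2 *m x) * (g * specnorm Ah * enorm x) =
      (g * enorm (P2 *m x)) * (specnorm Ah * enorm x) by ring.
    by rewrite ler_pM ?enorm_ge0 ?enorm_mulmx.
  have h2 := sqr_ge0 (enorm (P2 *m x) - g * specnorm Ah * enorm x).
  have h3 := P2d x.
  have h4 : enorm (P2 *m x) ^+ 2 = dot (P2 *m x) (P2 *m x) := enorm_sqr _.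
  have h5 : (g * specnorm Ah * enorm x) ^+ 2 = g ^+ 2 * specnorm Ah ^+ 2 * X.
    by rewrite !exprMn enorm_sqr.
  move: h1 h2 h3; rewrite sqrrB h4 h5 -/X.
  set a1 := dot _ _; set a2 := _ * (_ * _ * _); set a3 := dot _ _.
  set a4 := _ * X; set a5 := _ * X => h1 h2 h3; rewrite -mulr_natl in h2.
  by move: h1 h2 h3; lra.
have t7 : dot (G2 *m (P2 *m x)) (Ch *m (P2 *m x)) <= g * specnorm Ch * (v / delta * X).
  apply: le_trans (dot_le _ _) _.
  apply: (@le_trans _ _ (g * specnorm Ch * dot (P2 *m x) (P2 *m x))).
    have -> : g * specnorm Ch * dot (P2 *m x) (P2 *m x) =
      (g * enorm (P2 *m x)) * (specnorm Ch * enorm (P2 *m x)).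
      by rewrite -enorm_sqr; ring.
    by rewrite ler_pM ?enorm_ge0 ?enorm_mulmx.
  by rewrite ler_wpM2l ?mulr_ge0// P2d.
have t8 : dot (G2 *m (P2 *m x)) (Dh *m (P2 *m (C *m x))) <=
    g * specnorm C * specnorm Dh * (v / delta * X).
  apply: le_trans (dot_le _ _) _.
  have -> : g * specnorm C * specnorm Dh * (v / delta * X) =
    (g * (e * enorm x)) * (specnorm Dh * (e * (specnorm C * enorm x))).
    by rewrite -ee /X -enorm_sqr; ring.
  rewrite ler_pM ?enorm_ge0//.
    by apply: le_trans (G2g _) _; rewrite ler_wpM2l.
  apply: le_trans (enorm_mulmx _ _) _; rewrite ler_wpM2l//.
  by apply: le_trans (P2e _) _; rewrite ler_wpM2l// enorm_mulmx.
have W0 : 0 <= (1 + mu + nu * specnorm C ^+ 2 + 2 * g * specnorm Ch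
     + 2 * g * specnorm C * specnorm Dh) * (v / delta * X).
  apply: mulr_ge0; last exact: mulr_ge0.
  by do 4?[apply: addr_ge0] => //; rewrite !mulr_ge0 ?sqr_ge0.
have W1 : (1 + mu + nu * specnorm C ^+ 2 + 2 * g * specnorm Ch
     + 2 * g * specnorm C * specnorm Dh) * (v / delta * X) <=
   kap * ((1 + mu + nu * specnorm C ^+ 2 + 2 * g * specnorm Ch
     + 2 * g * specnorm C * specnorm Dh) * (v / delta * X)).
  by rewrite ler_peMl.
have t3 := Qq x; rewrite -/X in t3.
rewrite /ham /drift !mulmx0 !addr0 (dot0r 0) addr0 !dotDr.
have -> : (ham_rate * v + (q + g ^+ 2 * specnorm Ah ^+ 2)) * X =
  2 * (v * specnorm A * X) + v * (specnorm C ^+ 2 * X) +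
  kap * ((1 + mu + nu * specnorm C ^+ 2 + 2 * g * specnorm Ch
     + 2 * g * specnorm C * specnorm Dh) * (v / delta * X))
  + q * X + g ^+ 2 * specnorm Ah ^+ 2 * X.
  by rewrite /ham_rate; field; rewrite gt_eqF.
apply: (@le_trans _ _ (2 * (v * specnorm A * X) + v * (specnorm C ^+ 2 * X) +
  (1 + mu + nu * specnorm C ^+ 2 + 2 * g * specnorm Ch
     + 2 * g * specnorm C * specnorm Dh) * (v / delta * X)
  + q * X + g ^+ 2 * specnorm Ah ^+ 2 * X)); last by rewrite !lerD2r lerD2l.
clear W0 W1 Cx P2d P2e PV.
move: t1 t2 t3 t4 t5 t6 t7 t8.
set a1 := dot (P *m x) _; set a2 := dot (C *m x) _; set a3 := dot x _.
set a4 := dot (P2 *m x) _; set a5 := dot (P2 *m (C *m x)) _.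
set a6 := dot _ (Ah *m x); set a7 := dot _ (Ch *m _); set a8 := dot _ (Dh *m _).
set a9 := dot _ (P2 *m (A *m x)).
move=> t1 t2 t3 t4 t5 t6 t7 t8.
lra.
Qed.

End Hamiltonian.

(** * A priori estimate *)

Lemma subr_add4 (V : zmodType) (x1 x2 x3 x4 y1 y2 y3 y4 : V) :
  (x1 - y1) + (x2 - y2) + (x3 - y3) + (x4 - y4) =
  (x1 + x2 + x3 + x4) - (y1 + y2 + y3 + y4).
Proof.
rewrite (addrACA x1) -opprD (addrACA (x1 + x2)) -opprD.
by rewrite (addrACA (x1 + x2 + x3)) -opprD.
Qed.

Section Flow.
Context (R : realType) (n m k : nat) (E : ere_data R n m k).
Implicit Types (th : R -> 'M[R]_(k, n)).

Definition Ath th s := cA E s + cB E s *m th s.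
Definition Cth th s := cC E s + cD E s *m th s.

Definition source th (P2 : R -> 'M[R]_(m, n)) t s : 'M[R]_n :=
  cQ E t s + (th s)^T *m cR E t s *m th s + (P2 s)^T *m cM E t s *m P2 s
  + (Cth th s)^T *m (P2 s)^T *m cN E t s *m P2 s *m Cth th s.

(** The feedback is a parameter here: for fixed [th] and P2 the equation is linear in P1, and the
    same lemmas serve the clamped feedback and Theta. *)
Definition rhs1 th (P1 : R -> R -> 'M[R]_n) (P2 : R -> 'M[R]_(m, n)) t s : 'M[R]_n :=
  P1 t s *m Ath th s + (Ath th s)^T *m P1 t s + (Cth th s)^T *m P1 t s *m Cth th s
  + cQ E t s + (th s)^T *m cR E t s *m th s + (P2 s)^T *m cM E t s *m P2 s
  + (Cth th s)^T *m (P2 s)^T *m cN E t s *m P2 s *m Cth th s.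

Definition rhs2 th (P2 : R -> 'M[R]_(m, n)) s : 'M[R]_(m, n) :=
  P2 s *m Ath th s + (cAh E s + cBh E s *m th s) + cCh E s *m P2 s
  + cDh E s *m P2 s *m Cth th s.

Lemma ere_rhs1E (P1 : R -> R -> 'M[R]_n) (P2 : R -> 'M[R]_(m, n)) t s : ere_rhs1 E P1 P2 t s = rhs1 (Theta E P1 P2) P1 P2 t s.
Proof. by []. Qed.

Lemma ere_rhs2E (P1 : R -> R -> 'M[R]_n) (P2 : R -> 'M[R]_(m, n)) s : ere_rhs2 E P1 P2 s = rhs2 (Theta E P1 P2) P2 s.
Proof. by []. Qed.

Lemma rhs1_source th (P1 : R -> R -> 'M[R]_n) (P2 : R -> 'M[R]_(m, n)) t s : rhs1 th P1 P2 t s =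
  P1 t s *m Ath th s + (Ath th s)^T *m P1 t s + (Cth th s)^T *m P1 t s *m Cth th s
  + source th P2 t s.
Proof. by rewrite /rhs1 /source !addrA. Qed.

Lemma dot_source th (P2 : R -> 'M[R]_(m, n)) t s (x : 'cV[R]_n) : dot x (source th P2 t s *m x) =
  dot x (cQ E t s *m x) + dot (th s *m x) (cR E t s *m (th s *m x))
  + dot (P2 s *m x) (cM E t s *m (P2 s *m x))
  + dot (P2 s *m (Cth th s *m x)) (cN E t s *m (P2 s *m (Cth th s *m x))).
Proof.
rewrite /source; move: (Cth th s) => c.
by rewrite !mulmxDl !dotDr -!mulmxA -!dot_mulmx.
Qed.

Lemma dot_rhs1 th (P1 : R -> R -> 'M[R]_n) (P2 : R -> 'M[R]_(m, n)) t s (x : 'cV[R]_n) : (P1 t s)^T = P1 t s ->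
  dot x (rhs1 th P1 P2 t s *m x) = 2 * dot (P1 t s *m x) (Ath th s *m x)
  + dot (Cth th s *m x) (P1 t s *m (Cth th s *m x)) + dot x (source th P2 t s *m x).
Proof.
move=> sP; rewrite rhs1_source.
move: (Ath th s) (Cth th s) (source th P2 t s) => a c f; rewrite !mulmxDl !dotDr -!mulmxA -!dot_mulmx; congr (_ + _ + _).
by rewrite (sym_dot _ _ sP) dotC mulr2n mulrDl mul1r.
Qed.

Definition valuemx (P1 : R -> R -> 'M[R]_n) (P2 : R -> 'M[R]_(m, n)) s : 'M[R]_n := P1 s s + (P2 s)^T *m cG2 E s *m P2 s.

End Flow.

Definition coercive_data (R : realType) (T : R) (n m k : nat) (E : ere_data R n m k)
    (delta : R) : Prop :=
  forall t s : R, 0 <= t -> t <= s -> s <= T ->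
    [/\ lemx delta%:M (cR E t s), lemx delta%:M (cG2 E t)
      & [/\ lemx 0 (cQ E t s), lemx 0 (cM E t s), lemx 0 (cN E t s)
          & lemx 0 (cG1 E t)]].

Definition monotone_data (R : realType) (T : R) (n m k : nat) (E : ere_data R n m k)
    (Qh : 'M[R]_n) (Rh : 'M[R]_k) (Mh Nh : 'M[R]_m) (G1h : 'M[R]_n) (G2h : 'M[R]_m) :
    Prop :=
  forall t tau s : R, 0 <= t -> t <= tau -> tau <= s -> s <= T ->
    (lemx (cQ E t s) (cQ E tau s) /\ lemx (cQ E tau s) Qh) /\
    (lemx (cR E t s) (cR E tau s) /\ lemx (cR E tau s) Rh) /\
    (lemx (cM E t s) (cM E tau s) /\ lemx (cM E tau s) Mh) /\
    (lemx (cN E t s) (cN E tau s) /\ lemx (cN E tau s) Nh) /\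
    (lemx (cG1 E t) (cG1 E tau) /\ lemx (cG1 E tau) G1h) /\
    (lemx (cG2 E t) (cG2 E tau) /\ lemx (cG2 E tau) G2h).

Section APriori.
Context (R : realType) (n m k : nat) (E : ere_data R n m k) (T : R) (T0 : 0 <= T).
Local Notation mu := (@lebesgue_measure R).
Local Notation Int a b f := (\int[mu]_(r in `[a, b]) f r).

Hypotheses (bA : bdmmx `[0, T] (cA E)) (bB : bdmmx `[0, T] (cB E))
  (bC : bdmmx `[0, T] (cC E)) (bD : bdmmx `[0, T] (cD E))
  (bAh : bdmmx `[0, T] (cAh E)) (bBh : bdmmx `[0, T] (cBh E))
  (bCh : bdmmx `[0, T] (cCh E)) (bDh : bdmmx `[0, T] (cDh E)).
Hypotheses (bQ : forall t, 0 <= t -> t <= T -> bdmmx `[0, T] (cQ E t))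
  (bR : forall t, 0 <= t -> t <= T -> bdmmx `[0, T] (cR E t))
  (bM : forall t, 0 <= t -> t <= T -> bdmmx `[0, T] (cM E t))
  (bN : forall t, 0 <= t -> t <= T -> bdmmx `[0, T] (cN E t)).

Context (delta : R) (Qh : 'M[R]_n) (Rh : 'M[R]_k) (Mh Nh : 'M[R]_m)
  (G1h : 'M[R]_n) (G2h : 'M[R]_m).
Hypothesis hb : coercive_data T E delta.
Hypothesis hc : monotone_data T E Qh Rh Mh Nh G1h G2h.
Hypothesis delta_gt0 : 0 < delta.

Context (a : R) (a0 : 0 <= a) (aT : a <= T).
Context (th : R -> 'M[R]_(k, n)) (P1 : R -> R -> 'M[R]_n) (P2 : R -> 'M[R]_(m, n)).
Hypotheses (bth : bdmmx `[0, T] th) (bP2 : bdmmx `[0, T] P2)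
  (bP1 : forall t, 0 <= t -> t <= T -> bdmmx `[0, T] (P1 t)).
Hypothesis sP1 : forall t s, 0 <= t -> t <= s -> a <= s -> s <= T -> (P1 t s)^T = P1 t s.
Hypothesis eP1 : forall t s s', 0 <= t -> t <= s -> a <= s -> s <= s' -> s' <= T ->
  P1 t s = P1 t s' + mx_integral s s' (rhs1 E th P1 P2 t).
Hypothesis eP1T : forall t, 0 <= t -> t <= T -> P1 t T = cG1 E t.
Hypothesis eP2 : forall s s', a <= s -> s <= s' -> s' <= T ->
  P2 s = P2 s' + mx_integral s s' (rhs2 E th P2).
Hypothesis eP2T : P2 T = cH E.

Lemma lemx_scalar p (d : R) (X : 'M[R]_p) : lemx d%:M X ->
  forall x, d * dot x x <= dot x (X *m x).
Proof. by move=> dX x; have := lemx_dot x dX; rewrite mul_scalar_mx dotZr. Qed.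

Lemma lemx_scalar_psd p (d : R) (X : 'M[R]_p) : 0 <= d -> lemx d%:M X -> psd X.
Proof.
move=> d0 dX; apply/psdP; split; last first.
  by move=> x; apply: le_trans (lemx_scalar dX x); rewrite mulr_ge0 ?dot_ge0.
have := psd_sym dX; rewrite linearB/= tr_scalar_mx => /eqP.
by rewrite (inj_eq (addIr _)) => /eqP.
Qed.

Let psdR_ t s : 0 <= t -> t <= s -> s <= T -> psd (cR E t s).
Proof. by move=> t0 ts sT; have [/(lemx_scalar_psd (ltW delta_gt0))] := hb t0 ts sT. Qed.

Let psdQ_ t s : 0 <= t -> t <= s -> s <= T -> psd (cQ E t s).
Proof. by move=> t0 ts sT; have [_ _ [/lemx0]] := hb t0 ts sT. Qed.

Let psdM_ t s : 0 <= t -> t <= s -> s <= T -> psd (cM E t s).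
Proof. by move=> t0 ts sT; have [_ _ [_ /lemx0]] := hb t0 ts sT. Qed.

Let psdN_ t s : 0 <= t -> t <= s -> s <= T -> psd (cN E t s).
Proof. by move=> t0 ts sT; have [_ _ [_ _ /lemx0]] := hb t0 ts sT. Qed.

Let psdG1_ t : 0 <= t -> t <= T -> psd (cG1 E t).
Proof. by move=> t0 tT; have [_ _ [_ _ _ /lemx0]] := hb t0 tT (lexx T). Qed.

Let psdG2_ t : 0 <= t -> t <= T -> psd (cG2 E t).
Proof. by move=> t0 tT; have [_ /(lemx_scalar_psd (ltW delta_gt0))] := hb t0 tT (lexx T). Qed.

Lemma bdmmx_Ath : bdmmx `[0, T] (Ath E th).
Proof. by apply: nicemxD => //; exact: nicemxM. Qed.

Lemma bdmmx_Cth : bdmmx `[0, T] (Cth E th).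
Proof. by apply: nicemxD => //; exact: nicemxM. Qed.

Lemma bdmmx_source t : 0 <= t -> t <= T -> bdmmx `[0, T] (source E th P2 t).
Proof.
move=> t0 tT; have bC' := bdmmx_Cth; rewrite /source.
apply: nicemxD; [apply: nicemxD; [apply: nicemxD|]|].
- exact: bQ.
- by apply: nicemxM => //; apply: nicemxM; [exact: nicemx_tr | exact: bR].
- by apply: nicemxM => //; apply: nicemxM; [exact: nicemx_tr | exact: bM].
- apply: nicemxM => //; apply: nicemxM => //; apply: nicemxM; last exact: bN.
  by apply: nicemxM; exact: nicemx_tr.
Qed.

Lemma bdmmx_rhs1 t : 0 <= t -> t <= T -> bdmmx `[0, T] (rhs1 E th P1 P2 t).
Proof.
move=> t0 tT; have bA' := bdmmx_Ath; have bC' := bdmmx_Cth; have bP := bP1 t0 tT.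
have -> : rhs1 E th P1 P2 t = (fun s => P1 t s *m Ath E th s + (Ath E th s)^T *m P1 t s
    + (Cth E th s)^T *m P1 t s *m Cth E th s + source E th P2 t s).
  by apply/funext => s; rewrite rhs1_source.
apply: nicemxD; last exact: bdmmx_source.
apply: nicemxD; first apply: nicemxD.
- exact: nicemxM.
- by apply: nicemxM => //; exact: nicemx_tr.
- by apply: nicemxM => //; apply: nicemxM => //; exact: nicemx_tr.
Qed.

Lemma bdmmx_rhs2 : bdmmx `[0, T] (rhs2 E th P2).
Proof.
have bA' := bdmmx_Ath; have bC' := bdmmx_Cth; rewrite /rhs2.
apply: nicemxD; [apply: nicemxD; [apply: nicemxD|]|].
- exact: nicemxM.
- by apply: nicemxD => //; exact: nicemxM.
- exact: nicemxM.
- by apply: nicemxM => //; exact: nicemxM.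
Qed.

(** The equations are assumed only for times s >= a, because in the existence proof they are known
    only there. Optimality of [th] does not enter. *)
Lemma solution_psd t s : 0 <= t -> t <= s -> a <= s -> s <= T -> psd (P1 t s).
Proof.
move=> t0 ts as_ sT; apply/psdP; split; first exact: sP1.
move=> x; have s0 := le_trans t0 ts; have tT := le_trans ts sT.
have sub p q (F : R -> 'M[R]_(p, q)) : bdmmx `[0, T] F -> bdmmx `[s, T] F.
  exact: bdmmx_itvS.
apply: (@lyapunov_psd R n s T (P1 t) (Ath E th) (Cth E th) (source E th P2 t)) => //.
- by apply: sub; exact: bP1.
- by apply: sub; exact: bdmmx_Ath.
- by apply: sub; exact: bdmmx_Cth.
- by apply: sub; exact: bdmmx_source.
- by move=> r sr rT; apply: sP1 => //; [exact: le_trans sr | exact: le_trans sr].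
- move=> r r' sr rr rT; rewrite (eP1 t0 _ _ rr rT); [|exact: le_trans sr|exact: le_trans sr].
  by congr (_ + _); apply: eq_mx_integral => u _ _; rewrite rhs1_source.
- move=> r y sr rT; have tr := le_trans ts sr.
  rewrite dot_source; apply: addr_ge0; [apply: addr_ge0; [apply: addr_ge0|]|];
    by apply: psd_dot; [exact: psdQ_ || exact: psdR_ || exact: psdM_ || exact: psdN_].
- by move=> y; rewrite eP1T//; apply: psd_dot; exact: psdG1_.
Qed.

(** Both rows are driven by the same feedback and the same P2, so their difference solves the
    Lyapunov equation whose source and terminal value are the differences of the data. *)
Lemma solution_monotone t tau s : 0 <= t -> t <= tau -> tau <= s -> a <= s -> s <= T ->
  forall x, dot x (P1 t s *m x) <= dot x (P1 tau s *m x).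
Proof.
move=> t0 tt ts as_ sT x.
have tau0 := le_trans t0 tt; have s0 := le_trans tau0 ts; have tauT := le_trans ts sT.
have ts' := le_trans tt ts; have tT := le_trans tt tauT.
have sub p q (F : R -> 'M[R]_(p, q)) : bdmmx `[0, T] F -> bdmmx `[s, T] F.
  exact: bdmmx_itvS.
rewrite -subr_ge0 -dotBr -mulmxBl.
apply: (@lyapunov_psd R n s T (fun r => P1 tau r - P1 t r) (Ath E th) (Cth E th)
  (fun r => source E th P2 tau r - source E th P2 t r)) => //.
- by apply: nicemxB; apply: sub; exact: bP1.
- by apply: sub; exact: bdmmx_Ath.
- by apply: sub; exact: bdmmx_Cth.
- by apply: nicemxB; apply: sub; exact: bdmmx_source.
- move=> r sr rT; have ar := le_trans as_ sr; rewrite linearB/= !sP1//; lra.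
- move=> r r' sr rr rT; have ar := le_trans as_ sr; have r0 := le_trans s0 sr.
  rewrite (eP1 tau0 (le_trans ts sr) ar rr rT) (eP1 t0 (le_trans ts' sr) ar rr rT).
  rewrite opprD addrACA; congr (_ + _); rewrite -mx_integralB.
  + apply: eq_mx_integral => u _ _; rewrite !rhs1_source.
    move: (Ath E th u) (Cth E th u) (P1 tau u) (P1 t u) => A' C' X Y.
    move: (source E th P2 tau u) (source E th P2 t u) => S S'.
    by rewrite !(mulmxBl, mulmxBr) subr_add4.
  + by apply: bdmmx_itvS (bdmmx_rhs1 tau0 tauT).
  + by apply: bdmmx_itvS (bdmmx_rhs1 t0 tT).
- move=> r y sr rT; have tr := le_trans ts sr.
  rewrite mulmxBl dotBr !dot_source subr_ge0.
  have [[hQ _] [[hR _] [[hM _] [[hN _] _]]]] := hc t0 tt tr rT.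
  by rewrite !lerD ?lemx_dot.
- move=> y; rewrite !eP1T// mulmxBl dotBr subr_ge0.
  have [_ [_ [_ [_ [[hG _] _]]]]] := hc t0 tt tauT (lexx T).
  exact: lemx_dot.
Qed.


Hypotheses (bP1d : bdmmx `[0, T] (fun r => P1 r r)) (bG2 : bdmmx `[0, T] (cG2 E)).
Hypothesis cP1 : forall e, 0 < e -> exists2 d, 0 < d & forall t t' s,
  0 <= t -> t <= t' -> t' <= s -> a <= s -> s <= T -> t' - t < d ->
  absmx (P1 t s - P1 t' s) <= e.
Hypothesis cG2_ : forall e, 0 < e -> exists2 d, 0 < d & forall t t',
  0 <= t -> t <= t' -> t' <= T -> t' - t < d -> absmx (cG2 E t - cG2 E t') <= e.
Hypothesis opt : forall r, a <= r -> r <= T ->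
  control_weight (cD E r) (cR E r r) (cN E r r) (P1 r r) (P2 r) *m th r =
  - control_cross (cC E r) (cB E r) (cD E r) (cBh E r) (cDh E r) (cN E r r)
     (P1 r r) (P2 r) (cG2 E r).
Hypotheses (n_gt0 : (1 <= n)%N) (hG1h : posdef G1h) (hG2h : posdef G2h).

Local Notation G := (Num.max (specnorm G1h) (specnorm G2h)).
Let rate r := ham_rate (cA E r) (cC E r) (cCh E r) (cDh E r) delta G
  (specnorm Mh) (specnorm Nh) n%:R.
Let forcing r := specnorm Qh + G ^+ 2 * specnorm (cAh E r) ^+ 2.
Let v r := specnorm (valuemx E P1 P2 r).
Let f r := rate r * v r + forcing r.

Let G0 : 0 <= G.
Proof. by rewrite le_max specnorm_ge0. Qed.

Let rate_ge0 r : 0 <= rate r.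
Proof.
have sA0 := specnorm_ge0 (cA E r); have sC0 := specnorm_ge0 (cC E r).
have sCh0 := specnorm_ge0 (cCh E r); have sDh0 := specnorm_ge0 (cDh E r).
have sM0 := specnorm_ge0 Mh; have sN0 := specnorm_ge0 Nh.
apply: addr_ge0; first by apply: addr_ge0; rewrite ?sqr_ge0// mulr_ge0.
apply: mulr_ge0; first by rewrite divr_ge0// ltW.
by do 4?[apply: addr_ge0] => //; rewrite !mulr_ge0 ?sqr_ge0.
Qed.

Let forcing_ge0 r : 0 <= forcing r.
Proof. by rewrite addr_ge0 ?specnorm_ge0// mulr_ge0 ?sqr_ge0. Qed.

Let f_ge0 r : 0 <= f r.
Proof. by rewrite addr_ge0// mulr_ge0// specnorm_ge0. Qed.

Let sub p q (F : R -> 'M[R]_(p, q)) s s' : 0 <= s -> s' <= T ->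
  bdmmx `[0, T] F -> bdmmx `[s, s'] F.
Proof. by move=> s0 sT; exact: bdmmx_itvS. Qed.

Lemma bdm_rate : bdm `[0, T] rate.
Proof.
have bs p q (F : R -> 'M[R]_(p, q)) (bF : bdmmx `[0, T] F) :
  bdm `[0, T] (fun r => specnorm (F r)) by exact: bdm_specnorm.
have bc (c : R) : bdm `[0, T] (fun=> c) by exact: nice_cst.
have bsq (h : R -> R) : bdm `[0, T] h -> bdm `[0, T] (fun r => h r ^+ 2).
  by move=> bh; apply: (eq_bdm (f := fun r => h r * h r)) => //; exact: niceM.
have badd (h h' : R -> R) : bdm `[0, T] h -> bdm `[0, T] h' -> bdm `[0, T] (fun r => h r + h' r).
  exact: niceD.
have bmul (h h' : R -> R) : bdm `[0, T] h -> bdm `[0, T] h' -> bdm `[0, T] (fun r => h r * h' r).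
  exact: niceM.
apply: (badd _ _); first by apply: (badd _ _); [apply: (bmul _ _) => //; exact: (bs _ _ _) | apply: (bsq _); exact: (bs _ _ _)].
apply: (bmul _ _) => //; apply: (badd _ _); last first.
  by apply: (bmul _ _); [apply: (bmul _ _) => //; exact: (bs _ _ _) | exact: (bs _ _ _)].
apply: (badd _ _); last by apply: (bmul _ _) => //; exact: (bs _ _ _).
by apply: (badd _ _) => //; apply: (bmul _ _) => //; apply: (bsq _); exact: (bs _ _ _).
Qed.

Lemma bdm_forcing : bdm `[0, T] forcing.
Proof.
apply: niceD; first exact: nice_cst.
apply: niceM; first exact: nice_cst.
apply: (eq_bdm (f := fun r => specnorm (cAh E r) * specnorm (cAh E r))) => //.
by apply: niceM; exact: bdm_specnorm.
Qed.

Lemma bdm_value : bdm `[0, T] v.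
Proof.
apply: bdm_specnorm => //; apply: nicemxD => //; apply: nicemxM => //.
by apply: nicemxM => //; exact: nicemx_tr.
Qed.

Let bdm_f : bdm `[0, T] f.
Proof. by apply: niceD; [apply: niceM; [exact: bdm_rate | exact: bdm_value] | exact: bdm_forcing]. Qed.

Lemma G2_bound t z : 0 <= t -> t <= T -> enorm (cG2 E t *m z) <= G * enorm z.
Proof.
move=> t0 tT; apply: psd_enorm => //; first exact: psdG2_.
move=> y; have [_ [_ [_ [_ [_ [_ h]]]]]] := hc t0 (lexx t) tT (lexx T).
apply: le_trans (lemx_dot y h) _; apply: le_trans (dot_specnorm _ _) _.
by rewrite ler_wpM2r ?dot_ge0// le_max lexx orbT.
Qed.

Lemma valuemx_psd s : a <= s -> s <= T -> psd (valuemx E P1 P2 s).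
Proof.
move=> as_ sT; have s0 := le_trans a0 as_; apply: psdD; first exact: solution_psd.
by apply: psd_conj; exact: psdG2_.
Qed.

Lemma dot_valuemx s x : dot x (valuemx E P1 P2 s *m x) =
  dot x (P1 s s *m x) + dot (P2 s *m x) (cG2 E s *m (P2 s *m x)).
Proof. by rewrite /valuemx mulmxDl dotDr -!mulmxA -dot_mulmx. Qed.

(** The left side is [ham] at the optimal control [th r *m x], which is compared with the zero
    control. On the unit ball the bound f(r) is free of x, so it can be integrated in time. *)
Lemma ham_le r x : a <= r -> r <= T -> enorm x <= 1 ->
  2 * dot (P1 r r *m x) (Ath E th r *m x)
  + dot (Cth E th r *m x) (P1 r r *m (Cth E th r *m x)) + dot x (source E th P2 r r *m x)
  + 2 * dot (cG2 E r *m (P2 r *m x)) (rhs2 E th P2 r *m x) <= f r.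
Proof.
move=> ar rT x1; have r0 := le_trans a0 ar.
have pP := solution_psd r0 (lexx r) ar rT.
have [_ d2 _] := hb r0 (lexx r) rT.
have [[_ hQ] [_ [[_ hM] [[_ hN] _]]]] := hc r0 (lexx r) (lexx r) rT.
have Hopt := @ham_optimal R n m k (cA E r) (cC E r) (cB E r) (cD E r) (cAh E r) (cBh E r)
  (cCh E r) (cDh E r) (cQ E r r) (cR E r r) (cM E r r) (cN E r r) (P1 r r) (P2 r) (cG2 E r)
  pP (psdR_ r0 (lexx r) rT) (psdN_ r0 (lexx r) rT) x (th r *m x).
have Hbd := @ham_bound R n m k (cA E r) (cC E r) (cB E r) (cD E r) (cAh E r) (cBh E r)
  (cCh E r) (cDh E r) (cQ E r r) (cR E r r) (cM E r r) (cN E r r) (P1 r r) (P2 r) (cG2 E r)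
  pP delta G (specnorm Qh) (specnorm Mh) (specnorm Nh) n%:R.
have kap1 : 1 <= n%:R :> R by rewrite ler1n.
have := Hbd delta_gt0 G0 (specnorm_ge0 _) (specnorm_ge0 _) kap1 (lemx_scalar d2)
  (fun z => G2_bound z r0 rT) (fun y => le_trans (lemx_dot y hQ) (dot_specnorm _ _))
  (fun y => le_trans (lemx_dot y hM) (dot_specnorm _ _))
  (fun y => le_trans (lemx_dot y hN) (dot_specnorm _ _)) x.
have {}Hopt := Hopt _; rewrite !mulmxA opt// mulNmx in Hopt.
move=> Hb; have {}Hopt := Hopt erefl.
have xx : dot x x <= 1 by rewrite -enorm_sqr expr_le1// enorm_ge0.
apply: (@le_trans _ _ (f r * dot x x)); last by rewrite ler_piMr.
apply: le_trans Hb; apply: le_trans Hopt; rewrite le_eqVlt; apply/orP; left; apply/eqP.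
rewrite dot_source /ham /drift.
have -> : Ath E th r *m x = cA E r *m x + cB E r *m (th r *m x).
  by rewrite mulmxDl mulmxA.
have CE : Cth E th r *m x = cC E r *m x + cD E r *m (th r *m x).
  by rewrite mulmxDl mulmxA.
have -> : rhs2 E th P2 r *m x = P2 r *m (cA E r *m x + cB E r *m (th r *m x))
    + (cAh E r *m x + cBh E r *m (th r *m x)) + cCh E r *m (P2 r *m x)
    + cDh E r *m (P2 r *m (cC E r *m x + cD E r *m (th r *m x))).
  rewrite -CE /rhs2; move: (Cth E th r) => c; rewrite !(mulmxDl _ _ x) -!mulmxA.
  by congr (P2 r *m _ + _ + _ + _); rewrite /Ath mulmxDl mulmxA.
by rewrite CE; ring.
Qed.

(** The differential inequality for V in increment form, with an error e (s' - s) that is uniform in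
    x and in the position of [s, s']. *)
Lemma value_step e : 0 < e -> exists2 eta, 0 < eta & forall s s' x,
  a <= s -> s <= s' -> s' <= T -> s' - s < eta -> enorm x <= 1 ->
  dot x (valuemx E P1 P2 s *m x) <=
  dot x (valuemx E P1 P2 s' *m x) + Int s s' f + e * (s' - s).
Proof.
move=> e0.
have [ka ka0 Hka] := bdmmx_enorm bdmmx_Ath.
have [kr kr0 Hkr] := bdmmx_enorm bdmmx_rhs2.
have [kz kz0 Hkz] := bdmmx_enorm bP2.
(* K adds up the errors of order e1 h below: 2 ka from P1, 2 kz kr from G2, 2 G kr^2 from the
   variation of P2 in the integrand and G kr^2 from the square of its increment. *)
pose K := 2 * ka + 2 * kz * kr + 3 * G * kr ^+ 2 + 1.
have K0 : 0 < K.
  by rewrite ltr_wpDl// !addr_ge0 ?mulr_ge0 ?sqr_ge0.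
pose e1 := e / K; have e10 : 0 < e1 by rewrite divr_gt0.
have e1K : e1 * K = e by rewrite divfK// gt_eqF.
have [d1 d10 Hd1] := cP1 e10.
have [d2 d20 Hd2] := cG2_ e10.
exists (Num.min d1 (Num.min d2 e1)); first by rewrite !lt_min d10 d20.
move=> s s' x as_ ss sT; rewrite !lt_min => /and3P[hd1 hd2 he1] x1.
set h := s' - s in hd1 hd2 he1 *; have h0 : 0 <= h by rewrite subr_ge0.
have s0 := le_trans a0 as_; have s0' := le_trans s0 ss; have sT' := le_trans ss sT.
have as' := le_trans as_ ss.
have inD r : s <= r -> r <= s' -> `[0, T]%classic r.
  by move=> sr rs; rewrite /= in_itv/= (le_trans s0 sr) (le_trans rs sT).
have le1 (K' : R) : 0 <= K' -> K' * enorm x <= K' by move=> ?; rewrite ler_piMr.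
have ka1 r : s <= r -> r <= s' -> enorm (Ath E th r *m x) <= ka.
  by move=> sr rs; apply: le_trans (Hka _ _ (inD r sr rs)) (le1 _ ka0).
have kr1 r : s <= r -> r <= s' -> enorm (rhs2 E th P2 r *m x) <= kr.
  by move=> sr rs; apply: le_trans (Hkr _ _ (inD r sr rs)) (le1 _ kr0).
have kz1 r : s <= r -> r <= s' -> enorm (P2 r *m x) <= kz.
  by move=> sr rs; apply: le_trans (Hkz _ _ (inD r sr rs)) (le1 _ kz0).
have DP2 r : s <= r -> r <= s' ->
    P2 r *m x - P2 s' *m x = mx_integral r s' (rhs2 E th P2) *m x /\
    enorm (P2 r *m x - P2 s' *m x) <= kr * h.
  move=> sr rs.
  have -> : P2 r *m x - P2 s' *m x = mx_integral r s' (rhs2 E th P2) *m x.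
    by rewrite (eP2 (le_trans as_ sr) rs sT) mulmxDl addrC addKr.
  split=> //; apply: le_trans (enorm_mx_integral rs kr0 (sub (le_trans s0 sr) sT bdmmx_rhs2) _) _.
    by move=> u ru us; apply: Hkr; apply: inD => //; exact: le_trans ru.
  rewrite (le_trans (le1 _ _))//; first by rewrite mulr_ge0// subr_ge0.
  by rewrite ler_wpM2l// lerB.
pose z' := P2 s' *m x.
pose err := 2 * e1 * ka + 2 * (e1 * kz + G * (kr * h)) * kr.
(* All data are moved to the diagonal time r, where [ham_le] applies. Monotonicity handles the
   C-term and the source; the bilinear terms with A and with [rhs2] have no sign and are moved by
   continuity. *)
have point r : s <= r -> r <= s' ->
    dot x (rhs1 E th P1 P2 s r *m x) + 2 * dot (cG2 E s' *m z') (rhs2 E th P2 r *m x)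
    <= f r + err.
  move=> sr rs; have ar := le_trans as_ sr; have rT := le_trans rs sT.
  have r0 := le_trans s0 sr.
  have rsd : r - s < d1 by apply: le_lt_trans hd1; rewrite /h lerD2r.
  have srd : s' - r < d2 by apply: le_lt_trans hd2; rewrite /h lerD2l lerN2.
  rewrite dot_rhs1; last exact: sP1.
  have i1 : dot (P1 s r *m x) (Ath E th r *m x) <=
      dot (P1 r r *m x) (Ath E th r *m x) + e1 * ka.
    rewrite -lerBlDl -dotBl -mulmxBl; apply: le_trans (dot_le _ _) _.
    rewrite ler_pM ?enorm_ge0 ?ka1//; apply: le_trans (enorm_mulmx_abs _ _) _.
    apply: le_trans (ler_wpM2l (absmx_ge0 _) x1) _; rewrite mulr1.
    by apply: Hd1 => //; exact: le_trans rs sT.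
  have i2 := @solution_monotone s r r s0 sr (lexx r) ar rT (Cth E th r *m x).
  have i3 : dot x (source E th P2 s r *m x) <= dot x (source E th P2 r r *m x).
    have [[hQ _] [[hR _] [[hM _] [[hN _] _]]]] := hc s0 sr (lexx r) rT.
    by rewrite !dot_source !lerD ?lemx_dot.
  have i4 : dot (cG2 E s' *m z') (rhs2 E th P2 r *m x) <=
      dot (cG2 E r *m (P2 r *m x)) (rhs2 E th P2 r *m x) + (e1 * kz + G * (kr * h)) * kr.
    rewrite -lerBlDl -dotBl; apply: le_trans (dot_le _ _) _.
    rewrite ler_pM ?enorm_ge0 ?kr1//.
    have -> : cG2 E s' *m z' - cG2 E r *m (P2 r *m x) =
      - ((cG2 E r - cG2 E s') *m z' + cG2 E r *m (P2 r *m x - z')).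
      rewrite mulmxBl mulmxBr [in RHS]addrC addrA subrK opprB //.
    rewrite enormN; apply: le_trans (enormD _ _) _; rewrite lerD//.
      apply: le_trans (enorm_mulmx_abs _ _) _; rewrite ler_pM ?absmx_ge0 ?enorm_ge0//.
        exact: Hd2.
      exact: kz1.
    apply: le_trans (G2_bound _ r0 rT) _; rewrite ler_wpM2l//.
    by have [] := DP2 r sr rs.
  have i5 := ham_le ar rT x1.
  by rewrite /err; lra.
have bint : bdm `[s, s'] (fun r => dot x (rhs1 E th P1 P2 s r *m x)).
  by apply: bdm_form; apply: sub => //; exact: bdmmx_rhs1.
have bint2 : bdm `[s, s'] (fun r => dot (cG2 E s' *m z') (rhs2 E th P2 r *m x)).
  by apply: bdm_form; apply: sub => //; exact: bdmmx_rhs2.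
have bint3 : bdm `[s, s'] (fun r => 2 * dot (cG2 E s' *m z') (rhs2 E th P2 r *m x)).
  by apply: niceM => //; exact: nice_cst.
have bf : bdm `[s, s'] f by apply: bdm_itvS bdm_f.
have I1 : Int s s' (fun r => dot x (rhs1 E th P1 P2 s r *m x)) +
    2 * Int s s' (fun r => dot (cG2 E s' *m z') (rhs2 E th P2 r *m x)) <=
    Int s s' f + err * h.
  rewrite -intZ// -intD// -int_cst// -intD//; last exact: nice_cst.
  by apply: int_le => //; [exact: niceD | apply: niceD => //; exact: nice_cst].
rewrite !dot_valuemx.
(* Along row s from (s, s) to (s, s') by the equation, then from (s, s') up to the diagonal point
   (s', s') by monotonicity in the first argument. *)
have J1 : dot x (P1 s s *m x) <= dot x (P1 s' s' *m x) +
    Int s s' (fun r => dot x (rhs1 E th P1 P2 s r *m x)).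
  rewrite {1}(eP1 s0 (lexx s) as_ ss sT) mulmxDl dotDr dot_mx_integral ?lerD2r//; last first.
    by apply: sub => //; exact: bdmmx_rhs1.
  exact: solution_monotone.
have [DE Dn] := DP2 s (lexx s) ss.
set De := P2 s *m x - P2 s' *m x in DE Dn.
have zE : P2 s *m x = z' + De by rewrite /De /z' addrC subrK.
move: De DE Dn zE => De DE Dn zE.
(* After G2(s) <= G2(s'), the form of G2(s') is expanded at z' = P2(s') x; the linear part is the
   integral and the quadratic part is O(h^2). *)
have J2 : dot (P2 s *m x) (cG2 E s *m (P2 s *m x)) <=
   dot z' (cG2 E s' *m z') +
   2 * Int s s' (fun r => dot (cG2 E s' *m z') (rhs2 E th P2 r *m x)) + G * kr ^+ 2 * h * e1.
  have [_ [_ [_ [_ [_ [hG2 _]]]]]] := hc s0 ss sT (lexx T).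
  apply: le_trans (lemx_dot _ hG2) _; rewrite zE mulmxDr !dotDl !dotDr.
  have sG2 := psd_sym (psdG2_ s0' sT).
  rewrite (sym_dot De z' sG2) -dot_mx_integral; last by apply: sub => //; exact: bdmmx_rhs2.
  rewrite -DE.
  have -> : dot z' (cG2 E s' *m De) = dot (cG2 E s' *m z') De by rewrite dot_mulmx sG2.
  have : dot De (cG2 E s' *m De) <= G * kr ^+ 2 * h * e1.
    apply: le_trans (dot_le _ _) _.
    apply: (@le_trans _ _ (kr * h * (G * (kr * h)))).
      rewrite ler_pM ?enorm_ge0//; apply: le_trans (G2_bound _ s0' sT) _.
      by rewrite ler_wpM2l.
    have -> : kr * h * (G * (kr * h)) = G * kr ^+ 2 * h * h by ring.
    by rewrite ler_wpM2l ?(ltW he1)// !mulr_ge0 ?sqr_ge0.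
  lra.
have J3 : err * h + G * kr ^+ 2 * h * e1 <= e * h.
  have eh : err <= 2 * e1 * ka + 2 * (e1 * kz + G * (kr * e1)) * kr.
    by rewrite /err lerD2l ler_wpM2r// ler_wpM2l// lerD2l ler_wpM2l// ler_wpM2l// ltW.
  have := ler_wpM2r h0 eh; rewrite -e1K /K.
  have : 0 <= e1 * h by rewrite mulr_ge0// ltW.
  lra.
by move: I1 J1 J2 J3; rewrite -/z'; lra.
Qed.

Lemma dot_value_le s x : a <= s -> s <= T -> enorm x <= 1 ->
  dot x (valuemx E P1 P2 s *m x) <= G + G * specnorm (cH E) ^+ 2 + Int s T f.
Proof.
move=> as_ sT x1; have s0 := le_trans a0 as_.
have VT : dot x (valuemx E P1 P2 T *m x) <= G + G * specnorm (cH E) ^+ 2.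
  rewrite dot_valuemx eP1T// eP2T.
  have [_ [_ [_ [_ [[_ hG1] [_ hG2]]]]]] := hc T0 (lexx T) (lexx T) (lexx T).
  have xx : enorm x ^+ 2 <= 1 by rewrite expr_le1// enorm_ge0.
  rewrite lerD//.
    apply: le_trans (lemx_dot x hG1) _; apply: le_trans (dot_specnorm _ _) _.
    rewrite -enorm_sqr; apply: (@le_trans _ _ (G * enorm x ^+ 2)).
      by rewrite ler_wpM2r ?sqr_ge0// le_max lexx.
    by rewrite ler_piMr.
  apply: le_trans (lemx_dot _ hG2) _; apply: le_trans (dot_specnorm _ _) _.
  rewrite -enorm_sqr ler_pM ?specnorm_ge0 ?sqr_ge0//; first by rewrite le_max lexx orbT.
  rewrite lerXn2r ?nnegrE ?enorm_ge0 ?specnorm_ge0//.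
  by apply: le_trans (enorm_mulmx _ _) _; rewrite ler_piMr ?specnorm_ge0.
rewrite -lerBlDr; apply: le_trans VT.
pose Phi u := dot x (valuemx E P1 P2 u *m x) - Int u T f.
have : Phi s <= Phi T.
  apply: telescope => // e e0; have [eta eta0 He] := value_step e0.
  exists eta => // u u' su uu uT ue.
  have au := le_trans as_ su.
  have := He u u' x au uu uT ue x1; rewrite /Phi (@int_chasles _ u u' T f)//.
    by lra.
  by apply: bdm_itvS bdm_f => //; exact: le_trans au.
by rewrite /Phi int_pt subr0.
Qed.

Lemma dot_homogeneous p (X : 'M[R]_p) (c : R) :
  (forall x, enorm x <= 1 -> dot x (X *m x) <= c) ->
  forall x, dot x (X *m x) <= c * dot x x.
Proof.
move=> H x; have [x0|x0] := eqVneq (enorm x) 0.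
  by rewrite (enorm_eq0 x0) mulmx0 !dot0r mulr0.
have x1 : 0 < enorm x by rewrite lt_neqAle eq_sym x0 enorm_ge0.
have := H ((enorm x)^-1 *: x); rewrite enormZ ger0_norm ?invr_ge0 ?enorm_ge0// mulVf//.
move=> /(_ (lexx _)); rewrite -scalemxAr dotZl dotZr mulrA -expr2 exprVn mulrC.
by rewrite ler_pdivrMr ?exprn_gt0// enorm_sqr.
Qed.

(** V(s) is positive semi-definite, so the bound on its form bounds its norm, and Gronwall applies
    to the norm. Integrals over [s, T] are then enlarged to [0, T]. *)
Lemma value_bound s : a <= s -> s <= T ->
  specnorm (valuemx E P1 P2 s) <= CstarV T E delta Qh Mh Nh G1h G2h.
Proof.
move=> as_ sT; have s0 := le_trans a0 as_.
have c0 : 0 <= G + G * specnorm (cH E) ^+ 2 by rewrite addr_ge0// mulr_ge0 ?sqr_ge0.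
have sub1 h u : 0 <= u -> bdm `[0, T] h -> bdm `[u, T] h by move=> ?; exact: bdm_itvS.
have brate := bdm_rate; have bforc := bdm_forcing; have bv := bdm_value.
have I0 h u : (forall r, 0 <= h r) -> 0 <= Int u T h by move=> h0; apply: int_ge0.
have main : v s <= (G + G * specnorm (cH E) ^+ 2 + Int s T forcing) * expR (Int s T rate).
  apply: (@gronwall R s T v rate forcing) => //; [exact: sub1|exact: sub1|exact: sub1| |].
    by move=> r _ _; exact: specnorm_ge0.
  move=> u su uT; have au := le_trans as_ su.
  apply: psd_specnorm; first exact: valuemx_psd.
    by rewrite addr_ge0// I0.
  by apply: dot_homogeneous => x x1; exact: dot_value_le.
apply: (le_trans main); rewrite /CstarV.
have mono h : bdm `[0, T] h -> (forall r, 0 <= h r) -> Int s T h <= Int 0 T h.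
  move=> bh h0; rewrite (@int_chasles _ 0 s T h)//.
  by rewrite lerDr int_ge0.
apply: ler_pM; [|exact: expR_ge0| |].
- by rewrite addr_ge0// I0.
- by rewrite lerD2l mono.
- by rewrite ler_expR mono.
Qed.

(** Off the diagonal P1(t, s) <= P1(s, s) <= V(s). The sum of the bounds for P1 and for P2 serves
    both, so that one clamping level is enough. *)
Lemma entries_bound t s : 0 <= t -> t <= s -> a <= s -> s <= T ->
  let c := CstarV T E delta Qh Mh Nh G1h G2h in
  (forall i j, `|P1 t s i j| <= c + Num.sqrt (c / delta)) /\
  (forall i j, `|P2 s i j| <= c + Num.sqrt (c / delta)).
Proof.
move=> t0 ts as_ sT c; have s0 := le_trans t0 ts.
have vc : specnorm (valuemx E P1 P2 s) <= c by exact: value_bound.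
have c0 : 0 <= c by apply: le_trans vc; exact: specnorm_ge0.
have pss := solution_psd s0 (lexx s) as_ sT.
have Vx x : dot x (valuemx E P1 P2 s *m x) <= c * dot x x.
  by apply: le_trans (dot_specnorm _ _) _; rewrite ler_wpM2r ?dot_ge0.
split=> i j; apply: (le_trans (specnorm_entry _ _ _)).
  apply: (@le_trans _ _ c); last by rewrite lerDl sqrtr_ge0.
  apply: psd_specnorm => //; first exact: solution_psd.
  move=> x; apply: le_trans (Vx x); rewrite dot_valuemx.
  apply: (@le_trans _ _ (dot x (P1 s s *m x))); first exact: solution_monotone.
  by rewrite lerDl psd_dot//; exact: psdG2_.
apply: (@le_trans _ _ (Num.sqrt (c / delta))); last by rewrite lerDr.
apply: specnorm_le => x x1; rewrite enorm_le ?sqrtr_ge0// sqr_sqrtr; last first.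
  by rewrite divr_ge0// ltW.
rewrite ler_pdivlMr// mulrC.
have [_ d2 _] := hb s0 (lexx s) sT.
apply: le_trans (lemx_scalar d2 _) _.
apply: (@le_trans _ _ (dot x (valuemx E P1 P2 s *m x))).
  by rewrite dot_valuemx lerDr psd_dot.
apply: le_trans (Vx x) _; rewrite ler_piMr//.
by rewrite -enorm_sqr expr_le1// enorm_ge0.
Qed.

End APriori.

(** * The clamped equation *)

Section Tame.
Context (R : realType) (T : R) (n m k : nat).

Definition data_close (E : ere_data R n m k) (d t t' : R) : Prop := forall s,
  [/\ forall i j, `|cQ E t s i j - cQ E t' s i j| <= d,
      forall i j, `|cR E t s i j - cR E t' s i j| <= d,
      forall i j, `|cM E t s i j - cM E t' s i j| <= d &
  [/\ forall i j, `|cN E t s i j - cN E t' s i j| <= d,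
      forall i j, `|cG1 E t i j - cG1 E t' i j| <= d &
      forall i j, `|cG2 E t i j - cG2 E t' i j| <= d]].

(* Data bounded everywhere, and continued to all real times t, s. *)
Record tame (E : ere_data R n m k) (K : R) : Prop := Tame {
  tame_A : bdmmx `[0, T] (cA E);
  tame_B : bdmmx `[0, T] (cB E);
  tame_C : bdmmx `[0, T] (cC E);
  tame_D : bdmmx `[0, T] (cD E);
  tame_Ah : bdmmx `[0, T] (cAh E);
  tame_Bh : bdmmx `[0, T] (cBh E);
  tame_Ch : bdmmx `[0, T] (cCh E);
  tame_Dh : bdmmx `[0, T] (cDh E);
  tame_Qb : forall t s i j, `|cQ E t s i j| <= K;
  tame_Rb : forall t s i j, `|cR E t s i j| <= K;
  tame_Mb : forall t s i j, `|cM E t s i j| <= K;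
  tame_Nb : forall t s i j, `|cN E t s i j| <= K;
  tame_G1b : forall t i j, `|cG1 E t i j| <= K;
  tame_G2b : forall t i j, `|cG2 E t i j| <= K;
  tame_Qm : forall t, mxmeas `[0, T] (cQ E t);
  tame_Rm : forall t, mxmeas `[0, T] (cR E t);
  tame_Mm : forall t, mxmeas `[0, T] (cM E t);
  tame_Nm : forall t, mxmeas `[0, T] (cN E t);
  tame_Rd : mxmeas `[0, T] (fun s => cR E s s);
  tame_Nd : mxmeas `[0, T] (fun s => cN E s s);
  tame_G2m : mxmeas `[0, T] (cG2 E);
  tame_Qs : forall t s, (cQ E t s)^T = cQ E t s;
  tame_Rs : forall t s, (cR E t s)^T = cR E t s;
  tame_Ms : forall t s, (cM E t s)^T = cM E t s;
  tame_Ns : forall t s, (cN E t s)^T = cN E t s;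
  tame_G1s : forall t, (cG1 E t)^T = cG1 E t;
  tame_cl : forall e, 0 < e -> exists2 d, 0 < d &
    forall t t', `|t - t'| < d -> data_close E e t t'
}.

End Tame.

Section Clamp.
Context (R : realType).

Definition clamp (K x : R) : R := Num.max (Num.min x K) (- K).

Lemma clamp_id K x : `|x| <= K -> clamp K x = x.
Proof. by rewrite ler_norml /clamp => /andP[h1 h2]; rewrite min_l// max_l. Qed.

Lemma clamp_bound K x : 0 <= K -> `|clamp K x| <= K.
Proof.
move=> K0; rewrite /clamp ler_norml le_max lexx orbT/= ge_max ge_min lexx orbT/=.
by rewrite (le_trans _ K0)// oppr_le0.
Qed.

Lemma clamp_lip K x y : `|clamp K x - clamp K y| <= `|x - y|.
Proof.
have maxl (u v c : R) : `|Num.max u c - Num.max v c| <= `|u - v|.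
  case: (leP u c) => h; case: (leP v c) => h'.
  - by rewrite subrr normr0.
  - by rewrite ler0_norm ?ler0_norm; lra.
  - by rewrite ger0_norm ?ger0_norm; lra.
  - by [].
apply: (le_trans (maxl _ _ _)).
case: (leP x K) => h; case: (leP y K) => h'.
- by [].
- by rewrite ler0_norm ?ler0_norm; lra.
- by rewrite ger0_norm ?ger0_norm; lra.
- by rewrite subrr normr0.
Qed.

Lemma measurable_clamp (D : set R) K (f : R -> R) : measurable_fun D f ->
  measurable_fun D (fun s => clamp K (f s)).
Proof.
move=> mf; apply: (@measurable_maxr _ _ _ _ (fun s => Num.min (f s) K) (cst (- K))) => //.
by apply: (@measurable_minr _ _ _ _ f (cst K)).
Qed.

End Clamp.

Section ClampedEquation.
Context (R : realType) (T : R) (T0 : 0 <= T) (n m k : nat) (E : ere_data R n m k).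
Context (KE : R) (tE : tame T E KE) (delta : R) (delta_gt0 : 0 < delta) (K : R) (K0 : 0 <= K).

Local Notation I := ('I_n * 'I_n + 'I_m * 'I_n)%type.
Local Notation Z := (R * (I -> R) * (I -> R))%type.
Local Notation close := (pic_close (data_close E)).
Local Notation adm := (@pic_adm R T I).
Local Notation nice_ := (nice `[0, T] close adm).
Local Notation nicemx_ := (nicemx `[0, T] close adm).

(** Symmetrizing makes the right-hand side symmetric for every state, so symmetry of the solution is
    read off the integral equation instead of being carried through the iteration. *)
Definition M1 (u : I -> R) : 'M[R]_n :=
  let X := \matrix_(i, j) clamp K (u (inl (i, j))) in 2^-1 *: (X + X^T).

Definition M2 (u : I -> R) : 'M[R]_(m, n) := \matrix_(i, j) clamp K (u (inr (i, j))).

Definition cweight (r : R) (P : 'M[R]_n) (P2 : 'M[R]_(m, n)) : 'M[R]_k :=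
  control_weight (cD E r) (cR E r r) (cN E r r) P P2.

Definition ccross (r : R) (P : 'M[R]_n) (P2 : 'M[R]_(m, n)) : 'M[R]_(k, n) :=
  control_cross (cC E r) (cB E r) (cD E r) (cBh E r) (cDh E r) (cN E r r) P P2 (cG2 E r).

Definition thetaK (r : R) (v : I -> R) : 'M[R]_(k, n) :=
  - (reginv (detlb k delta) (cweight r (M1 v) (M2 v)) *m ccross r (M1 v) (M2 v)).

(** The row values z.1.2 enter only through P1(t, r); the feedback and P2 are read from the diagonal
    values z.2. P2 is thus stored as a family of rows that all coincide. *)
Definition FK (i : I) (r : R) (z : Z) : R :=
  match i with
  | inl ij => rhs1 E (fun=> thetaK r z.2) (fun _ _ => M1 z.1.2) (fun=> M2 z.2) z.1.1 r ij.1 ij.2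
  | inr ij => rhs2 E (fun=> thetaK r z.2) (fun=> M2 z.2) r ij.1 ij.2
  end.

Definition gK (i : I) (t : R) : R :=
  match i with
  | inl ij => cG1 E t ij.1 ij.2
  | inr ij => cH E ij.1 ij.2
  end.

Lemma M1_sym u : (M1 u)^T = M1 u.
Proof. by rewrite /M1 linearZ/= linearD/= trmxK addrC. Qed.

Lemma nice_clamp1 i : nice_ (fun _ z => clamp K (z.1.2 i)).
Proof.
split=> [g [_ m1 _]|]; first by apply: measurable_clamp; exact: m1.
exists (K + 1); split=> [|r _]; first by rewrite addr_ge0.
split=> [z|d z z' d0 [_ h _]].
  by apply: (le_trans (clamp_bound _ K0)); rewrite lerDl.
apply: (le_trans (clamp_lip _ _ _)); apply: (le_trans (h i)).
by rewrite ler_peMl// lerDr.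
Qed.

Lemma nice_clamp2 i : nice_ (fun _ z => clamp K (z.2 i)).
Proof.
split=> [g [_ _ m2]|]; first by apply: measurable_clamp; exact: m2.
exists (K + 1); split=> [|r _]; first by rewrite addr_ge0.
split=> [z|d z z' d0 [_ _ h]].
  by apply: (le_trans (clamp_bound _ K0)); rewrite lerDl.
apply: (le_trans (clamp_lip _ _ _)); apply: (le_trans (h i)).
by rewrite ler_peMl// lerDr.
Qed.

Lemma nice_data (f : R -> R -> R) : (forall t, measurable_fun `[0, T] (f t)) ->
  (forall t s, `|f t s| <= KE) ->
  (forall d t t', data_close E d t t' -> forall s, `|f t s - f t' s| <= d) ->
  nice_ (fun r z => f z.1.1 r).
Proof.
move=> mf fK fc.
have KE0 : 0 <= KE by apply: le_trans (fK 0 0).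
split=> [g [[t gt] _ _]|].
  rewrite (_ : (fun r => f (g r).1.1 r) = f t); first exact: mf.
  by apply/funext => r; rewrite gt.
exists (KE + 1); split=> [|r _]; first by rewrite addr_ge0.
split=> [z|d z z' d0 [h _ _]].
  by apply: (le_trans (fK _ _)); rewrite lerDl.
by apply: (le_trans (fc _ _ _ h r)); rewrite ler_peMl// lerDr.
Qed.

Lemma nicemx_bdmmx p q (F : R -> 'M[R]_(p, q)) :
  bdmmx `[0, T] F -> nicemx_ (fun r _ => F r).
Proof. by move=> bF i j; exact: bdm_nice (bF i j). Qed.

Lemma mxmeas_bdmmx p q (F : R -> 'M[R]_(p, q)) (c : R) :
  mxmeas `[0, T] F -> (forall s i j, `|F s i j| <= c) -> bdmmx `[0, T] F.
Proof. by move=> mF Fc i j; apply: (@bdmP _ _ _ c) => // r _; exact: Fc. Qed.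

Lemma nicemx_M1u : nicemx_ (fun _ z => M1 z.1.2).
Proof.
have nX : nicemx_ (fun _ z => \matrix_(i, j) clamp K (z.1.2 (inl (i, j)))).
  by move=> i j; apply: eq_nice (nice_clamp1 (inl (i, j))) => r z; rewrite mxE.
by apply: nicemxZ; [exact: nice_cst | apply: nicemxD => //; exact: nicemx_tr].
Qed.

Lemma nicemx_M1v : nicemx_ (fun _ z => M1 z.2).
Proof.
have nX : nicemx_ (fun _ z => \matrix_(i, j) clamp K (z.2 (inl (i, j)))).
  by move=> i j; apply: eq_nice (nice_clamp2 (inl (i, j))) => r z; rewrite mxE.
by apply: nicemxZ; [exact: nice_cst | apply: nicemxD => //; exact: nicemx_tr].
Qed.

Lemma nicemx_M2v : nicemx_ (fun _ z => M2 z.2).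
Proof.
by move=> i j; apply: eq_nice (nice_clamp2 (inr (i, j))) => r z; rewrite mxE.
Qed.

Lemma nicemx_thetaK : nicemx_ (fun r z => thetaK r z.2).
Proof.
have nD := nicemx_bdmmx (tame_D tE); have nB := nicemx_bdmmx (tame_B tE).
have nC := nicemx_bdmmx (tame_C tE); have nBh := nicemx_bdmmx (tame_Bh tE).
have nDh := nicemx_bdmmx (tame_Dh tE).
have nR : nicemx_ (fun r _ => cR E r r).
  by apply: nicemx_bdmmx; apply: mxmeas_bdmmx (tame_Rd tE) _ => s; exact: (tame_Rb tE).
have nN : nicemx_ (fun r _ => cN E r r).
  by apply: nicemx_bdmmx; apply: mxmeas_bdmmx (tame_Nd tE) _ => s; exact: (tame_Nb tE).
have nG2 : nicemx_ (fun r _ => cG2 E r).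
  by apply: nicemx_bdmmx; apply: mxmeas_bdmmx (tame_G2m tE) _ => s; exact: (tame_G2b tE).
have nP := nicemx_M1v; have nP2 := nicemx_M2v.
have nPN : nicemx_ (fun r z => M1 z.2 + (M2 z.2)^T *m cN E r r *m M2 z.2).
  by apply: nicemxD => //; apply: nicemxM => //; apply: nicemxM => //; exact: nicemx_tr.
have nW : nicemx_ (fun r z => cweight r (M1 z.2) (M2 z.2)).
  apply: nicemxD => //; apply: nicemxM => //; apply: nicemxM => //; exact: nicemx_tr.
have nX : nicemx_ (fun r z => ccross r (M1 z.2) (M2 z.2)).
  apply: nicemxD; first apply: nicemxD.
  - by apply: nicemxM => //; exact: nicemx_tr.
  - by apply: nicemxM => //; apply: nicemxM => //; exact: nicemx_tr.
  - apply: nicemxM => //; apply: nicemxM => //; apply: nicemxD; first apply: nicemxD.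
    + exact: nicemx_tr.
    + by apply: nicemxM; exact: nicemx_tr.
    + by apply: nicemxM; [apply: nicemxM|]; exact: nicemx_tr.
apply: nicemxN; apply: nicemxM => //.
apply: nicemxZ; last exact: nicemx_adj.
have nd := nice_det nW.
apply: niceM => //; apply: (@nice_inv _ _ _ _ _ _ (detlb k delta)).
- exact: detlb_gt0.
- by move=> r z _; rewrite le_max lexx orbT.
apply: nice_max; exact: niceM.
Qed.

Lemma nicemx_tQ : nicemx_ (fun r z => cQ E z.1.1 r).
Proof.
move=> i j; apply: (nice_data (f := fun t s => cQ E t s i j)).
- by move=> t; exact: (tame_Qm tE).
- by move=> t s; exact: (tame_Qb tE).
- by move=> d t t' h s; have [h1 _ _ _] := h s.
Qed.

Lemma nicemx_tR : nicemx_ (fun r z => cR E z.1.1 r).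
Proof.
move=> i j; apply: (nice_data (f := fun t s => cR E t s i j)).
- by move=> t; exact: (tame_Rm tE).
- by move=> t s; exact: (tame_Rb tE).
- by move=> d t t' h s; have [_ h1 _ _] := h s.
Qed.

Lemma nicemx_tM : nicemx_ (fun r z => cM E z.1.1 r).
Proof.
move=> i j; apply: (nice_data (f := fun t s => cM E t s i j)).
- by move=> t; exact: (tame_Mm tE).
- by move=> t s; exact: (tame_Mb tE).
- by move=> d t t' h s; have [_ _ h1 _] := h s.
Qed.

Lemma nicemx_tN : nicemx_ (fun r z => cN E z.1.1 r).
Proof.
move=> i j; apply: (nice_data (f := fun t s => cN E t s i j)).
- by move=> t; exact: (tame_Nm tE).
- by move=> t s; exact: (tame_Nb tE).
- by move=> d t t' h s; have [_ _ _ [h1 _ _]] := h s.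
Qed.

(** After clamping and regularization every entry is built from bounded Lipschitz pieces by sums,
    products and one inverse bounded away from 0. *)
Lemma nice_FK i : nice_ (FK i).
Proof.
have nth := nicemx_thetaK; have nP := nicemx_M1u; have nP2 := nicemx_M2v.
have nA' : nicemx_ (fun r z => cA E r + cB E r *m thetaK r z.2).
  apply: nicemxD; first exact: nicemx_bdmmx (tame_A tE).
  by apply: nicemxM => //; exact: nicemx_bdmmx (tame_B tE).
have nC' : nicemx_ (fun r z => cC E r + cD E r *m thetaK r z.2).
  apply: nicemxD; first exact: nicemx_bdmmx (tame_C tE).
  by apply: nicemxM => //; exact: nicemx_bdmmx (tame_D tE).
case: i => [[i j]|[i j]].
- apply: (@nicemx_entry _ _ _ _ _ n n (fun r z => rhs1 E (fun=> thetaK r z.2)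
    (fun _ _ => M1 z.1.2) (fun=> M2 z.2) z.1.1 r)); rewrite /rhs1 /Ath /Cth.
  have nAt := nicemx_tr nA'; have nCt := nicemx_tr nC'.
  apply: nicemxD; [apply: nicemxD; [apply: nicemxD; [apply: nicemxD; [apply: nicemxD; [apply: nicemxD|]|]|]|]|].
  + exact: nicemxM.
  + exact: nicemxM.
  + by apply: nicemxM => //; exact: nicemxM.
  + exact: nicemx_tQ.
  + by apply: nicemxM => //; apply: nicemxM; [exact: nicemx_tr | exact: nicemx_tR].
  + by apply: nicemxM => //; apply: nicemxM; [exact: nicemx_tr | exact: nicemx_tM].
  + apply: nicemxM => //; apply: nicemxM => //; apply: nicemxM; last exact: nicemx_tN.
    by apply: nicemxM => //; exact: nicemx_tr.
- apply: (@nicemx_entry _ _ _ _ _ m n (fun r z => rhs2 E (fun=> thetaK r z.2)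
    (fun=> M2 z.2) r)); rewrite /rhs2 /Ath /Cth.
  apply: nicemxD; [apply: nicemxD; [apply: nicemxD|]|].
  + exact: nicemxM.
  + apply: nicemxD; first exact: nicemx_bdmmx (tame_Ah tE).
    by apply: nicemxM => //; exact: nicemx_bdmmx (tame_Bh tE).
  + by apply: nicemxM => //; exact: nicemx_bdmmx (tame_Ch tE).
  + apply: nicemxM => //; apply: nicemxM => //; exact: nicemx_bdmmx (tame_Dh tE).
Qed.

End ClampedEquation.

(* A replacement for congr where comparing the summands by conversion diverges. *)
Lemma congrD (V : nmodType) (x x' y y' : V) : x = x' -> y = y' -> x + y = x' + y'.
Proof. by move=> -> ->. Qed.

Lemma rhs1_sym (R : realType) (n m k : nat) (E : ere_data R n m k)
  (th : R -> 'M[R]_(k, n)) (P1 : R -> R -> 'M[R]_n) (P2 : R -> 'M[R]_(m, n)) t s :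
  (P1 t s)^T = P1 t s -> (cQ E t s)^T = cQ E t s -> (cR E t s)^T = cR E t s ->
  (cM E t s)^T = cM E t s -> (cN E t s)^T = cN E t s ->
  (rhs1 E th P1 P2 t s)^T = rhs1 E th P1 P2 t s.
Proof.
move=> sP sQ sR sM sN; rewrite /rhs1; move: (Ath E th s) (Cth E th s) => A C.
rewrite !linearD/= !trmx_mul !trmxK sP sQ sR sM sN !mulmxA.
by rewrite [X in X + _ + _ + _ + _ + _]addrC.
Qed.

(** * The a priori estimate on an interval [a, T] *)

Section RegionSolution.
Context (R : realType) (T : R) (T0 : 0 <= T) (n m k : nat) (E : ere_data R n m k).

(** Common form of the clamped solution on [a, T] and of a solution of the ERE with a = 0, so that
    the estimate is proved once. Optimality of [th] is kept apart since it is deduced from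
    positivity. *)
Record region_solution (a : R) (th : R -> 'M[R]_(k, n)) (P1 : R -> R -> 'M[R]_n)
    (P2 : R -> 'M[R]_(m, n)) : Prop := RegionSolution {
  rs_th : bdmmx `[0, T] th;
  rs_P2 : bdmmx `[0, T] P2;
  rs_P1 : forall t, 0 <= t -> t <= T -> bdmmx `[0, T] (P1 t);
  rs_P1d : bdmmx `[0, T] (fun r => P1 r r);
  rs_sym : forall t s, 0 <= t -> t <= s -> a <= s -> s <= T -> (P1 t s)^T = P1 t s;
  rs_eq1 : forall t s s', 0 <= t -> t <= s -> a <= s -> s <= s' -> s' <= T ->
    P1 t s = P1 t s' + mx_integral s s' (rhs1 E th P1 P2 t);
  rs_eq1T : forall t, 0 <= t -> t <= T -> P1 t T = cG1 E t;
  rs_eq2 : forall s s', a <= s -> s <= s' -> s' <= T ->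
    P2 s = P2 s' + mx_integral s s' (rhs2 E th P2);
  rs_eq2T : P2 T = cH E;
  rs_cont : forall e, 0 < e -> exists2 d, 0 < d & forall t t' s i j,
    0 <= t -> t <= t' -> t' <= s -> a <= s -> s <= T -> t' - t < d ->
    `|P1 t s i j - P1 t' s i j| <= e
}.

Context (KE : R) (tE : tame T E KE).
Context (delta : R) (Qh : 'M[R]_n) (Rh : 'M[R]_k) (Mh Nh : 'M[R]_m)
  (G1h : 'M[R]_n) (G2h : 'M[R]_m).
Hypothesis delta_gt0 : 0 < delta.
Hypothesis hb : coercive_data T E delta.
Hypothesis hc : monotone_data T E Qh Rh Mh Nh G1h G2h.
Hypotheses (n_gt0 : (1 <= n)%N).

Lemma tame_Q t : 0 <= t -> t <= T -> bdmmx `[0, T] (cQ E t).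
Proof. by move=> _ _; apply: mxmeas_bdmmx (tame_Qm tE t) _ => s; exact: (tame_Qb tE). Qed.
Lemma tame_R t : 0 <= t -> t <= T -> bdmmx `[0, T] (cR E t).
Proof. by move=> _ _; apply: mxmeas_bdmmx (tame_Rm tE t) _ => s; exact: (tame_Rb tE). Qed.
Lemma tame_M t : 0 <= t -> t <= T -> bdmmx `[0, T] (cM E t).
Proof. by move=> _ _; apply: mxmeas_bdmmx (tame_Mm tE t) _ => s; exact: (tame_Mb tE). Qed.
Lemma tame_N t : 0 <= t -> t <= T -> bdmmx `[0, T] (cN E t).
Proof. by move=> _ _; apply: mxmeas_bdmmx (tame_Nm tE t) _ => s; exact: (tame_Nb tE). Qed.

Lemma cweight_coercive r P P2 : 0 <= r -> r <= T -> psd P ->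
  forall x, delta * dot x x <= dot x (cweight E r P P2 *m x).
Proof.
move=> r0 rT pP x; rewrite /cweight dot_control_weight.
have [dR _ [_ _ /lemx0 pN _]] := hb r0 (lexx r) rT.
apply: le_trans (lemx_scalar dR x) _; rewrite -addrA lerDl.
by rewrite addr_ge0// psd_dot.
Qed.

Definition optimal (a : R) th P1 P2 : Prop := forall r, a <= r -> r <= T ->
  cweight E r (P1 r r) (P2 r) *m th r = - ccross E r (P1 r r) (P2 r).

Lemma invmx_optimal r P P2 : 0 <= r -> r <= T -> psd P ->
  cweight E r P P2 *m - (invmx (cweight E r P P2) *m ccross E r P P2) =
  - ccross E r P P2.
Proof.
move=> r0 rT pP; rewrite mulmxN mulmxA mulmxV ?mul1mx//.
exact: coercive_unitmx delta_gt0 (cweight_coercive P2 r0 rT pP).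
Qed.

Context (a : R) (a0 : 0 <= a) (aT : a <= T).
Context (th : R -> 'M[R]_(k, n)) (P1 : R -> R -> 'M[R]_n) (P2 : R -> 'M[R]_(m, n)).
Hypothesis sol : region_solution a th P1 P2.

Lemma region_rhs1 t : 0 <= t -> t <= T -> bdmmx `[0, T] (rhs1 E th P1 P2 t).
Proof.
case: sol => *; apply: bdmmx_rhs1 => //; try by case: tE.
- exact: tame_Q.
- exact: tame_R.
- exact: tame_M.
- exact: tame_N.
Qed.

Lemma region_rhs2 : bdmmx `[0, T] (rhs2 E th P2).
Proof. by case: sol => *; apply: bdmmx_rhs2 => //; case: tE. Qed.

Lemma region_psd t s : 0 <= t -> t <= s -> a <= s -> s <= T -> psd (P1 t s).
Proof.
exact: (solution_psd (tame_A tE) (tame_B tE) (tame_C tE) (tame_D tE) tame_Q tame_R tame_M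
  tame_N hb delta_gt0 (rs_th sol) (rs_P2 sol) (rs_P1 sol) (rs_sym sol) (rs_eq1 sol)
  (rs_eq1T sol)).
Qed.

Lemma absmx_small (p : nat) (e : R) : 0 < e -> exists2 e', 0 < e' &
  forall X : 'M[R]_p, (forall i j, `|X i j| <= e') -> absmx X <= e.
Proof.
move=> e0; have p0 : 0 < p%:R * p%:R + 1 :> R by rewrite ltr_wpDl// mulr_ge0.
exists (e / (p%:R * p%:R + 1)) => [|X HX]; first by rewrite divr_gt0.
apply: (le_trans (absmx_le HX)).
rewrite mulrCA ler_piMr ?(ltW e0)// ler_pdivrMr// mul1r lerDl//.
Qed.

Let P1cont e : 0 < e -> exists2 d, 0 < d & forall t t' s,
  0 <= t -> t <= t' -> t' <= s -> a <= s -> s <= T -> t' - t < d ->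
  absmx (P1 t s - P1 t' s) <= e.
Proof.
move=> /(absmx_small n)[e' e'0 He]; have [d d0 Hd] := rs_cont sol e'0.
exists d => // t t' s t0 tt ts as_ sT td; apply: He => i j; rewrite !mxE.
exact: Hd.
Qed.

Let G2cont e : 0 < e -> exists2 d, 0 < d & forall t t',
  0 <= t -> t <= t' -> t' <= T -> t' - t < d -> absmx (cG2 E t - cG2 E t') <= e.
Proof.
move=> /(absmx_small m)[e' e'0 He]; have [d d0 Hd] := tame_cl tE e'0.
exists d => // t t' t0 tt tT td; apply: He => i j; rewrite !mxE.
have : `|t - t'| < d by rewrite distrC ger0_norm ?subr_ge0.
by move=> /Hd /(_ 0)[_ _ _ [_ _]].
Qed.

Lemma region_value s : optimal a th P1 P2 -> a <= s -> s <= T ->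
  specnorm (valuemx E P1 P2 s) <= CstarV T E delta Qh Mh Nh G1h G2h.
Proof.
have bG2 : bdmmx `[0, T] (cG2 E).
  by apply: mxmeas_bdmmx (tame_G2m tE) _ => r; exact: (tame_G2b tE).
move=> opt.
exact: (value_bound T0 (tame_A tE) (tame_B tE) (tame_C tE) (tame_D tE) (tame_Ah tE)
  (tame_Bh tE) (tame_Ch tE) (tame_Dh tE) tame_Q tame_R tame_M tame_N hb hc delta_gt0 a0
  (rs_th sol) (rs_P2 sol) (rs_P1 sol) (rs_sym sol) (rs_eq1 sol) (rs_eq1T sol) (rs_eq2 sol)
  (rs_eq2T sol) (rs_P1d sol) bG2 P1cont G2cont opt n_gt0).
Qed.

Definition stateb : R :=
  let c := CstarV T E delta Qh Mh Nh G1h G2h in c + Num.sqrt (c / delta).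

Lemma region_entries t s : optimal a th P1 P2 -> 0 <= t -> t <= s -> a <= s -> s <= T ->
  (forall i j, `|P1 t s i j| <= stateb) /\ (forall i j, `|P2 s i j| <= stateb).
Proof.
have bG2 : bdmmx `[0, T] (cG2 E).
  by apply: mxmeas_bdmmx (tame_G2m tE) _ => r; exact: (tame_G2b tE).
move=> opt.
exact: (entries_bound T0 (tame_A tE) (tame_B tE) (tame_C tE) (tame_D tE) (tame_Ah tE)
  (tame_Bh tE) (tame_Ch tE) (tame_Dh tE) tame_Q tame_R tame_M tame_N hb hc delta_gt0 a0
  (rs_th sol) (rs_P2 sol) (rs_P1 sol) (rs_sym sol) (rs_eq1 sol) (rs_eq1T sol) (rs_eq2 sol)
  (rs_eq2T sol) (rs_P1d sol) bG2 P1cont G2cont opt n_gt0).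
Qed.

End RegionSolution.

(** * The clamping is never active *)

Section ClampedSolution.
Context (R : realType) (T : R) (T0 : 0 <= T) (n m k : nat) (E : ere_data R n m k).
Context (KE : R) (tE : tame T E KE).
Context (delta : R) (Qh : 'M[R]_n) (Rh : 'M[R]_k) (Mh Nh : 'M[R]_m)
  (G1h : 'M[R]_n) (G2h : 'M[R]_m).
Hypothesis delta_gt0 : 0 < delta.
Hypothesis hb : coercive_data T E delta.
Hypothesis hc : monotone_data T E Qh Rh Mh Nh G1h G2h.
Hypotheses (n_gt0 : (1 <= n)%N).

Local Notation I := ('I_n * 'I_n + 'I_m * 'I_n)%type.
Local Notation Z := (R * (I -> R) * (I -> R))%type.
Local Notation mu := (@lebesgue_measure R).
Local Notation Int a b f := (\int[mu]_(r in `[a, b]) f r).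
Local Notation bound := (stateb T E delta Qh Mh Nh G1h G2h).

Lemma CstarV_ge0 : 0 <= CstarV T E delta Qh Mh Nh G1h G2h.
Proof.
rewrite /CstarV; set G := Num.max _ _.
have G0 : 0 <= G by rewrite le_max specnorm_ge0.
apply: mulr_ge0; last exact: expR_ge0.
apply: addr_ge0; first by rewrite addr_ge0// mulr_ge0 ?sqr_ge0.
by apply: int_ge0 => r _ _; rewrite addr_ge0 ?specnorm_ge0// mulr_ge0 ?sqr_ge0.
Qed.

Lemma stateb_ge0 : 0 <= bound.
Proof. by apply: addr_ge0; [exact: CstarV_ge0 | exact: sqrtr_ge0]. Qed.

Lemma KE_ge0 : 0 <= KE.
Proof.
by apply: le_trans (tame_Qb tE 0 0 (Ordinal n_gt0) (Ordinal n_gt0)).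
Qed.

(* The clamping level leaves a margin of 1 above the a priori bound. *)
Definition level : R := bound + 1 + KE + absmx (cH E).

Lemma level_ge0 : 0 <= level.
Proof.
apply: addr_ge0; last exact: absmx_ge0.
by apply: addr_ge0; [apply: addr_ge0; first exact: stateb_ge0 | exact: KE_ge0].
Qed.

Lemma level_parts : [/\ 1 <= level, KE + absmx (cH E) <= level & 1 + bound <= level].
Proof.
have := stateb_ge0; have := KE_ge0; have := absmx_ge0 (cH E); rewrite /level.
by split; lra.
Qed.

Local Notation F := (FK E delta level).
Local Notation g := (@gK R n m k E).

Lemma entry_absmx p q (X : 'M[R]_(p, q)) i j : `|X i j| <= absmx X.
Proof.
rewrite /absmx (bigD1 i)//= (bigD1 j)//= -addrA lerDl.
by apply: addr_ge0; apply: sumr_ge0 => i' _ //; apply: sumr_ge0.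
Qed.

Lemma gK_bound i t : `|g i t| <= KE + absmx (cH E).
Proof.
case: i => -[i j] /=.
  by apply: (le_trans (tame_G1b tE _ _ _)); rewrite lerDl absmx_ge0.
by apply: (le_trans (entry_absmx _ _ _)); rewrite lerDr KE_ge0.
Qed.

Lemma clamped_constant : exists2 L, 1 <= L &
  [/\ forall i t, `|g i t| <= L,
      forall i d t t', 0 <= d -> data_close E d t t' -> `|g i t - g i t'| <= L * d,
      forall i r z, 0 <= r -> r <= T -> `|F i r z| <= L &
      forall i r d z z', 0 <= r -> r <= T -> 0 <= d ->
        pic_close (data_close E) d z z' -> `|F i r z - F i r z'| <= L * d].
Proof.
have /choice[b Hb] : forall i, exists b, 0 <= b /\ forall r, `[0, T]%classic r ->
    (forall z, `|F i r z| <= b) /\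
    (forall d z z', 0 <= d -> pic_close (data_close E) d z z' -> `|F i r z - F i r z'| <= b * d).
  by move=> i; have [_] := nice_FK tE delta_gt0 level_ge0 i.
have bs i : b i <= \sum_j b j.
  by rewrite (bigD1 i)//= lerDl sumr_ge0// => j _; case: (Hb j).
have s0 : 0 <= \sum_j b j by apply: sumr_ge0 => j _; case: (Hb j).
have [l1 l2 _] := level_parts.
(* The sum covers all components of F at once. Adding [level] covers the terminal data and gives L
   >= 1, which their dependence on t requires. *)
exists (\sum_j b j + level); first by apply: (le_trans l1); rewrite lerDr.
split.
- move=> i t; apply: (le_trans (gK_bound i t)).
  by apply: (le_trans l2); rewrite lerDr.
- move=> i d t t' d0 h; apply: (@le_trans _ _ (1 * d)); last first.
    by rewrite ler_wpM2r//; apply: (le_trans l1); rewrite lerDr.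
  rewrite mul1r; case: i => -[i j] /=; last by rewrite subrr normr0.
  by have [_ _ _ [_ h1 _]] := h 0.
- move=> i r z r0 rT; have [_ /(_ r)] := Hb i.
  rewrite /= in_itv/= r0 rT => /(_ isT)[/(_ z) h _].
  by apply: (le_trans h); apply: (le_trans (bs i)); rewrite lerDl level_ge0.
- move=> i r d z z' r0 rT d0 zz'; have [_ /(_ r)] := Hb i.
  rewrite /= in_itv/= r0 rT => /(_ isT)[_ /(_ d z z' d0 zz') h].
  apply: (le_trans h); rewrite ler_wpM2r//; apply: (le_trans (bs i)).
  by rewrite lerDl level_ge0.
Qed.

Lemma data_closexx d t : 0 <= d -> data_close E d t t.
Proof. by move=> d0 s; split; [| | |split] => *; rewrite subrr normr0. Qed.

Lemma M1_state (K : R) (u : I -> R) (P : 'M[R]_n) : P^T = P ->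
  (forall i j, u (inl (i, j)) = P i j) -> (forall i j, `|P i j| <= K) ->
  M1 K u = P.
Proof.
move=> sP uP bP; apply/matrixP => i j; rewrite /M1 !mxE !uP !clamp_id//.
by have -> : P j i = P i j; [rewrite -[in LHS]sP mxE | field].
Qed.

Lemma M2_state (K : R) (u : I -> R) (P : 'M[R]_(m, n)) :
  (forall i j, u (inr (i, j)) = P i j) -> (forall i j, `|P i j| <= K) ->
  M2 K u = P.
Proof. by move=> uP bP; apply/matrixP => i j; rewrite /M2 !mxE uP clamp_id. Qed.

Lemma thetaK_optimal (K r : R) (v : I -> R) : 0 <= r -> r <= T -> psd (M1 K v) ->
  thetaK E delta K r v =
  - (invmx (cweight E r (M1 K v) (M2 K v)) *m ccross E r (M1 K v) (M2 K v)).
Proof.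
move=> r0 rT pP; rewrite /thetaK reginvE//.
exact: cweight_coercive hb _ _ _ r0 rT pP.
Qed.

Section Solution.
Context (U : I -> R -> R -> R) (L : R) (L1 : 1 <= L).
Hypothesis gL : forall i t, `|g i t| <= L.
Hypothesis FL : forall i r z, 0 <= r -> r <= T -> `|F i r z| <= L.
Hypothesis cU : pic_ucont T U.
Hypothesis eU : forall i t s, 0 <= s -> s <= T -> U i t s = pic T F g U i t s.

Definition stP1 t s : 'M[R]_n := \matrix_(i, j) U (inl (i, j)) t s.
Definition stP2 s : 'M[R]_(m, n) := \matrix_(i, j) U (inr (i, j)) s s.
Definition stth r : 'M[R]_(k, n) := thetaK E delta level r (fun j => U j r r).

Let L0 : 0 <= L. Proof. exact: le_trans L1. Qed.

Let Ubd i t s : 0 <= s -> s <= T -> `|U i t s| <= L + L * T.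
Proof.
move=> s0 sT; rewrite eU// /pic (le_trans (ler_normD _ _))// lerD//.
apply: (@le_trans _ _ (L * (T - s))); last by rewrite ler_wpM2l// lerBlDr lerDl.
apply: int_norm => //; last by move=> r sr rT; apply: FL => //; exact: le_trans sr.
by apply: (pic_bdm (nice_FK tE delta_gt0 level_ge0)) => //; exact: pic_ucont_meas.
Qed.

Let bint i t s s' : 0 <= s -> s' <= T -> bdm `[s, s'] (fun r => F i r (pic_arg U t r)).
Proof.
move=> s0 sT.
by apply: (pic_bdm (nice_FK tE delta_gt0 level_ge0)) => //; exact: pic_ucont_meas.
Qed.

Lemma st_bdm_row t : bdmmx `[0, T] (stP1 t).
Proof.
have [m1 _] := pic_ucont_meas t cU.
move=> i j; apply: (@eq_bdm _ _ (U (inl (i, j)) t)); first by move=> r _; rewrite mxE.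
apply: (@bdmP _ _ _ (L + L * T)) => // r; rewrite /= in_itv/= => /andP[r0 rT].
exact: Ubd.
Qed.

Lemma st_bdm_diag : bdmmx `[0, T] (fun r => stP1 r r).
Proof.
have [_ m1] := pic_ucont_meas 0 cU.
move=> i j; apply: (@eq_bdm _ _ (fun r => U (inl (i, j)) r r)); first by move=> r _; rewrite mxE.
apply: (@bdmP _ _ _ (L + L * T)) => // r; rewrite /= in_itv/= => /andP[r0 rT].
exact: Ubd.
Qed.

Lemma st_bdm_P2 : bdmmx `[0, T] stP2.
Proof.
have [_ m1] := pic_ucont_meas 0 cU.
move=> i j; apply: (@eq_bdm _ _ (fun r => U (inr (i, j)) r r)); first by move=> r _; rewrite mxE.
apply: (@bdmP _ _ _ (L + L * T)) => // r; rewrite /= in_itv/= => /andP[r0 rT].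
exact: Ubd.
Qed.

Lemma st_bdm_th : bdmmx `[0, T] stth.
Proof.
have [m1 m2] := pic_ucont_meas 0 cU.
move=> i j; have nth := nicemx_thetaK tE delta_gt0 level_ge0 i j.
apply: (nice_bdm nth (g := fun r => pic_arg U 0 r)).
by split; [exists 0 | exact: m1 | exact: m2].
Qed.

Lemma st_sym t s : 0 <= s -> s <= T -> (stP1 t s)^T = stP1 t s.
Proof.
move=> s0 sT; apply/matrixP => i j; rewrite !mxE !eU// /pic /=.
rewrite -[in LHS](tame_G1s tE) mxE; apply: congrD; first by [].
  apply: eq_int => r _ _.
rewrite -[in LHS]rhs1_sym ?mxE//.
- exact: M1_sym.
- exact: (tame_Qs tE).
- exact: (tame_Rs tE).
- exact: (tame_Ms tE).
- exact: (tame_Ns tE).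
Qed.

(** The P2 components of the right-hand side ignore t and the row values, so both sides have the
    same integral representation. *)
Lemma st_inr i t t' s : 0 <= s -> s <= T -> U (inr i) t s = U (inr i) t' s.
Proof. by move=> s0 sT; rewrite eU// [RHS]eU. Qed.

Lemma st_diff i t s s' : 0 <= s -> s <= s' -> s' <= T ->
  U i t s = U i t s' + Int s s' (fun r => F i r (pic_arg U t r)).
Proof.
move=> s0 ss sT; rewrite (eU _ _ s0 (le_trans ss sT)) (eU _ _ (le_trans s0 ss) sT) /pic.
by rewrite (@int_chasles _ s s' T)//; [ring | exact: bint].
Qed.

Section Region.
Context (a : R) (a0 : 0 <= a) (aT : a <= T).
Hypothesis ub : forall i t u, 0 <= t -> t <= u -> a <= u -> u <= T -> `|U i t u| <= level.

Lemma st_M1 t r : 0 <= t -> t <= r -> a <= r -> r <= T ->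
  M1 level (fun j => U j t r) = stP1 t r.
Proof.
move=> t0 tr ar rT; apply: M1_state => [|i j|i j]; rewrite ?mxE//.
  by apply: st_sym => //; exact: le_trans ar.
exact: ub.
Qed.

Lemma st_M2 r : a <= r -> r <= T -> M2 level (fun j => U j r r) = stP2 r.
Proof.
move=> ar rT; apply: M2_state => i j; rewrite mxE//.
by apply: ub => //; exact: le_trans ar.
Qed.

Lemma st_region : region_solution T E a stth stP1 stP2.
Proof.
split.
- exact: st_bdm_th.
- exact: st_bdm_P2.
- by move=> t _ _; exact: st_bdm_row.
- exact: st_bdm_diag.
- by move=> t s t0 ts as_ sT; apply: st_sym => //; exact: le_trans as_.
- move=> t s s' t0 ts as_ ss sT; have s0 := le_trans a0 as_.
  apply/matrixP => i j; rewrite [LHS]mxE [RHS]mxE.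
  rewrite [X in _ = X + _]mxE.
  rewrite [X in _ = _ + X]mxE.
  rewrite (st_diff _ _ s0 ss sT).
  apply: congrD; first by [].
  apply: eq_int => r sr rs /=; have ar := le_trans as_ sr; have rT := le_trans rs sT.
  by rewrite /rhs1 /= st_M1// ?(le_trans ts sr)// st_M2.
- move=> t t0 tT; apply/matrixP => i j.
  by rewrite mxE eU// /pic int_pt addr0.
- move=> s s' as_ ss sT; have s0 := le_trans a0 as_.
  apply/matrixP => i j; rewrite [LHS]mxE [RHS]mxE [X in _ = X + _]mxE
    [X in _ = _ + X]mxE (st_diff _ _ s0 ss sT).
  rewrite (st_inr _ s s'); [|exact: le_trans ss|by []]; apply: congrD; first by [].
  apply: eq_int => r sr rs /=; have ar := le_trans as_ sr; have rT := le_trans rs sT.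
  by rewrite /rhs2 /= st_M2.
- apply/matrixP => i j.
  by rewrite mxE eU// /pic int_pt addr0.
- move=> e e0; have [d d0 Hd] := cU e0; exists d => // t t' s i j t0 tt ts as_ sT td.
  rewrite !mxE ltW// Hd ?subrr ?normr0//; first exact: le_trans as_.
    exact: le_trans as_.
  by rewrite distrC ger0_norm// subr_ge0.
Qed.

Lemma st_psd t s : 0 <= t -> t <= s -> a <= s -> s <= T -> psd (stP1 t s).
Proof. exact: (region_psd tE delta_gt0 hb st_region). Qed.

(** Not circular: [st_psd] holds for any bounded feedback. It makes the control weight coercive, and
    there the regularized inverse is the inverse. *)
Lemma st_th_inv r : a <= r -> r <= T -> stth r =
  - (invmx (cweight E r (stP1 r r) (stP2 r)) *m ccross E r (stP1 r r) (stP2 r)).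
Proof.
move=> ar rT; have r0 := le_trans a0 ar.
by rewrite /stth thetaK_optimal ?st_M1 ?st_M2//; exact: st_psd.
Qed.

Lemma st_optimal : optimal T E a stth stP1 stP2.
Proof.
move=> r ar rT; have r0 := le_trans a0 ar.
by rewrite st_th_inv// (invmx_optimal delta_gt0 hb)//; exact: st_psd.
Qed.

Lemma st_bound i t s : 0 <= t -> t <= s -> a <= s -> s <= T -> `|U i t s| <= bound.
Proof.
move=> t0 ts as_ sT; have s0 := le_trans a0 as_.
have [h1 h2] := region_entries T0 tE delta_gt0 hb hc n_gt0 a0 st_region st_optimal t0 ts as_ sT.
case: i => -[i j]; first by have := h1 i j; rewrite mxE.
by have := h2 i j; rewrite mxE (st_inr _ t s).
Qed.

End Region.

(** If U stays within [level] on [a', T], it is even within [bound] there, which is at least 1 below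
    [level]. As U is L-Lipschitz in s, it stays within [level] for a further time 1/L. *)
Lemma st_global i t s : 0 <= t -> t <= s -> s <= T -> `|U i t s| <= level.
Proof.
move=> t0 ts sT; have s0 := le_trans t0 ts.
have eta0 : 0 < L^-1 by rewrite invr_gt0 (lt_le_trans ltr01).
suff : forall i t u, 0 <= t -> t <= u -> 0 <= u -> u <= T -> `|U i t u| <= level by exact.
apply: (@backward_induction R (fun a => forall i t u, 0 <= t -> t <= u -> a <= u -> u <= T ->
  `|U i t u| <= level) 0 T L^-1) => //.
  move=> i' t' u t0' tu Tu uT; have -> : u = T by apply/eqP; rewrite eq_le uT.
  rewrite eU// /pic int_pt addr0; apply: (le_trans (gK_bound i' t')).
  by have [] := level_parts.
move=> a a' aa0 aa aT' ae IH i' t' u t0' tu au uT.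
have a0' := le_trans aa0 aa.
have [ua|ua] := leP a' u; first by apply: IH.
have u0 := le_trans t0' tu.
(* The row t' contains the time a', so u and a' are compared on one row. *)
have ta : t' <= a' by rewrite (le_trans tu)// ltW.
have h1 : `|U i' t' a'| <= bound by exact: (st_bound a0' IH).
have h2 : `|U i' t' u - U i' t' a'| <= 1.
  rewrite eU// [X in _ - X]eU//.
  apply: (le_trans (pic_lipschitz g
    (nice_FK tE delta_gt0 level_ge0) FL i' (pic_ucont_meas t' cU) u0 (ltW ua) aT')).
  apply: (@le_trans _ _ (L * (a' - a))); first by rewrite ler_wpM2l// lerD2l lerN2.
  by rewrite mulrC -ler_pdivlMr ?(lt_le_trans ltr01)// mul1r ltW.
rewrite -(subrK (U i' t' a') (U i' t' u)) (le_trans (ler_normD _ _))//.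
by apply: (le_trans (lerD h2 h1)); have [] := level_parts.
Qed.

End Solution.

End ClampedSolution.

(** * Continuity on compact sets *)

Section UniformOnCompact.
Context (R : realType).

(** Compactness in near-covering form: a radius that works for all points near each x in A works on
    A at once. Halving r makes room for the triangle inequality. *)
Lemma heine_cantor (V : pseudoMetricType R) (A : set V) (h : V -> R) : compact A ->
  {within A, continuous h} -> forall e, 0 < e -> exists2 d, 0 < d &
    forall z z', A z -> A z' -> ball z d z' -> `|h z - h z'| < e.
Proof.
move=> /compact_near_coveringP cA /subspace_continuousP ch e e0.
pose P (d : R) z := A z -> forall z', A z' -> ball z d z' -> `|h z - h z'| < e.
have : \forall d \near 0^'+, A `<=` P d.
  apply: cA => x Ax.
  have e20 : 0 < e / 2 by rewrite divr_gt0.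
  have /cvgrPdist_lt /(_ _ e20) := ch x Ax.
  rewrite near_withinE => /nbhs_ballP[r /= r0 Hr].
  have r20 : 0 < r / 2 by rewrite divr_gt0.
  exists (ball x (r / 2), [set d | d < r / 2]).
    by split; [exact: nbhsx_ballx | exact: nbhs_right_lt].
  move=> [z d] [/= xz dr] Az z' Az' zz'.
  have r2r : r / 2 <= r by lra.
  have h1 : `|h x - h z| < e / 2 by exact: (Hr z (le_ball r2r xz) Az).
  have xz' : ball x r z'.
    by rewrite (splitr r); apply: ball_triangle xz (le_ball (ltW dr) zz').
  have h2 : `|h x - h z'| < e / 2 by exact: (Hr z' xz' Az').
  rewrite -(subrKA (h x)) (le_lt_trans (ler_normD _ _))//.
  by rewrite (splitr e) ltrD// distrC.
move=> Hd; have : \forall d \near 0^'+, 0 < d /\ A `<=` P d.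
  by apply: filterI => //; exact: nbhs_right_gt.
by move=> /filter_ex[d [d0 AP]]; exists d => // z z' Az; exact: AP.
Qed.

Lemma continuous_within_entry (V : topologicalType) (A : set V) p q
  (f : V -> 'M[R]_(p, q)) i j :
  {within A, continuous f} -> {within A, continuous (fun z => f z i j)}.
Proof.
move=> /subspace_continuousP cf; apply/subspace_continuousP => x Ax.
apply: (@cvg_comp _ _ _ f (fun M : 'M[R]_(p, q) => M i j) _ (nbhs (f x)) (nbhs (f x i j))).
  exact: cf.
exact: coord_continuous.
Qed.

Lemma heine_cantor_mx (V : pseudoMetricType R) (A : set V) p q (f : V -> 'M[R]_(p, q)) :
  compact A -> {within A, continuous f} -> forall e, 0 < e -> exists2 d, 0 < d &
    forall z z' i j, A z -> A z' -> ball z d z' -> `|f z i j - f z' i j| < e.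
Proof.
move=> cA cf e e0.
have /choice[d Hd] : forall ij : 'I_p * 'I_q, exists d, 0 < d /\ forall z z', A z -> A z' ->
    ball z d z' -> `|f z ij.1 ij.2 - f z' ij.1 ij.2| < e.
  move=> [i j]; have cij := @continuous_within_entry _ A p q f i j cf.
  by have [d d0 h] := heine_cantor cA cij e0; exists d.
exists (\big[Num.min/1]_ij d ij).
  by apply/bigmin_gtP; split=> // ij _; case: (Hd ij).
move=> z z' i j Az Az' zz'; have [_ h] := Hd (i, j); apply: (h _ _ Az Az').
by apply: le_ball zz'; exact: (bigmin_le _ (i, j)).
Qed.

Lemma compact_bounded_mx (V : topologicalType) (A : set V) p q (f : V -> 'M[R]_(p, q)) :
  compact A -> {within A, continuous f} ->
  exists2 K, 0 <= K & forall z i j, A z -> `|f z i j| <= K.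
Proof.
move=> cA cf.
have /choice[b Hb] : forall ij : 'I_p * 'I_q, exists b, 0 <= b /\ forall z, A z ->
    `|f z ij.1 ij.2| <= b.
  move=> [i j]; have cij := @continuous_within_entry _ A p q f i j cf.
  have /compact_bounded[M [_ HM]] := continuous_compact cij cA.
  exists (Num.max M 0 + 1); split; first by rewrite addr_ge0// le_max lexx orbT.
  move=> z Az; apply: (HM (Num.max M 0 + 1)); last by exists z.
  by rewrite (@le_lt_trans _ _ (Num.max M 0)) ?ltrDl// le_max lexx.
exists (\sum_ij b ij); first by apply: sumr_ge0 => ij _; case: (Hb ij).
move=> z i j Az; rewrite (bigD1 (i, j))//= -[leLHS]addr0 lerD//.
  by have [_ /(_ _ Az)] := Hb (i, j).
by apply: sumr_ge0 => ij _; case: (Hb ij).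
Qed.

Lemma continuous_within_mx (V : pseudoMetricType R) (A : set V) p q (f : V -> 'M[R]_(p, q)) :
  (forall e, 0 < e -> exists2 d, 0 < d & forall z z' i j, A z -> A z' -> ball z d z' ->
     `|f z i j - f z' i j| < e) ->
  {within A, continuous f}.
Proof.
move=> H; apply/subspace_continuousP => x Ax; apply/cvg_ballP => e e0.
have [d d0 Hd] := H e e0.
rewrite near_withinE; apply/nbhs_ballP; exists d => //= y xy Ay.
by split=> // i j; exact: Hd.
Qed.

Lemma triangle_compact (T : R) : compact (triangle T).
Proof.
apply: (@subclosed_compact _ _ (`[0, T]%classic `*` `[0, T]%classic)).
- have -> : triangle T = [set p : R * R | 0 <= p.1] `&` ([set p | 0 <= p.2 - p.1] `&` [set p | p.2 <= T]).
    apply/seteqP; split=> [[t s] /= [h1 [h2 h3]]|[t s] /= [h1 [h2 h3]]].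
      by split=> //; split; rewrite ?subr_ge0.
    by split=> //; rewrite subr_ge0 in h2; split.
  apply: closedI; last apply: closedI.
  + apply: (@closed_comp _ _ (fun p : R * R => p.1) [set x | 0 <= x]); last exact: closed_ge.
    by move=> p _; exact: cvg_fst.
  + apply: (@closed_comp _ _ (fun p : R * R => p.2 - p.1) [set x | 0 <= x]); last exact: closed_ge.
    by move=> p _; apply: cvgB; [exact: cvg_snd | exact: cvg_fst].
  + apply: (@closed_comp _ _ (fun p : R * R => p.2) [set x | x <= T]); last exact: closed_le.
    by move=> p _; exact: cvg_snd.
- by apply: compact_setX; exact: segment_compact.
- move=> [t s] /= [h1 [h2 h3]]; by rewrite !in_itv/= h1 h3 andbT (le_trans h2 h3) (le_trans h1 h2).
Qed.

Lemma square_compact (T : R) : compact (square T).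
Proof.
have -> : square T = `[0, T]%classic `*` `[0, T]%classic.
  by apply/seteqP; split=> -[t s] /=; rewrite !in_itv.
by apply: compact_setX; exact: segment_compact.
Qed.

End UniformOnCompact.

(** * Existence and uniqueness for bounded data *)

Section TameTheorem.
Context (R : realType) (T : R) (T0 : 0 <= T) (n m k : nat) (E : ere_data R n m k).
Context (KE : R) (tE : tame T E KE).
Context (delta : R) (Qh : 'M[R]_n) (Rh : 'M[R]_k) (Mh Nh : 'M[R]_m)
  (G1h : 'M[R]_n) (G2h : 'M[R]_m).
Hypothesis delta_gt0 : 0 < delta.
Hypothesis hb : coercive_data T E delta.
Hypothesis hc : monotone_data T E Qh Rh Mh Nh G1h G2h.
Hypotheses (n_gt0 : (1 <= n)%N).

Local Notation I := ('I_n * 'I_n + 'I_m * 'I_n)%type.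
Local Notation mu := (@lebesgue_measure R).
Local Notation Int a b f := (\int[mu]_(r in `[a, b]) f r).
Local Notation bound := (stateb T E delta Qh Mh Nh G1h G2h).
Local Notation lev := (level T E KE delta Qh Mh Nh G1h G2h).
Local Notation F := (FK E delta lev).
Local Notation g := (@gK R n m k E).

Lemma maxr_lip (t x y : R) : `|Num.max t x - Num.max t y| <= `|x - y|.
Proof.
case: (leP t x) => h; case: (leP t y) => h'.
- by [].
- by rewrite ger0_norm ?ger0_norm; lra.
- by rewrite ler0_norm ?ler0_norm; lra.
- by rewrite subrr normr0.
Qed.

(* Extends P1 to s < t, where the equation does not determine it. *)
Definition upper_ext (P1 : R -> R -> 'M[R]_n) t s := P1 t (Num.max t s).

Section EreSolution.
Context (P1 : R -> R -> 'M[R]_n) (P2 : R -> 'M[R]_(m, n)).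
Hypothesis sol : ere_solution T E P1 P2.

Local Notation Q1 := (upper_ext P1).
Local Notation th := (Theta E P1 P2).

Let cP1 : {within triangle T, continuous (fun z : R * R => P1 z.1 z.2)}.
Proof. by case: sol. Qed.
Let pP1 t s : triangle T (t, s) -> psd (P1 t s).
Proof. by case: sol => _ + _ _ _; apply. Qed.
Let cP2 : {within `[0, T], continuous P2}.
Proof. by case: sol. Qed.

Let tri t s : 0 <= t -> t <= T -> 0 <= s -> s <= T -> triangle T (t, Num.max t s).
Proof.
move=> t0 tT s0 sT; split=> //=; split; first by rewrite le_max lexx.
by rewrite ge_max tT.
Qed.

Lemma ere_row_meas t : 0 <= t -> t <= T -> mxmeas `[0, T] (Q1 t).
Proof.
move=> t0 tT i j; apply: subspace_continuous_measurable_fun => //.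
apply: continuous_within_eps => x e /=; rewrite in_itv/= => /andP[x0 xT] e0.
have [d d0 Hd] := heine_cantor_mx (@triangle_compact R T) cP1 e0.
exists d => // y; rewrite in_itv/= => /andP[y0 yT] xy.
apply: (Hd (t, Num.max t x) (t, Num.max t y)); [exact: tri|exact: tri|].
split=> /=; first exact: ballxx.
by rewrite /ball/= (le_lt_trans (maxr_lip _ _ _)).
Qed.

Lemma ere_diag_meas : mxmeas `[0, T] (fun r => Q1 r r).
Proof.
move=> i j; apply: subspace_continuous_measurable_fun => //.
apply: continuous_within_eps => x e /=; rewrite in_itv/= => /andP[x0 xT] e0.
have [d d0 Hd] := heine_cantor_mx (@triangle_compact R T) cP1 e0.
exists d => // y; rewrite in_itv/= => /andP[y0 yT] xy.
rewrite /upper_ext !maxxx; apply: (Hd (x, x) (y, y)).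
- by rewrite -{2}(maxxx x); exact: tri.
- by rewrite -{2}(maxxx y); exact: tri.
- by split.
Qed.

Lemma ere_P2_meas : mxmeas `[0, T] P2.
Proof.
move=> i j; apply: subspace_continuous_measurable_fun => //.
by apply: (@continuous_within_entry _ _ _ _ _ P2).
Qed.

Lemma ere_bounded : exists2 K, 0 <= K &
  (forall t s i j, triangle T (t, s) -> `|P1 t s i j| <= K) /\
  (forall s i j, 0 <= s -> s <= T -> `|P2 s i j| <= K).
Proof.
have [b1 b10 H1] := compact_bounded_mx (@triangle_compact R T) cP1.
have [b2 b20 H2] := compact_bounded_mx (@segment_compact R 0 T) cP2.
exists (b1 + b2); first exact: addr_ge0.
split=> [t s i j ts|s i j s0 sT].
  by apply: (le_trans (H1 (t, s) i j ts)); rewrite lerDl.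
by apply: (le_trans (H2 s i j _)); rewrite ?lerDr//= in_itv/= s0.
Qed.

Let bQ1 t : 0 <= t -> t <= T -> bdmmx `[0, T] (Q1 t).
Proof.
move=> t0 tT i j; have [K K0 [H1 _]] := ere_bounded.
apply: (@bdmP _ _ _ K); first exact: ere_row_meas.
by move=> r /=; rewrite in_itv/= => /andP[r0 rT]; apply: H1; exact: tri.
Qed.

Let bQ1d : bdmmx `[0, T] (fun r => Q1 r r).
Proof.
move=> i j; have [K K0 [H1 _]] := ere_bounded.
apply: (@bdmP _ _ _ K); first exact: ere_diag_meas.
by move=> r /=; rewrite in_itv/= => /andP[r0 rT]; apply: H1; exact: tri.
Qed.

Let bP2 : bdmmx `[0, T] P2.
Proof.
move=> i j; have [K K0 [_ H2]] := ere_bounded.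
apply: (@bdmP _ _ _ K); first exact: ere_P2_meas.
by move=> r /=; rewrite in_itv/= => /andP[r0 rT]; apply: H2.
Qed.

Lemma ThetaE r : th r =
  - (invmx (cweight E r (P1 r r) (P2 r)) *m ccross E r (P1 r r) (P2 r)).
Proof. by []. Qed.

Definition ere_state (i : I) (t s : R) : R :=
  match i with
  | inl ij => Q1 t s ij.1 ij.2
  | inr ij => P2 s ij.1 ij.2
  end.

Lemma ere_state_meas t : 0 <= t -> t <= T -> pic_meas T ere_state t.
Proof.
move=> t0 tT; split=> -[[i j]|[i j]] /=.
- exact: ere_row_meas.
- exact: ere_P2_meas.
- exact: ere_diag_meas.
- exact: ere_P2_meas.
Qed.

(** Stated for any level K above the solution. It is applied first with a bound coming from
    compactness, to see that Theta is bounded and measurable, and then with [lev], once the a priori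
    bound is available. *)
Lemma ere_state_theta K r : 0 <= r -> r <= T ->
  (forall i j, `|P1 r r i j| <= K) -> (forall i j, `|P2 r i j| <= K) ->
  thetaK E delta K r (fun j => ere_state j r r) = th r.
Proof.
move=> r0 rT b1 b2.
have E1 : M1 K (fun j => ere_state j r r) = P1 r r.
  apply: M1_state => // [|i j]; last by rewrite /= /upper_ext maxxx.
  by apply: psd_sym; apply: pP1; split.
have E2 : M2 K (fun j => ere_state j r r) = P2 r by apply: M2_state.
by rewrite (thetaK_optimal delta_gt0 hb)// E1 ?E2//; apply: pP1; split.
Qed.

Let bth : bdmmx `[0, T] th.
Proof.
move=> i j; have [K K0 [H1 H2]] := ere_bounded.
have [m1 m2] := ere_state_meas (lexx 0) T0.
have nth := nicemx_thetaK tE delta_gt0 K0 i j.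
apply: (eq_bdm _ (nice_bdm nth (g := fun r => pic_arg ere_state 0 r) _)); last first.
  by split; [exists 0 | exact: m1 | exact: m2].
move=> r /=; rewrite in_itv/= => /andP[r0 rT].
rewrite -(ere_state_theta (K := K))// => i' j'; last exact: H2.
by apply: H1; split.
Qed.

Let brhs1 t : 0 <= t -> t <= T -> bdmmx `[0, T] (rhs1 E th Q1 P2 t).
Proof.
exact: (bdmmx_rhs1 (tame_A tE) (tame_B tE) (tame_C tE) (tame_D tE) (tame_Q tE)
  (tame_R tE) (tame_M tE) (tame_N tE) bth bP2 bQ1).
Qed.

Let brhs2 : bdmmx `[0, T] (rhs2 E th P2).
Proof.
exact: (bdmmx_rhs2 (tame_A tE) (tame_B tE) (tame_C tE) (tame_D tE) (tame_Ah tE)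
  (tame_Bh tE) (tame_Ch tE) (tame_Dh tE) bth bP2).
Qed.

Lemma Q1E t s : t <= s -> Q1 t s = P1 t s.
Proof. by move=> ts; rewrite /Q1 max_r. Qed.

Lemma ere_eq1 t s : 0 <= t -> t <= s -> s <= T ->
  Q1 t s = cG1 E t + mx_integral s T (rhs1 E th Q1 P2 t).
Proof.
move=> t0 ts sT; have tsT : triangle T (t, s) by [].
have E1 r : t <= r -> ere_rhs1 E P1 P2 t r = rhs1 E th Q1 P2 t r.
  by move=> tr; rewrite ere_rhs1E /rhs1 Q1E.
case: sol => _ _ _ /(_ t s tsT)[_ eq1] _.
rewrite Q1E; last exact: ts.
rewrite [LHS]eq1; apply: congrD; first by [].
  apply: eq_mx_integral => r sr rT.
by apply: E1; exact: le_trans sr.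
Qed.

Lemma ere_eq2 s : 0 <= s -> s <= T -> P2 s = cH E + mx_integral s T (rhs2 E th P2).
Proof.
by move=> s0 sT; case: sol => _ _ _ _ /(_ s)[]; rewrite ?s0.
Qed.

Lemma ere_region : region_solution T E 0 th Q1 P2.
Proof.
split=> //.
- move=> t s t0 ts s0 sT; rewrite Q1E//; apply: psd_sym; exact: pP1.
- move=> t s s' t0 ts s0 ss sT; have ts' := le_trans ts ss.
  rewrite !ere_eq1 ?(le_trans ss)// (@mx_integral_chasles _ s s' T)//.
    by rewrite addrAC -addrA.
  by apply: bdmmx_itvS (brhs1 t0 (le_trans ts' sT)).
- by move=> t t0 tT; rewrite ere_eq1// mx_integral_pt addr0.
- move=> s s' s0 ss sT; have s0' := le_trans s0 ss.
  rewrite (ere_eq2 s0 (le_trans ss sT)) (ere_eq2 s0' sT) (@mx_integral_chasles _ s s' T)//.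
    by rewrite addrAC -addrA.
  by apply: bdmmx_itvS brhs2.
- by rewrite (ere_eq2 T0 (lexx T)) mx_integral_pt addr0.
- move=> e e0; have [d d0 Hd] := heine_cantor_mx (@triangle_compact R T) cP1 e0.
  exists d => // t t' s i j t0 tt ts s0 sT td; have t0' := le_trans t0 tt.
  rewrite !Q1E//; last exact: le_trans ts.
  rewrite ltW//; apply: (Hd (t, s) (t', s)); [split=> //; split=> //|split=> //; split=> //|].
    exact: le_trans ts.
  split=> /=; last exact: ballxx.
  by rewrite /ball/= distrC ger0_norm// subr_ge0.
Qed.

Lemma ere_optimal : optimal T E 0 th Q1 P2.
Proof.
move=> r r0 rT; rewrite Q1E// ThetaE (invmx_optimal delta_gt0 hb)//.
by apply: pP1; split.
Qed.

Lemma ere_state_bound i t s : 0 <= t -> t <= s -> s <= T -> `|ere_state i t s| <= bound.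
Proof.
move=> t0 ts sT; have s0 := le_trans t0 ts.
have [h1 h2] := region_entries T0 tE delta_gt0 hb hc n_gt0 (lexx 0) ere_region
  ere_optimal t0 ts s0 sT.
by case: i => -[i j]; [exact: h1 | exact: h2].
Qed.

(** By the a priori bound neither the clamping nor the regularization changes anything along the
    solution. *)
Lemma ere_state_pic i t s : 0 <= t -> t <= s -> s <= T ->
  ere_state i t s = pic T F g ere_state i t s.
Proof.
move=> t0 ts sT; have s0 := le_trans t0 ts.
have bl : bound <= lev.
  have [_ _] := level_parts tE delta Qh Mh Nh G1h G2h n_gt0.
  by apply: le_trans; rewrite lerDr.
have ub j t' r : 0 <= t' -> t' <= r -> r <= T -> `|ere_state j t' r| <= lev.
  by move=> ? ? ?; apply: le_trans bl; exact: ere_state_bound.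
have eM1 r t' : 0 <= t' -> t' <= r -> r <= T ->
    M1 lev (fun j => ere_state j t' r) = Q1 t' r.
  move=> t0' tr rT; apply: M1_state => // [|i' j'].
    exact: (rs_sym ere_region t0' tr (le_trans t0' tr) rT).
  exact: (ub (inl (i', j')) t' r).
have eM2 r : 0 <= r -> r <= T -> M2 lev (fun j => ere_state j r r) = P2 r.
  move=> r0 rT; apply: M2_state => // i' j'.
  exact: (ub (inr (i', j')) r r).
have eth r : 0 <= r -> r <= T -> thetaK E delta lev r (fun j => ere_state j r r) = th r.
  move=> r0 rT; apply: ere_state_theta => // i' j'.
    by rewrite -Q1E//; exact: (ub (inl (i', j')) r r).
  exact: (ub (inr (i', j')) r r).
case: i => -[i j]; rewrite /ere_state /pic /=.
- rewrite ere_eq1// mxE [X in _ + X]mxE; apply: congrD; first by [].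
  apply: eq_int => r sr rT.
  have r0 := le_trans s0 sr; have tr := le_trans ts sr.
  by rewrite /rhs1 /Cth /Ath eth// (eM1 r t)// (eM2 r).
- rewrite ere_eq2// mxE [X in _ + X]mxE; apply: congrD; first by [].
  apply: eq_int => r sr rT.
  have r0 := le_trans s0 sr.
  by rewrite /rhs2 /Cth /Ath eth// (eM2 r).
Qed.

End EreSolution.

Lemma ere_unique P1 P2 P1' P2' :
  ere_solution T E P1 P2 -> ere_solution T E P1' P2' ->
  (forall t s : R, triangle T (t, s) -> P1' t s = P1 t s) /\
  (forall s : R, 0 <= s <= T -> P2' s = P2 s).
Proof.
move=> sol sol'.
have [L L1 [gL gL' FL FL']] := clamped_constant tE Qh Mh Nh G1h G2h delta_gt0 n_gt0.
have L0 : 0 <= L by exact: le_trans L1.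
have nF := nice_FK tE delta_gt0 (level_ge0 tE delta Qh Mh Nh G1h G2h n_gt0).
have main i t s : 0 <= t -> t <= s -> s <= T ->
    ere_state P1' P2' i t s = ere_state P1 P2 i t s.
  apply: (picard_uniqueness (g := g) (B := bound) (@data_closexx R n m k E) nF L0 FL').
  - by move=> t' *; exact: ere_state_meas.
  - by move=> t' *; exact: ere_state_meas.
  - by move=> i' t' s' *; split; exact: ere_state_bound.
  - by move=> i' t' s' *; exact: ere_state_pic.
  - by move=> i' t' s' *; exact: ere_state_pic.
split=> [t s [/= t0 [ts sT]]|s /andP[s0 sT]]; apply/matrixP => i j.
  by have := main (inl (i, j)) t s t0 ts sT; rewrite /= !Q1E.
exact: (main (inr (i, j)) s s s0 (lexx s) sT).
Qed.

Lemma ere_value_bound P1 P2 : ere_solution T E P1 P2 -> forall s, 0 <= s -> s <= T ->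
  specnorm (P1 s s + (P2 s)^T *m cG2 E s *m P2 s) <= CstarV T E delta Qh Mh Nh G1h G2h.
Proof.
move=> sol s s0 sT.
have := region_value T0 tE delta_gt0 hb hc n_gt0 (lexx 0) (ere_region sol)
  (ere_optimal sol) s0 sT.
by rewrite /valuemx Q1E.
Qed.

Lemma ere_exists : exists P1 P2, ere_solution T E P1 P2.
Proof.
have [L L1 [gL gL' FL FL']] := clamped_constant tE Qh Mh Nh G1h G2h delta_gt0 n_gt0.
have L0 : 0 <= L by exact: le_trans L1.
have nF := nice_FK tE delta_gt0 (level_ge0 tE delta Qh Mh Nh G1h G2h n_gt0).
have [U [cU eU]] := @picard_existence R T T0 I (data_close E) F g
  (@data_closexx R n m k E) (tame_cl tE) nF L L0 gL gL' FL FL'.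
have ub := st_global T0 tE delta_gt0 hb hc n_gt0 L1 gL FL cU eU.
have ub0 i t u : 0 <= t -> t <= u -> 0 <= u -> u <= T -> `|U i t u| <= lev.
  by move=> ? ? _; exact: ub.
have reg := st_region T0 tE delta_gt0 n_gt0 L1 gL FL cU eU (lexx 0) ub0.
have thE r : 0 <= r -> r <= T ->
    stth T E KE delta Qh Mh Nh G1h G2h U r = Theta E (stP1 U) (stP2 U) r.
  by move=> r0 rT; rewrite (st_th_inv T0 tE delta_gt0 hb n_gt0 L1 gL FL cU eU (lexx 0) ub0).
have r1E t r : 0 <= r -> r <= T -> rhs1 E (stth T E KE delta Qh Mh Nh G1h G2h U) (stP1 U) (stP2 U) t r =
    ere_rhs1 E (stP1 U) (stP2 U) t r.
  by move=> r0 rT; rewrite ere_rhs1E /rhs1 /Cth /Ath thE.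
have r2E r : 0 <= r -> r <= T -> rhs2 E (stth T E KE delta Qh Mh Nh G1h G2h U) (stP2 U) r =
    ere_rhs2 E (stP1 U) (stP2 U) r.
  by move=> r0 rT; rewrite ere_rhs2E /rhs2 /Cth /Ath thE.
exists (stP1 U), (stP2 U); split.
- apply: continuous_within_mx => e e0; have [d d0 Hd] := cU e e0; exists d => //.
  move=> [t s] [t' s'] i j [/= t0 [ts sT]] [/= t0' [ts' sT']] [/= tt ss]; rewrite !mxE.
  by apply: Hd => //; [exact: le_trans ts | exact: le_trans ts'].
- move=> t s [/= t0 [ts sT]].
  by apply: (region_psd tE delta_gt0 hb reg) => //; exact: le_trans ts.
- apply: continuous_within_mx => e e0; have [d d0 Hd] := cU e e0; exists d => //.
  move=> s s' i j /=; rewrite !in_itv/= => /andP[s0 sT] /andP[s0' sT'] ss; rewrite !mxE.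
  exact: Hd.
- move=> t s [/= t0 [ts sT]]; have s0 := le_trans t0 ts; have tT := le_trans ts sT.
  have b1 := region_rhs1 tE reg t0 tT; split.
    apply: bdmmx_mx_integrable => i j.
    apply: (eq_bdm _ (bdm_itvS s0 (lexx T) (b1 i j))) => r /=; rewrite in_itv/= => /andP[sr rT].
    by rewrite r1E// (le_trans s0).
  rewrite -(rs_eq1T reg t0 tT) {1}(rs_eq1 reg t0 ts s0 sT (lexx T)); apply: congrD; first by [].
  by apply: eq_mx_integral => r sr rT; rewrite r1E// (le_trans s0).
- move=> s /andP[s0 sT].
  have b2 := region_rhs2 tE reg; split.
    apply: bdmmx_mx_integrable => i j.
    apply: (eq_bdm _ (bdm_itvS s0 (lexx T) (b2 i j))) => r /=; rewrite in_itv/= => /andP[sr rT].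
    by rewrite r2E// (le_trans s0).
  rewrite -(rs_eq2T reg) {1}(rs_eq2 reg s0 sT (lexx T)); apply: congrD; first by [].
  by apply: eq_mx_integral => r sr rT; rewrite r2E// (le_trans s0).
Qed.

End TameTheorem.

(** * Reduction to bounded data *)

Section Reduction.
Context (R : realType) (T : R) (T0 : 0 <= T).
Local Notation mu := (@lebesgue_measure R).

Lemma ae_mono (P Q : R -> Prop) : (forall s, P s -> Q s) ->
  {ae mu, forall s, P s} -> {ae mu, forall s, Q s}.
Proof.
move=> PQ; rewrite /prop_near1 /nbhs /=.
by apply: (@filterS _ _ (ae_filter_ringOfSetsType mu)); exact: PQ.
Qed.

Lemma ae_and (P Q : R -> Prop) : {ae mu, forall s, P s} -> {ae mu, forall s, Q s} ->
  {ae mu, forall s, P s /\ Q s}.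
Proof. by move=> hP hQ; exact: (@filterI _ _ (ae_filter_ringOfSetsType mu) _ _ hP hQ). Qed.

Lemma ae_integrable (a b : R) (f h : R -> R) :
  measurable_fun `[a, b] f -> measurable_fun `[a, b] h ->
  {ae mu, forall s, s \in `[a, b] -> f s = h s} ->
  mu.-integrable `[a, b] (EFin \o f) ->
  mu.-integrable `[a, b] (EFin \o h) /\
  \int[mu]_(s in `[a, b]) f s = \int[mu]_(s in `[a, b]) h s.
Proof.
move=> mf mh fh /integrableP[_ fin]; split.
  apply/integrableP; split; first exact/measurable_EFinP.
  rewrite (@ae_eq_integral _ _ _ mu `[a, b] (fun s => `|(EFin \o f) s|)%E) //.
  - by apply: measurableT_comp => //; exact/measurable_EFinP.
  - by apply: measurableT_comp => //; exact/measurable_EFinP.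
  - by apply: ae_mono fh => s fhs sab; rewrite /= fhs.
rewrite /Rintegral; congr fine; apply: ae_eq_integral => //.
- exact/measurable_EFinP.
- exact/measurable_EFinP.
- by apply: ae_mono fh => s fhs sab; rewrite /= fhs.
Qed.

Lemma Linfty_clamp p q (F : R -> 'M[R]_(p, q)) : Linfty T F ->
  exists F', [/\ bdmmx `[0, T] F', mxmeas `[0, T] F &
    {ae mu, forall s, s \in `[0, T] -> F' s = F s}].
Proof.
move=> [mF [K HK]].
(* The maximum with 0 is there because [clamp_bound] asks for a nonnegative level. *)
exists (fun s => map_mx (clamp (Num.max K 0)) (F s)); split.
- move=> i j; apply: (@bdmP _ _ _ (Num.max K 0)).
    apply: (@eq_measurable_fun _ _ _ _ _ (fun s => clamp (Num.max K 0) (F s i j))).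
      by move=> s _; rewrite mxE.
    exact: measurable_clamp.
  by move=> r _; rewrite mxE; apply: clamp_bound; rewrite le_max lexx orbT.
- exact: mF.
- apply: ae_mono HK => s Hs sT; apply/matrixP => i j; rewrite mxE clamp_id//.
  by rewrite le_max Hs.
Qed.

(** The projection onto [0, T]. Composed with it, data continuous on a compact set become bounded
    and uniformly continuous for all real times, and are unchanged on [0, T]. *)
Definition tclamp (t : R) : R := Num.min (Num.max t 0) T.

Lemma tclamp_id t : 0 <= t -> t <= T -> tclamp t = t.
Proof. by move=> t0 tT; rewrite /tclamp max_l// min_l. Qed.

Lemma tclamp_ge0 t : 0 <= tclamp t.
Proof. by rewrite /tclamp le_min le_max lexx orbT. Qed.

Lemma tclamp_le t : tclamp t <= T.
Proof. by rewrite /tclamp ge_min lexx orbT. Qed.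

Lemma tclamp_lip x y : `|tclamp x - tclamp y| <= `|x - y|.
Proof.
apply: (@le_trans _ _ `|Num.max x 0 - Num.max y 0|); last first.
  by rewrite !(maxC _ 0) maxr_lip.
rewrite /tclamp; move: (Num.max x 0) (Num.max y 0) => u w.
case: (leP u T) => h; case: (leP w T) => h'.
- by [].
- by rewrite ler0_norm ?ler0_norm; lra.
- by rewrite ger0_norm ?ger0_norm; lra.
- by rewrite subrr normr0.
Qed.

Lemma continuous_sym2_tame p (Q : R -> R -> 'M[R]_p) : continuous_sym2 T Q ->
  exists2 K, 0 <= K &
  [/\ forall t s i j, `|Q (tclamp t) (tclamp s) i j| <= K,
      forall t, mxmeas `[0, T] (fun s => Q (tclamp t) (tclamp s)),
      mxmeas `[0, T] (fun s => Q (tclamp s) (tclamp s)),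
      forall t s, (Q (tclamp t) (tclamp s))^T = Q (tclamp t) (tclamp s) &
      forall e, 0 < e -> exists2 d, 0 < d & forall t t', `|t - t'| < d ->
        forall s i j, `|Q (tclamp t) (tclamp s) i j - Q (tclamp t') (tclamp s) i j| <= e].
Proof.
move=> [cQ sQ].
have sq t s : square T (tclamp t, tclamp s).
  by split; rewrite /= tclamp_ge0 tclamp_le.
have hc := heine_cantor_mx (@square_compact R T) cQ.
have [K K0 HK] := compact_bounded_mx (@square_compact R T) cQ.
exists K => //; split.
- by move=> t s i j; exact: (HK (tclamp t, tclamp s)).
- move=> t i j; apply: subspace_continuous_measurable_fun => //.
  apply: continuous_within_eps => x e _ e0; have [d d0 Hd] := hc e e0.
  exists d => // y _ xy; apply: (Hd (tclamp t, tclamp x) (tclamp t, tclamp y)); [exact: sq|exact: sq|].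
  split=> /=; first exact: ballxx.
  by rewrite /ball/= (le_lt_trans (tclamp_lip _ _)).
- move=> i j; apply: subspace_continuous_measurable_fun => //.
  apply: continuous_within_eps => x e _ e0; have [d d0 Hd] := hc e e0.
  exists d => // y _ xy; apply: (Hd (tclamp x, tclamp x) (tclamp y, tclamp y)); [exact: sq|exact: sq|].
  by split=> /=; rewrite /ball/= (le_lt_trans (tclamp_lip _ _)).
- by move=> t s; exact: sQ.
- move=> e e0; have [d d0 Hd] := hc e e0; exists d => // t t' tt s i j.
  apply/ltW/(Hd (tclamp t, tclamp s) (tclamp t', tclamp s)); [exact: sq|exact: sq|].
  split=> /=; last exact: ballxx.
  by rewrite /ball/= (le_lt_trans (tclamp_lip _ _)).
Qed.

Lemma continuous_sym1_tame p (G : R -> 'M[R]_p) : continuous_sym1 T G ->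
  exists2 K, 0 <= K &
  [/\ forall t i j, `|G (tclamp t) i j| <= K,
      mxmeas `[0, T] (fun s => G (tclamp s)),
      forall t, (G (tclamp t))^T = G (tclamp t) &
      forall e, 0 < e -> exists2 d, 0 < d & forall t t', `|t - t'| < d ->
        forall i j, `|G (tclamp t) i j - G (tclamp t') i j| <= e].
Proof.
move=> [cG sG].
have sq t : `[0, T]%classic (tclamp t) by rewrite /= in_itv/= tclamp_ge0 tclamp_le.
have hc := heine_cantor_mx (@segment_compact R 0 T) cG.
have [K K0 HK] := compact_bounded_mx (@segment_compact R 0 T) cG.
exists K => //; split.
- by move=> t i j; exact: HK.
- move=> i j; apply: subspace_continuous_measurable_fun => //.
  apply: continuous_within_eps => x e _ e0; have [d d0 Hd] := hc e e0.
  exists d => // y _ xy; apply: Hd => //.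
  by rewrite /ball/= (le_lt_trans (tclamp_lip _ _)).
- by move=> t; apply: sG; rewrite tclamp_ge0 tclamp_le.
- move=> e e0; have [d d0 Hd] := hc e e0; exists d => // t t' tt i j.
  apply/ltW/Hd => //.
  by rewrite /ball/= (le_lt_trans (tclamp_lip _ _)).
Qed.

Context (n m k : nat).

(** The given coefficients are bounded only almost everywhere, so [bdmmx] fails for them.
    Measurability still allows integrals of almost everywhere equal functions to be compared. *)
Record meas_data (E : ere_data R n m k) : Prop := MeasData {
  md_A : mxmeas `[0, T] (cA E);
  md_B : mxmeas `[0, T] (cB E);
  md_C : mxmeas `[0, T] (cC E);
  md_D : mxmeas `[0, T] (cD E);
  md_Ah : mxmeas `[0, T] (cAh E);
  md_Bh : mxmeas `[0, T] (cBh E);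
  md_Ch : mxmeas `[0, T] (cCh E);
  md_Dh : mxmeas `[0, T] (cDh E);
  md_Q : forall t, 0 <= t <= T -> mxmeas `[0, T] (cQ E t);
  md_R : forall t, 0 <= t <= T -> mxmeas `[0, T] (cR E t);
  md_M : forall t, 0 <= t <= T -> mxmeas `[0, T] (cM E t);
  md_N : forall t, 0 <= t <= T -> mxmeas `[0, T] (cN E t);
  md_Rd : mxmeas `[0, T] (fun s => cR E s s);
  md_Nd : mxmeas `[0, T] (fun s => cN E s s);
  md_G2 : mxmeas `[0, T] (cG2 E)
}.

Record same_at (E E' : ere_data R n m k) (s : R) : Prop := SameAt {
  sa_A : cA E s = cA E' s;
  sa_B : cB E s = cB E' s;
  sa_C : cC E s = cC E' s;
  sa_D : cD E s = cD E' s;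
  sa_Ah : cAh E s = cAh E' s;
  sa_Bh : cBh E s = cBh E' s;
  sa_Ch : cCh E s = cCh E' s;
  sa_Dh : cDh E s = cDh E' s;
  sa_Q : forall t, 0 <= t <= T -> cQ E t s = cQ E' t s;
  sa_R : forall t, 0 <= t <= T -> cR E t s = cR E' t s;
  sa_M : forall t, 0 <= t <= T -> cM E t s = cM E' t s;
  sa_N : forall t, 0 <= t <= T -> cN E t s = cN E' t s;
  sa_G2 : cG2 E s = cG2 E' s
}.

Lemma same_at_sym E E' s : same_at E E' s -> same_at E' E s.
Proof.
by move=> [] *; split=> // t tT; apply/esym; auto.
Qed.

Section SameRhs.
Context (E E' : ere_data R n m k).

Lemma same_Theta (P1 : R -> R -> 'M[R]_n) (P2 : R -> 'M[R]_(m, n)) s :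
  0 <= s <= T -> same_at E E' s -> Theta E P1 P2 s = Theta E' P1 P2 s.
Proof.
move=> sT [eA eB eC eD eAh eBh eCh eDh eQ eR eM eN eG2].
by rewrite /Theta eB eC eD eBh eDh eR// eN// eG2.
Qed.

Lemma same_rhs1 (P1 : R -> R -> 'M[R]_n) (P2 : R -> 'M[R]_(m, n)) t s :
  0 <= t <= T -> 0 <= s <= T -> same_at E E' s ->
  ere_rhs1 E P1 P2 t s = ere_rhs1 E' P1 P2 t s.
Proof.
move=> tT sT same; rewrite /ere_rhs1 (same_Theta _ _ sT same).
move: same => [eA eB eC eD eAh eBh eCh eDh eQ eR eM eN eG2].
by rewrite eA eB eC eD eQ// eR// eM// eN.
Qed.

Lemma same_rhs2 (P1 : R -> R -> 'M[R]_n) (P2 : R -> 'M[R]_(m, n)) s :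
  0 <= s <= T -> same_at E E' s -> ere_rhs2 E P1 P2 s = ere_rhs2 E' P1 P2 s.
Proof.
move=> sT same; rewrite /ere_rhs2 (same_Theta _ _ sT same).
move: same => [eA eB eC eD eAh eBh eCh eDh eQ eR eM eN eG2].
by rewrite eA eB eC eD eAh eBh eCh eDh.
Qed.

End SameRhs.

Lemma mxmeas_itvS p q (F : R -> 'M[R]_(p, q)) (a b : R) : 0 <= a -> b <= T ->
  mxmeas `[0, T] F -> mxmeas `[a, b] F.
Proof.
move=> a0 bT mF i j; apply: measurable_funS (mF i j) => //.
by apply: subset_itv; rewrite bnd_simp.
Qed.

Lemma mxmeas_Theta (D : set R) (mD : measurable D) (E : ere_data R n m k)
  (P1 : R -> R -> 'M[R]_n) (P2 : R -> 'M[R]_(m, n)) :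
  (forall p q (F : R -> 'M[R]_(p, q)), mxmeas `[0, T] F -> mxmeas D F) ->
  meas_data E -> mxmeas D (fun r => P1 r r) -> mxmeas D P2 -> mxmeas D (Theta E P1 P2).
Proof.
move=> sub [mA mB mC mD_ mAh mBh mCh mDh _ _ _ _ mR mN mG2] mP1 mP2.
have {}mB := sub _ _ _ mB; have {}mC := sub _ _ _ mC; have {}mD_ := sub _ _ _ mD_.
have {}mBh := sub _ _ _ mBh; have {}mDh := sub _ _ _ mDh.
have {}mR := sub _ _ _ mR; have {}mN := sub _ _ _ mN; have {}mG2 := sub _ _ _ mG2.
have mP : mxmeas D (fun s => P1 s s + (P2 s)^T *m cN E s s *m P2 s).
  by apply: mxmeasD => //; apply: mxmeasM => //; apply: mxmeasM => //; exact: mxmeas_tr.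
rewrite /Theta; apply: mxmeasN; apply: mxmeasM.
  apply: mxmeas_inv => //; apply: mxmeasD => //; apply: mxmeasM => //; apply: mxmeasM => //.
  exact: mxmeas_tr.
apply: mxmeasD; first apply: mxmeasD.
- by apply: mxmeasM => //; exact: mxmeas_tr.
- by apply: mxmeasM => //; apply: mxmeasM => //; exact: mxmeas_tr.
- apply: mxmeasM => //; apply: mxmeasM => //; apply: mxmeasD; first apply: mxmeasD.
  + exact: mxmeas_tr.
  + by apply: mxmeasM; exact: mxmeas_tr.
  + by apply: mxmeasM; [apply: mxmeasM|]; exact: mxmeas_tr.
Qed.

Lemma mxmeas_rhs1 (D : set R) (mD : measurable D) (E : ere_data R n m k)
  (P1 : R -> R -> 'M[R]_n) (P2 : R -> 'M[R]_(m, n)) t :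
  (forall p q (F : R -> 'M[R]_(p, q)), mxmeas `[0, T] F -> mxmeas D F) ->
  meas_data E -> 0 <= t <= T -> mxmeas D (P1 t) -> mxmeas D (fun r => P1 r r) ->
  mxmeas D P2 -> mxmeas D (ere_rhs1 E P1 P2 t).
Proof.
move=> sub mE tT mP mP1 mP2; have mth := mxmeas_Theta mD sub mE mP1 mP2.
move: mE => [mA mB mC mD_ _ _ _ _ /(_ t tT) mQ /(_ t tT) mR /(_ t tT) mM /(_ t tT) mN _ _ _].
have mA' : mxmeas D (fun s => cA E s + cB E s *m Theta E P1 P2 s).
  by apply: mxmeasD; [exact: sub | apply: mxmeasM => //; exact: sub].
have mC' : mxmeas D (fun s => cC E s + cD E s *m Theta E P1 P2 s).
  by apply: mxmeasD; [exact: sub | apply: mxmeasM => //; exact: sub].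
rewrite /ere_rhs1.
apply: mxmeasD; [apply: mxmeasD; [apply: mxmeasD; [apply: mxmeasD; [apply: mxmeasD; [apply: mxmeasD|]|]|]|]|].
- exact: mxmeasM.
- by apply: mxmeasM => //; exact: mxmeas_tr.
- by apply: mxmeasM => //; apply: mxmeasM => //; exact: mxmeas_tr.
- exact: sub.
- by apply: mxmeasM => //; apply: mxmeasM; [exact: mxmeas_tr | exact: sub].
- by apply: mxmeasM => //; apply: mxmeasM; [exact: mxmeas_tr | exact: sub].
- apply: mxmeasM => //; apply: mxmeasM => //; apply: mxmeasM; last exact: sub.
  by apply: mxmeasM; exact: mxmeas_tr.
Qed.

Lemma mxmeas_rhs2 (D : set R) (mD : measurable D) (E : ere_data R n m k)
  (P1 : R -> R -> 'M[R]_n) (P2 : R -> 'M[R]_(m, n)) :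
  (forall p q (F : R -> 'M[R]_(p, q)), mxmeas `[0, T] F -> mxmeas D F) ->
  meas_data E -> mxmeas D (fun r => P1 r r) -> mxmeas D P2 -> mxmeas D (ere_rhs2 E P1 P2).
Proof.
move=> sub mE mP1 mP2; have mth := mxmeas_Theta mD sub mE mP1 mP2.
move: mE => [mA mB mC mD_ mAh mBh mCh mDh _ _ _ _ _ _ _].
rewrite /ere_rhs2.
have mC' : mxmeas D (fun s => cC E s + cD E s *m Theta E P1 P2 s).
  by apply: mxmeasD; [exact: sub | apply: mxmeasM => //; exact: sub].
apply: mxmeasD; [apply: mxmeasD; [apply: mxmeasD|]|].
- apply: mxmeasM => //; apply: mxmeasD; [exact: sub | apply: mxmeasM => //; exact: sub].
- by apply: mxmeasD; [exact: sub | apply: mxmeasM => //; exact: sub].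
- by apply: mxmeasM => //; exact: sub.
- by apply: mxmeasM => //; apply: mxmeasM => //; exact: sub.
Qed.


Section Transfer.
Context (E E' : ere_data R n m k).
Hypotheses (mE : meas_data E) (mE' : meas_data E').
Hypothesis EE' : {ae mu, forall s, s \in `[0, T] -> same_at E E' s}.
Hypotheses (EH : cH E = cH E') (EG1 : forall t, 0 <= t <= T -> cG1 E t = cG1 E' t).

Lemma mx_ae_integrable p q (a b : R) (F H : R -> 'M[R]_(p, q)) :
  mxmeas `[a, b] F -> mxmeas `[a, b] H ->
  {ae mu, forall s, s \in `[a, b] -> F s = H s} ->
  mx_integrable a b F -> mx_integrable a b H /\ mx_integral a b F = mx_integral a b H.
Proof.
move=> mF mH FH iF.
have main i j : mu.-integrable `[a, b] (EFin \o (fun s => H s i j)) /\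
    \int[mu]_(s in `[a, b]) F s i j = \int[mu]_(s in `[a, b]) H s i j.
  apply: ae_integrable; [exact: mF | exact: mH | | exact: iF].
  by apply: ae_mono FH => s FHs sab; rewrite FHs.
split; first by move=> i j; have [] := main i j.
by apply/matrixP => i j; rewrite !mxE; have [] := main i j.
Qed.

(** Theta(s) involves the data at time s only. For fixed t the right-hand sides of the two equations
    therefore agree for almost every s, and have the same integrals. *)
Lemma ere_transfer (P1 : R -> R -> 'M[R]_n) (P2 : R -> 'M[R]_(m, n)) :
  ere_solution T E P1 P2 -> ere_solution T E' P1 P2.
Proof.
move=> sol; have mQ1 := ere_row_meas sol; have mQ1d := ere_diag_meas sol.
have mP2 := ere_P2_meas sol.
case: sol => cP1 pP1 cP2 eq1 eq2.
have sub s : 0 <= s -> forall p q (F : R -> 'M[R]_(p, q)),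
    mxmeas `[0, T] F -> mxmeas `[s, T] F.
  by move=> s0 p q F; exact: mxmeas_itvS.
have mP1d : mxmeas `[0, T] (fun r => P1 r r).
  move=> i j; apply: eq_measurable_fun (mQ1d i j) => r _.
  by rewrite /upper_ext maxxx.
have mP1 t s : 0 <= t -> t <= s -> s <= T -> mxmeas `[s, T] (P1 t).
  move=> t0 ts sT i j; have s0 := le_trans t0 ts.
  have := sub s s0 _ _ _ (mQ1 t t0 (le_trans ts sT)) i j.
  apply: eq_measurable_fun => r /set_mem/=; rewrite in_itv/= => /andP[sr _].
  by rewrite /upper_ext max_r// (le_trans ts).
have inT s r : 0 <= s -> r \in `[s, T] -> 0 <= r <= T.
  by move=> s0; rewrite in_itv/= => /andP[sr ->]; rewrite (le_trans s0).
split; [exact: cP1 | exact: pP1 | exact: cP2 | |].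
- move=> t s tst; have [/= t0 [ts sT]] := tst; have s0 := le_trans t0 ts.
  have tT : 0 <= t <= T by rewrite t0 (le_trans ts).
  have [i1 e1] := eq1 t s tst.
  have [] := @mx_ae_integrable n n s T (ere_rhs1 E P1 P2 t) (ere_rhs1 E' P1 P2 t) _ _ _ i1.
  + by apply: mxmeas_rhs1 => //; [exact: sub|exact: mP1|exact: sub|exact: sub].
  + by apply: mxmeas_rhs1 => //; [exact: sub|exact: mP1|exact: sub|exact: sub].
  + apply: ae_mono EE' => r same rs; have rT := inT s r s0 rs.
    by apply: (same_rhs1 _ _ tT rT); apply: same; rewrite in_itv.
  + by move=> i2 <-; rewrite -(EG1 tT); split; [exact: i2 | exact: e1].
- move=> s sT'; have /andP[s0 sT] := sT'; have [i1 e1] := eq2 s sT'.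
  have [] := @mx_ae_integrable m n s T (ere_rhs2 E P1 P2) (ere_rhs2 E' P1 P2) _ _ _ i1.
  + by apply: mxmeas_rhs2 => //; [exact: sub|exact: sub|exact: sub].
  + by apply: mxmeas_rhs2 => //; [exact: sub|exact: sub|exact: sub].
  + apply: ae_mono EE' => r same rs; have rT := inT s r s0 rs.
    by apply: (same_rhs2 _ _ rT); apply: same; rewrite in_itv.
  + by move=> i2 <-; rewrite -EH; split; [exact: i2 | exact: e1].
Qed.

End Transfer.

End Reduction.

(** Coefficients enter the constant only under integrals, so the bound obtained for the truncated
    data is the one claimed for the given data. *)
Lemma CstarV_ae (R : realType) (T : R) (n m k : nat) (E E' : ere_data R n m k) (delta : R)
  (Qh : 'M[R]_n) (Mh Nh : 'M[R]_m) (G1h : 'M[R]_n) (G2h : 'M[R]_m) :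
  bdmmx `[0, T] (cA E') -> bdmmx `[0, T] (cC E') -> bdmmx `[0, T] (cAh E') ->
  bdmmx `[0, T] (cCh E') -> bdmmx `[0, T] (cDh E') -> meas_data T E ->
  {ae (@lebesgue_measure R), forall s, s \in `[0, T] -> same_at T E' E s} ->
  cH E' = cH E ->
  CstarV T E' delta Qh Mh Nh G1h G2h = CstarV T E delta Qh Mh Nh G1h G2h.
Proof.
move=> bA bC bAh bCh bDh mE ae EH; rewrite /CstarV EH.
set G := Num.max _ _.
have ms p q (F : R -> 'M[R]_(p, q)) : mxmeas `[0, T] F ->
    measurable_fun `[0, T] (fun s => specnorm (F s)) by exact: measurable_specnorm.
have mA := ms _ _ _ (md_A mE); have mC := ms _ _ _ (md_C mE).
have mAh := ms _ _ _ (md_Ah mE); have mCh := ms _ _ _ (md_Ch mE).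
have mDh := ms _ _ _ (md_Dh mE).
have mc (c : R) : measurable_fun `[0, T] (fun=> c) by exact: measurable_cst.
have mX (h : R -> R) : measurable_fun `[0, T] h -> measurable_fun `[0, T] (fun s => h s ^+ 2).
  exact: measurable_funX.
have mD (h h' : R -> R) : measurable_fun `[0, T] h -> measurable_fun `[0, T] h' ->
  measurable_fun `[0, T] (fun s => h s + h' s) by exact: measurable_funD.
have mM (h h' : R -> R) : measurable_fun `[0, T] h -> measurable_fun `[0, T] h' ->
  measurable_fun `[0, T] (fun s => h s * h' s) by exact: measurable_funM.
have bf := bdm_forcing bAh Qh G1h G2h.
have br := bdm_rate bA bC bCh bDh delta Mh Nh G1h G2h.
have [_ I1] := @ae_integrable R 0 T _ (fun s => specnorm Qh + G ^+ 2 * specnorm (cAh E s) ^+ 2)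
  (bdm_measurable bf) (mD _ _ (mc _) (mM _ _ (mc _) (mX _ mAh)))
  (ae_mono (fun s (h : s \in `[0, T] -> same_at T E' E s) sT =>
    congr1 (fun X => specnorm Qh + G ^+ 2 * specnorm X ^+ 2) (sa_Ah (h sT))) ae)
  (bdm_integrable bf).
have mr : measurable_fun `[0, T] (fun s => 2 * specnorm (cA E s) + specnorm (cC E s) ^+ 2
       + n%:R / delta *
         (1 + specnorm Mh + specnorm Nh * specnorm (cC E s) ^+ 2
          + 2 * G * specnorm (cCh E s)
          + 2 * G * specnorm (cC E s) * specnorm (cDh E s))).
  apply: (mD _ _); first by apply: (mD _ _); [apply: (mM _ _) | apply: (mX _)].
  apply: (mM _ _); first exact: mc.
  apply: (mD _ _); last by apply: (mM _ _); [apply: (mM _ _) |].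
  apply: (mD _ _); last by apply: (mM _ _).
  by apply: (mD _ _); [exact: mc | apply: (mM _ _); [exact: mc | apply: (mX _)]].
have [_ I2] := @ae_integrable R 0 T _ _ (bdm_measurable br) mr
  (ae_mono (fun s (h : s \in `[0, T] -> same_at T E' E s) sT => 
    let: SameAt eA _ eC _ _ _ eCh eDh _ _ _ _ _ := h sT in
    f_equal4 (fun XA XC XCh XDh => 2 * specnorm XA + specnorm XC ^+ 2
       + n%:R / delta *
         (1 + specnorm Mh + specnorm Nh * specnorm XC ^+ 2
          + 2 * G * specnorm XCh + 2 * G * specnorm XC * specnorm XDh)) eA eC eCh eDh) ae)
  (bdm_integrable br).
rewrite -I1 -I2 //.
Qed.

Theorem theorem1p1 (R : realType) (T : R) (n m k : nat) (E : ere_data R n m k)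
  (delta : R) (Qh : 'M[R]_n) (Rh : 'M[R]_k) (Mh Nh : 'M[R]_m)
  (G1h : 'M[R]_n) (G2h : 'M[R]_m)
  (T_gt0 : 0 < T) (n_gt0 : (1 <= n)%N) (m_gt0 : (1 <= m)%N) (k_gt0 : (1 <= k)%N)
  (* (a) *)
  (hA : Linfty T (cA E)) (hC : Linfty T (cC E))
  (hB : Linfty T (cB E)) (hD : Linfty T (cD E))
  (hAh : Linfty T (cAh E)) (hBh : Linfty T (cBh E))
  (hCh : Linfty T (cCh E)) (hDh : Linfty T (cDh E))
  (hQ : continuous_sym2 T (cQ E)) (hR : continuous_sym2 T (cR E))
  (hM : continuous_sym2 T (cM E)) (hN : continuous_sym2 T (cN E))
  (hG1 : continuous_sym1 T (cG1 E)) (hG2 : continuous_sym1 T (cG2 E))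
  (* (b) *)
  (delta_gt0 : 0 < delta)
  (hb : forall t s : R, 0 <= t -> t <= s -> s <= T ->
    [/\ lemx delta%:M (cR E t s), lemx delta%:M (cG2 E t)
      & [/\ lemx 0 (cQ E t s), lemx 0 (cM E t s), lemx 0 (cN E t s)
          & lemx 0 (cG1 E t)]])
  (* (c) *)
  (hQh : posdef Qh) (hRh : posdef Rh) (hMh : posdef Mh) (hNh : posdef Nh)
  (hG1h : posdef G1h) (hG2h : posdef G2h)
  (hc : forall t tau s : R, 0 <= t -> t <= tau -> tau <= s -> s <= T ->
    (lemx (cQ E t s) (cQ E tau s) /\ lemx (cQ E tau s) Qh) /\
    (lemx (cR E t s) (cR E tau s) /\ lemx (cR E tau s) Rh) /\
    (lemx (cM E t s) (cM E tau s) /\ lemx (cM E tau s) Mh) /\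
    (lemx (cN E t s) (cN E tau s) /\ lemx (cN E tau s) Nh) /\
    (lemx (cG1 E t) (cG1 E tau) /\ lemx (cG1 E tau) G1h) /\
    (lemx (cG2 E t) (cG2 E tau) /\ lemx (cG2 E tau) G2h)) :
  exists (P1 : R -> R -> 'M[R]_n) (P2 : R -> 'M[R]_(m, n)),
    [/\ ere_solution T E P1 P2,
        forall (P1' : R -> R -> 'M[R]_n) (P2' : R -> 'M[R]_(m, n)),
          ere_solution T E P1' P2' ->
          (forall t s : R, triangle T (t, s) -> P1' t s = P1 t s) /\
          (forall s : R, 0 <= s <= T -> P2' s = P2 s)
      & (ereal_sup [set (specnorm (P1 t t + (P2 t)^T *m cG2 E t *m P2 t))%:E
                     | t in `[0%R, T]]
         <= (CstarV T E delta Qh Mh Nh G1h G2h)%:E)%E].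
Proof.
have T0 : 0 <= T by exact: ltW.
have [A' [bA mA eA]] := Linfty_clamp hA; have [B' [bB mB eB]] := Linfty_clamp hB.
have [C' [bC mC eC]] := Linfty_clamp hC; have [D' [bD mD eD]] := Linfty_clamp hD.
have [Ah' [bAh mAh eAh]] := Linfty_clamp hAh; have [Bh' [bBh mBh eBh]] := Linfty_clamp hBh.
have [Ch' [bCh mCh eCh]] := Linfty_clamp hCh; have [Dh' [bDh mDh eDh]] := Linfty_clamp hDh.
have [KQ KQ0 [bQ mQ _ sQ cQ_]] := continuous_sym2_tame T0 hQ.
have [KR KR0 [bR mR mRd sR cR_]] := continuous_sym2_tame T0 hR.
have [KM KM0 [bM mM _ sM cM_]] := continuous_sym2_tame T0 hM.
have [KN KN0 [bN mN mNd sN cN_]] := continuous_sym2_tame T0 hN.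
have [KG1 KG10 [bG1 _ sG1 cG1_]] := continuous_sym1_tame T0 hG1.
have [KG2 KG20 [bG2 mG2 _ cG2_]] := continuous_sym1_tame T0 hG2.
pose tc := tclamp T.
(* The measurable coefficients are truncated at an essential bound and the times are projected onto
   [0, T]; assumptions (b) and (c) concern only times in [0, T] and survive. *)
pose E' := EreData A' B' C' D' Ah' Bh' Ch' Dh' (cH E)
  (fun t s => cQ E (tc t) (tc s)) (fun t s => cR E (tc t) (tc s))
  (fun t s => cM E (tc t) (tc s)) (fun t s => cN E (tc t) (tc s))
  (fun t => cG1 E (tc t)) (fun t => cG2 E (tc t)).
pose KE := KQ + KR + KM + KN + KG1 + KG2.
have tame_E' : tame T E' KE.
  split=> //=.
  - by move=> t s i j; apply: (le_trans (bQ t s i j)); rewrite /KE; lra.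
  - by move=> t s i j; apply: (le_trans (bR t s i j)); rewrite /KE; lra.
  - by move=> t s i j; apply: (le_trans (bM t s i j)); rewrite /KE; lra.
  - by move=> t s i j; apply: (le_trans (bN t s i j)); rewrite /KE; lra.
  - by move=> t i j; apply: (le_trans (bG1 t i j)); rewrite /KE; lra.
  - by move=> t i j; apply: (le_trans (bG2 t i j)); rewrite /KE; lra.
  - move=> e e0.
    have [d1 d10 h1] := cQ_ e e0; have [d2 d20 h2] := cR_ e e0.
    have [d3 d30 h3] := cM_ e e0; have [d4 d40 h4] := cN_ e e0.
    have [d5 d50 h5] := cG1_ e e0; have [d6 d60 h6] := cG2_ e e0.
    exists (Num.min d1 (Num.min d2 (Num.min d3 (Num.min d4 (Num.min d5 d6))))).
      by rewrite !lt_min d10 d20 d30 d40 d50.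
    move=> t t'; rewrite !lt_min => /andP[k1 /andP[k2 /andP[k3 /andP[k4 /andP[k5 k6]]]]] s.
    split; [exact: h1|exact: h2|exact: h3|split; [exact: h4|exact: h5|exact: h6]].
have tcE t : 0 <= t <= T -> tc t = t by move=> /andP[? ?]; exact: tclamp_id.
have tcE' t : 0 <= t -> t <= T -> tc t = t by exact: tclamp_id.
have same : {ae (@lebesgue_measure R), forall s, s \in `[0, T] -> same_at T E' E s}.
  have := ae_and eA (ae_and eB (ae_and eC (ae_and eD (ae_and eAh (ae_and eBh
    (ae_and eCh eDh)))))).
  apply: ae_mono => s [qA [qB [qC [qD [qAh [qBh [qCh qDh]]]]]]] sT.
  have sT' : 0 <= s <= T by move: sT; rewrite in_itv.
  move: qA qB qC qD qAh qBh qCh qDh => /(_ sT) qA /(_ sT) qB /(_ sT) qC /(_ sT) qD.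
  move=> /(_ sT) qAh /(_ sT) qBh /(_ sT) qCh /(_ sT) qDh.
  by split=> //= [t tT|t tT|t tT|t tT|]; rewrite !tcE.
have same' : {ae (@lebesgue_measure R), forall s, s \in `[0, T] -> same_at T E E' s}.
  by apply: ae_mono same => s h sT; apply: same_at_sym; exact: h.
have meas_E' : meas_data T E'.
  split=> //=; try exact: bdmmx_mxmeas.
have meas_E : meas_data T E.
  have onT (f g : R -> R) : (forall s, 0 <= s <= T -> f s = g s) ->
      measurable_fun `[0, T] f -> measurable_fun `[0, T] g.
    move=> fg; apply: eq_measurable_fun => s /set_mem/=.
    by rewrite in_itv; exact: fg.
  split=> //.
  - by move=> t tT i j; apply: onT (mQ t i j) => s sT; rewrite -/tc !tcE.
  - by move=> t tT i j; apply: onT (mR t i j) => s sT; rewrite -/tc !tcE.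
  - by move=> t tT i j; apply: onT (mM t i j) => s sT; rewrite -/tc !tcE.
  - by move=> t tT i j; apply: onT (mN t i j) => s sT; rewrite -/tc !tcE.
  - by move=> i j; apply: onT (mRd i j) => s sT; rewrite -/tc !tcE.
  - by move=> i j; apply: onT (mNd i j) => s sT; rewrite -/tc !tcE.
  - by move=> i j; apply: onT (mG2 i j) => s sT; rewrite -/tc !tcE.
have hb' : coercive_data T E' delta.
  move=> t s t0 ts sT; have s0 := le_trans t0 ts; have tT := le_trans ts sT.
  by rewrite /= !tcE'//; exact: hb.
have hc' : monotone_data T E' Qh Rh Mh Nh G1h G2h.
  move=> t tau s t0 tt ts sT; have tau0 := le_trans t0 tt; have s0 := le_trans tau0 ts.
  have tauT := le_trans ts sT; have tT := le_trans tt tauT.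
  by rewrite /= !tcE'//; exact: hc.
have G1E t : 0 <= t <= T -> cG1 E t = cG1 E' t by move=> tT; rewrite /= tcE.
have back P1 P2 : ere_solution T E' P1 P2 -> ere_solution T E P1 P2.
  by apply: (ere_transfer meas_E' meas_E same) => // t /G1E.
have forth P1 P2 : ere_solution T E P1 P2 -> ere_solution T E' P1 P2.
  exact: (ere_transfer meas_E meas_E' same' erefl G1E).
(* By [back] and [forth] the two equations have the same solutions, so existence, uniqueness and the
   bound all carry over from E'. *)
have [P1 [P2 sol]] := ere_exists T0 tame_E' delta_gt0 hb' hc' n_gt0.
exists P1, P2; split; first exact: back.
  move=> P1' P2' /forth sol'.
  exact: (ere_unique T0 tame_E' delta_gt0 hb' hc' n_gt0 sol sol').
apply: ge_ereal_sup => _ [t /= tT <-]; move: tT; rewrite in_itv/= => tT.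
have /andP[t0 tT'] := tT.
have G2e : cG2 E' t = cG2 E t by rewrite /= tcE.
have := ere_value_bound T0 tame_E' delta_gt0 hb' hc' n_gt0 sol t0 tT'.
have Ce := @CstarV_ae R T n m k E E' delta Qh Mh Nh G1h G2h bA bC bAh bCh bDh meas_E same erefl.
rewrite [X in _ <= X]Ce G2e => vb.
by rewrite lee_fin; exact: vb.
Qed.
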